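(* Let $Y={\mathbf X}\theta_0+W$ where ${\mathbf X}\in\mathbb{R}^{n\times p}$ has i.i.d. rows $X_i\sim\mathsf{N}(0,\Sigma)$ with $\Sigma\succ0$ and $\Sigma_{i,i}\le1$, $W\sim\mathsf{N}(0,\sigma^2I_{n\times n})$ independent of ${\mathbf X}$, $\theta_0\in\mathbb{R}^p$, $S=\mathrm{supp}(\theta_0)$, $s_0=|S|$. Let $T_0,v_0$ be as in the context, $t_0=|T_0|$. Assume (i) $\sigma_{\min}(\Sigma_{T_0,T_0})\ge C_{\min}>0$; (ii) $\|\Sigma_{T_0^c,T_0}\Sigma_{T_0,T_0}^{-1}v_{0,T_0}\|_\infty\le1-\eta$ for some $\eta>0$; $\lambda=\frac{4\sigma}{\eta}\sqrt{\frac{c_1\log p}{n}}$ with $c_1>1$; (iii) for some $c_2>0$, $|\theta_{0,i}|\ge c_2\lambda+\frac32\lambda|[\Sigma_{T_0,T_0}^{-1}v_{0,T_0}]_i|$ for $i\in S$ and $|[\Sigma_{T_0,T_0}^{-1}v_{0,T_0}]_i|\ge2c_2$ for $i\in T_0\setminus S$; $\eta\le c_2\sqrt{C_{\min}}$; and $n\ge\max(M_1,M_3)t_0\log p$ where $M_1=\frac{74c_1}{\eta^2C_{\min}}$, $M_3=\frac{32^2c_1}{c_2^2C_{\min}^2}$. Suppose moreover $n\ge\max(\widetilde M_1,\widetilde M_3)s_0\log p$ with $\widetilde M_j=\big(1+\frac{4\|\Sigma\|_2}{\kappa(s_0,1)}\big)M_j$. Let $\widehat\theta^{\mathrm{GL}}$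 and $\widehat S$ be the Gauss-Lasso estimator and selected model computed with this $\lambda$. Then for every $\mu>0$ $$\mathbb{P}\big(\|\widehat\theta^{\mathrm{GL}}-\theta_0\|_\infty\ge\mu\big)\le p\,e^{-n/10}+6e^{-s_0/2}+8p^{1-c_1}+2p\,e^{-nC_{\min}\mu^2/(2\sigma^2)},$$ and $$\mathbb{P}(\widehat S=S)\ge1-p\,e^{-n/10}-6e^{-s_0/2}-10p^{1-c_1}.$$
   Context: $\widehat\theta^n(\lambda)$ minimizes $\frac{1}{2n}\|Y-{\mathbf X}\theta\|_2^2+\lambda\|\theta\|_1$. Gauss-Lasso: $T=\mathrm{supp}(\widehat\theta^n)$, $\widehat\theta^{\mathrm{GL}}_T=({\mathbf X}_T^{\sf T}{\mathbf X}_T)^{-1}{\mathbf X}_T^{\sf T}Y$, $\widehat\theta^{\mathrm{GL}}_{T^c}=0$; with $\widehat\theta^{\mathrm{GL}}_{(s_0)}$ the $s_0$-th largest entry in modulus, $\widehat S=\{i:|\widehat\theta^{\mathrm{GL}}_i|\ge|\widehat\theta^{\mathrm{GL}}_{(s_0)}|\}$. $\widehat\theta^\infty(\xi)$ is the unique minimizer of $\frac12\langle\theta-\theta_0,\Sigma(\theta-\theta_0)\rangle+\xi\|\theta\|_1$; there exist $\xi_0>0$, $T_0\subseteq[p]$, $v_0\in\{-1,0,+1\}^p$ with $\mathrm{sign}(\widehat\theta^\infty(\xi))=v_0$, $\mathrm{supp}(\widehat\theta^\infty(\xi))=\mathrm{supp}(v_0)=T_0$ for $\xi\in(0,\xi_0)$,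 $T_0\supseteq S$, $v_{0,S}=\mathrm{sign}(\theta_{0,S})$. $\kappa(s,c_0)=\min_{|J|\le s}\min_{\|u_{J^c}\|_1\le c_0\|u_J\|_1}\langle u,\Sigma u\rangle/\|u\|_2^2$. $\mathrm{sign}(u)_i=+1,0,-1$ as $u_i>0,=0,<0$; $A_{I,J}$ submatrix; $A^{-1}_{I,I}=(A_{I,I})^{-1}$; $\sigma_{\min}$ minimum singular value. *)

(* Defs.v *)
From HB Require Import structures.
From mathcomp Require Import all_boot all_order all_algebra.
From mathcomp Require Import all_classical all_reals all_analysis.
Set Implicit Arguments. Unset Strict Implicit. Unset Printing Implicit Defensive.
Import Order.TTheory GRing.Theory Num.Theory.
Local Open Scope classical_set_scope.
Local Open Scope ring_scope.

Definition vsupp (R : realType) (p : nat) (v : 'cV[R]_p) : {set 'I_p} :=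
  [set i | v i 0 != 0].
Definition l1 (R : realType) (p : nat) (v : 'cV[R]_p) : R := \sum_i `|v i 0|.
Definition l2sq (R : realType) (p : nat) (v : 'cV[R]_p) : R := \sum_i v i 0 ^+ 2.
Definition l2 (R : realType) (p : nat) (v : 'cV[R]_p) : R := Num.sqrt (l2sq v).
Definition linf (R : realType) (p : nat) (v : 'cV[R]_p) : R :=
  \big[Num.max/0]_i `|v i 0|.
Definition qform (R : realType) (p : nat) (A : 'M[R]_p) (u : 'cV[R]_p) : R :=
  (u^T *m A *m u) 0 0.

Definition subm (R : realType) (m p : nat) (I : {set 'I_m}) (J : {set 'I_p})
  (A : 'M[R]_(m, p)) : 'M[R]_(#|I|, #|J|) :=
  mxsub (fun k : 'I_#|I| => enum_val k) (fun k : 'I_#|J| => enum_val k) A.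
Definition subcols (R : realType) (n p : nat) (T : {set 'I_p}) (X : 'M[R]_(n, p))
  : 'M[R]_(n, #|T|) := colsub (fun k : 'I_#|T| => enum_val k) X.
Definition subv (R : realType) (p : nat) (T : {set 'I_p}) (v : 'cV[R]_p)
  : 'cV[R]_#|T| := rowsub (fun k : 'I_#|T| => enum_val k) v.
Definition extv (R : realType) (p : nat) (T : {set 'I_p}) (u : 'cV[R]_#|T|)
  : 'cV[R]_p := \col_i \sum_(k : 'I_#|T| | enum_val k == i) u k 0.

Definition lasso_obj (R : realType) (n p : nat) (X : 'M[R]_(n, p)) (Y : 'cV[R]_n)
  (lam : R) (th : 'cV[R]_p) : R :=
  (2 * n%:R)^-1 * l2sq (Y - X *m th) + lam * l1 th.
Definition is_lasso (R : realType) (n p : nat) (X : 'M[R]_(n, p)) (Y : 'cV[R]_n)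
  (lam : R) (th : 'cV[R]_p) : Prop :=
  forall th', lasso_obj X Y lam th <= lasso_obj X Y lam th'.

Definition gauss_lasso (R : realType) (n p : nat) (X : 'M[R]_(n, p)) (Y : 'cV[R]_n)
  (th : 'cV[R]_p) : 'cV[R]_p :=
  let T := vsupp th in
  let XT := subcols T X in
  extv (invmx (XT^T *m XT) *m XT^T *m Y).

(* |v_(k)| : the k-th largest entry in modulus (k >= 1) *)
Definition kth_largest_abs (R : realType) (p : nat) (v : 'cV[R]_p) (k : nat) : R :=
  nth 0 (sort (fun a b : R => b <= a) [seq `|v i 0| | i <- enum 'I_p]) k.-1.
Definition selected_model (R : realType) (p : nat) (v : 'cV[R]_p) (s0 : nat)
  : {set 'I_p} := [set i | kth_largest_abs v s0 <= `|v i 0|].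

Definition pop_obj (R : realType) (p : nat) (Sig : 'M[R]_p) (th0 : 'cV[R]_p)
  (xi : R) (th : 'cV[R]_p) : R :=
  2^-1 * qform Sig (th - th0) + xi * l1 th.
Definition is_pop_min (R : realType) (p : nat) (Sig : 'M[R]_p) (th0 : 'cV[R]_p)
  (xi : R) (th : 'cV[R]_p) : Prop :=
  forall th', pop_obj Sig th0 xi th <= pop_obj Sig th0 xi th'.

Definition sigma_min (R : realType) (m : nat) (A : 'M[R]_m) : R :=
  inf [set l2 (A *m u) / l2 u | u in [set u : 'cV[R]_m | u != 0]].
Definition opnorm2 (R : realType) (m : nat) (A : 'M[R]_m) : R :=
  sup [set l2 (A *m u) / l2 u | u in [set u : 'cV[R]_m | u != 0]].
Definition kappa (R : realType) (p : nat) (Sig : 'M[R]_p) (s : nat) (c0 : R) : R :=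
  inf [set qform Sig u / l2sq u | u in
        [set u : 'cV[R]_p | u != 0 /\
           exists J : {set 'I_p}, (#|J| <= s)%N /\
             \sum_(i in ~: J) `|u i 0| <= c0 * \sum_(i in J) `|u i 0| ]].

Definition mutually_independent (R : realType) (d : measure_display)
  (Om : measurableType d) (P : probability Om R) (I : finType) (f : I -> Om -> R)
  : Prop :=
  forall B : I -> set R, (forall i, measurable (B i)) ->
    P [set w | forall i, B i (f i w)] =
    (\prod_(i : I) fine (P (f i @^-1` B i)))%:E.

Definition iid_std_normal (R : realType) (d : measure_display)
  (Om : measurableType d) (P : probability Om R) (I : finType) (f : I -> Om -> R)
  : Prop :=
  [/\ forall i, measurable_fun setT (f i),
      forall i (B : set R), measurable B -> P (f i @^-1` B) = normal_prob 0 1 B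
    & mutually_independent P f].

Definition gauss_family (R : realType) (Om : Type) (n p : nat)
  (Z : 'I_n -> 'I_p -> Om -> R) (G : 'I_n -> Om -> R)
  : ('I_n * 'I_p) + 'I_n -> Om -> R :=
  fun k => match k with inl ij => Z ij.1 ij.2 | inr i => G i end.

(* design X = Z A : rows X_i = Z_i A ~ N(0, A^T A) i.i.d. *)
Definition design (R : realType) (Om : Type) (n p : nat)
  (Z : 'I_n -> 'I_p -> Om -> R) (A : 'M[R]_p) (w : Om) : 'M[R]_(n, p) :=
  (\matrix_(i, j) Z i j w) *m A.
(* Y = X th0 + W with W = sigma G ~ N(0, sigma^2 I_n) *)
Definition response (R : realType) (Om : Type) (n p : nat)
  (Z : 'I_n -> 'I_p -> Om -> R) (G : 'I_n -> Om -> R) (A : 'M[R]_p)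
  (th0 : 'cV[R]_p) (sigma : R) (w : Om) : 'cV[R]_n :=
  design Z A w *m th0 + sigma *: (\col_i G i w).

(* Main.v *)
Require Import Defs.
From HB Require Import structures.
From mathcomp Require Import all_boot all_order all_algebra.
From mathcomp Require Import all_classical all_reals all_analysis.
From mathcomp Require Import measurable_realfun ring lra.
Set Implicit Arguments. Unset Strict Implicit. Unset Printing Implicit Defensive.
Import Order.TTheory GRing.Theory Num.Theory.
Local Open Scope classical_set_scope.
Local Open Scope ring_scope.

(** Idea. A Gaussian column Z q is independent of the columns Z M with
    q^T M = 0, since a rotation of the standard Gaussian matrix Z sends q to an
    axis.  Writing X_T = Z A_T for the design restricted to T = T0, every entry of
    (X_T^T X_T)^-1 is thereby reduced to one column: for a direction u, put
    q = A_T (A_T^T A_T)^-1 u and let N be a basis of the orthogonal of u; then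
    u^T (X_T^T X_T)^-1 u = (u^T (A_T^T A_T)^-1 u)^2 / |r|^2, where r is the residual
    of Z q on the columns of X_T N, a chi-square variable up to scale.  Together
    with the Gaussian tails of the noise and of the off-support columns this gives a
    dual certificate, so that the Lasso has support T with probability at least
    1 - 6 p^(1-c1), and T contains S.  On that event the Gauss-Lasso error is
    sigma (X_T^T X_T)^-1 X_T^T G, whose i-th entry is, given Z, centred Gaussian with
    variance sigma^2 [(X_T^T X_T)^-1]_ii; averaging its tail over the chi-square
    residual yields the bound on the sup-norm error.  Taking mu = c2 lambda / 2, the
    s0 largest estimated entries are then exactly those of S. *)

(** * Gaussian integrals on the line and in the plane *)

(** The obstacle is that the conditional variance of the error is random. Bounding it on a good
    event would lose a factor 3/2 in the exponent [n Cmin mu^2 / (2 sigma^2)]. Instead the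
    conditional tail is averaged: the variance is a constant divided by a chi-square variable, so
    [exp(- mu^2 / (2 var))] is an exponential in that variable and its mean is an explicit Laplace
    transform. With [a = Cmin mu^2 / sigma^2] this gives the exponent [(n - t) / 2 * a / (1 + a)] in
    place of [n a / 2]; the discrepancy is paid by the factor 2 in front of [p] and, for large [mu],
    by terms in [p^(1-c1)] and [exp(- s0 / 2)]. Rates are measured by [L = c1 ln p]: a Gaussian tail
    at [2 sqrt L] is [exp(- 2 L)]. When [8 p^(1-c1) >= 1] the claim is trivial, so
    [exp(- L) < 1 / 8] may be assumed and terms [p exp(- 2 L)] are absorbed into [p exp(- L)].
    Gaussian integrals over [R^n] are iterated one-dimensional integrals, and independence is used
    as the right to resample one coordinate at a time. *)

Section Density.
Context {R : realType}.
Local Notation leb := (@lebesgue_measure R).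
Local Open Scope ereal_scope.

Let integral_normal_indic (m s : R) (E : set R) : measurable E ->
  \int[normal_prob m s]_x (\1_E x)%:E =
  \int[leb]_x ((\1_E x)%:E * (normal_pdf m s x)%:E).
Proof.
move=> mE; rewrite integral_indic// setIT /normal_prob.
rewrite [LHS]integral_mkcond; apply: eq_integral => x _.
rewrite patchE indicE; case: ifPn => _; rewrite ?mul1e ?mul0e//.
Qed.

Import HBNNSimple.

Let integral_normal_nnsfun (m s : R) (f : {nnsfun _ >-> R}) :
  \int[normal_prob m s]_x (f x)%:E =
  \int[leb]_x ((f x)%:E * (normal_pdf m s x)%:E).
Proof.
under [LHS]eq_integral do rewrite fimfunE -fsumEFin//.
rewrite [LHS]ge0_integral_fsum//; last 2 first.
  - by move=> r; exact/measurable_EFinP/measurableT_comp.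
  - by move=> r x _; rewrite nnfun_muleindic_ge0.
under eq_fsbigr => r _ do rewrite integralZl_indic_nnsfun//=.
rewrite [RHS](_ : _ = \int[leb]_x \sum_(r \in range f)
   (r * \1_(f @^-1` [set r]) x * normal_pdf m s x)%:E); last first.
  apply: eq_integral => x _; rewrite fimfunE fsumEFin//= -EFinM; congr EFin.
  by rewrite mulr_fsuml.
rewrite [RHS]ge0_integral_fsum//; last 2 first.
  - move=> r; apply/measurable_EFinP; apply: measurable_funM; last exact: measurable_normal_pdf.
    exact: measurableT_comp.
  - move=> r x _; rewrite lee_fin mulr_ge0// ?normal_pdf_ge0//.
    by rewrite -lee_fin nnfun_muleindic_ge0.
apply: eq_fsbigr => r rf.
rewrite integral_normal_indic; last exact: (@measurable_funPTI _ _ _ _ f).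
have r0 : (0 <= r)%R by move: rf; rewrite inE => -[x _ <-].
under [RHS]eq_integral do rewrite -mulrA EFinM.
rewrite [RHS]ge0_integralZl//=.
- by apply/measurable_EFinP; apply: measurable_funM; [exact: measurable_indic|exact: measurable_normal_pdf].
- by move=> x _; rewrite lee_fin mulr_ge0// normal_pdf_ge0.
Qed.

Lemma ge0_integral_normal (m s : R) (f : measurableTypeR R -> \bar R) :
  measurable_fun setT f -> (forall x, 0 <= f x) ->
  \int[normal_prob m s]_x f x = \int[leb]_x (f x * (normal_pdf m s x)%:E).
Proof.
move=> mf f0.
pose f_ := nnsfun_approx measurableT mf.
transitivity (limn (fun n => \int[normal_prob m s]_x (f_ n x)%:E)).
  rewrite -monotone_convergence//=.
  - apply: eq_integral => x _; apply/esym/cvg_lim => //=.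
    exact: cvg_nnsfun_approx.
  - by move=> n; apply/measurable_EFinP; exact: measurable_funTS.
  - by move=> n x _; rewrite lee_fin.
  - by move=> x _ a b ab; rewrite lee_fin; exact/lefP/nd_nnsfun_approx.
transitivity (limn (fun n => \int[leb]_x ((f_ n x)%:E * (normal_pdf m s x)%:E))).
  by apply: congr_lim; apply/funext => n; exact: integral_normal_nnsfun.
rewrite -monotone_convergence//=.
- apply: eq_integral => x _; apply/cvg_lim => //=.
  apply: cvgeZr => //; exact: cvg_nnsfun_approx.
- move=> n; apply: emeasurable_funM; first exact/measurable_EFinP/measurable_funTS.
  by apply/measurable_EFinP; exact: measurable_normal_pdf.
- by move=> n x _; rewrite -EFinM lee_fin mulr_ge0// normal_pdf_ge0.
- move=> x _ a b ab; rewrite -!EFinM lee_fin ler_wpM2r ?normal_pdf_ge0//.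
  exact/lefP/nd_nnsfun_approx.
Qed.

(** Rescaling the image measure by [c] gives a measure with the right values on half-open intervals,
    and these determine Lebesgue measure. *)
Lemma lebesgue_affine (c d : R) (E : set R) : (0 < c)%R -> measurable E ->
  leb ((fun x => c * x + d)%R @^-1` E) = (c^-1)%:E * leb E.
Proof.
move=> c0 mE.
have mf : measurable_fun setT (fun x : measurableTypeR R => (c * x + d)%R : measurableTypeR R).
  by apply: measurable_funD => //; apply: measurable_funM.
pose mu1 : {measure set (measurableTypeR R) -> \bar R} :=
  mscale (NngNum (ltW c0)) (pushforward leb (fun x : measurableTypeR R => (c * x + d)%R : measurableTypeR R)).
have : leb E = mu1 mf E.
  apply: lebesgue_measure_unique => // _ [[a b]] _ <-.
  rewrite /mu1/= /mscale/= /pushforward.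
  rewrite (_ : _ @^-1` _ = `]((a - d) / c)%R, ((b - d) / c)%R]%classic); last first.
    apply/seteqP; split => x /=; rewrite !in_itv/=;
    by rewrite ltr_pdivrMr// ler_pdivlMr// ltrBlDr lerBrDr (mulrC x).
  rewrite !lebesgue_measure_itv/= !lte_fin ltr_pM2r ?invr_gt0// ltrD2r.
  case: ifP => _; last by rewrite mule0.
  rewrite -EFinB -EFinM; congr EFin; field.
  by rewrite gt_eqF.
rewrite /mu1/= /mscale/= /pushforward => ->.
by rewrite muleA -EFinM mulVf ?mul1e// gt_eqF.
Qed.

Lemma ge0_integral_affine (c d : R) (f : R -> \bar R) : (0 < c)%R ->
  measurable_fun setT f -> (forall x, 0 <= f x) ->
  \int[leb]_x f (c * x + d)%R = (c^-1)%:E * \int[leb]_x f x.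
Proof.
move=> c0 mf f0.
have mphi : measurable_fun setT (fun x : measurableTypeR R => (c * x + d)%R : measurableTypeR R).
  by apply: measurable_funD => //; apply: measurable_funM.
have c0' : (0 <= c^-1)%R by rewrite invr_ge0 ltW.
rewrite -[c^-1%R]/((NngNum c0')%:num)%R -ge0_integral_mscale//.
rewrite -[LHS](ge0_integral_pushforward mphi leb measurableT)//.
apply: eq_measure_integral => /= A mA _.
by rewrite /pushforward lebesgue_affine.
Qed.

End Density.

Notation gam R := (@normal_prob R 0 1).

Section StdNormal.
Context {R : realType}.
Local Notation leb := (@lebesgue_measure R).
Local Notation RT := (measurableTypeR R).

Lemma normal_pdf01 (x : R) : normal_pdf 0 1 x = normal_peak 1 * expR (- x ^+ 2 / 2).
Proof. by rewrite normal_pdfE ?oner_eq0// /normal_fun subr0 expr1n. Qed.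

Local Open Scope ereal_scope.

(** Completing the square turns the integrand into a multiple of the normal density of mean
    [a / (1 + b)] and variance [1 / (1 + b)]. *)
Lemma integral_normal_expR (a b : R) : (0 < 1 + b)%R ->
  \int[gam R]_x (expR (a * x - b * x ^+ 2 / 2))%:E =
  ((Num.sqrt (1 + b))^-1 * expR (a ^+ 2 / (2 * (1 + b))))%:E.
Proof.
move=> b0.
have mf : measurable_fun setT (fun x : R => (expR (a * x - b * x ^+ 2 / 2))%:E).
  apply/measurable_EFinP; apply: measurableT_comp => //.
  apply: measurable_funB; first exact: measurable_funM.
  apply: measurable_funM => //; apply: measurable_funM => //; exact: measurable_funX.
rewrite ge0_integral_normal//.
set s := (Num.sqrt (1 + b))^-1%R.
have s2 : (s ^+ 2 = (1 + b)^-1)%R by rewrite exprVn sqr_sqrtr// ltW.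
have s0 : (0 < s)%R by rewrite invr_gt0 sqrtr_gt0.
have b1 : (1 + b)%R != 0%R by rewrite gt_eqF.
transitivity (\int[leb]_x ((s * expR (a ^+ 2 / (2 * (1 + b))))%:E
     * (normal_pdf (a / (1 + b)) s x)%:E)).
  apply: eq_integral => x _; rewrite -!EFinM; congr EFin.
  rewrite normal_pdf01 normal_pdfE ?gt_eqF//= /normal_fun.
  have -> : (@normal_peak R 1 = s * normal_peak s)%R.
    rewrite /normal_peak expr1n mul1r -mulrnAr sqrtrM ?sqr_ge0// sqrtr_sqr gtr0_norm//.
    by rewrite invfM mulrA mulfV ?mul1r// gt_eqF.
  rewrite [LHS]mulrCA [RHS]mulrACA; congr (_ * _)%R.
  rewrite -!expRD; congr expR.
  by rewrite s2; field.
rewrite ge0_integralZl//=.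
- by rewrite integral_normal_pdf mule1.
- by apply/measurable_EFinP; exact: measurable_normal_pdf.
- by move=> x _; rewrite lee_fin normal_pdf_ge0.
- by rewrite lee_fin mulr_ge0// ?expR_ge0// ltW.
Qed.

Let rot (c s : R) (z : RT * RT) : RT * RT := (c * z.1 + s * z.2, - s * z.1 + c * z.2)%R.

Let measurable_rot c s : measurable_fun setT (rot c s).
Proof.
by apply/measurable_fun_pairP; split; apply: measurable_funD; apply: measurable_funM.
Qed.

Let int2 (F : RT * RT -> \bar R) := \int[gam R]_x \int[gam R]_y F (x, y).

Let int2E (F : RT * RT -> \bar R) : measurable_fun setT F -> (forall z, 0 <= F z) ->
  int2 F = \int[leb]_x \int[leb]_y
     (F (x, y) * (normal_pdf 0 1 x * normal_pdf 0 1 y)%:E).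
Proof.
move=> mF F0; rewrite /int2 ge0_integral_normal; first last.
- by move=> x; apply: integral_ge0.
- exact: (measurable_fun_fubini_tonelli_F (m2 := gam R) F).
apply: eq_integral => x _.
rewrite ge0_integral_normal//; last exact: measurable_fun_pair2.
rewrite -ge0_integralZr//=.
- by apply: eq_integral => y _; rewrite -muleA -EFinM [X in (_ * X%:E)%E]mulrC.
- apply: emeasurable_funM; first exact: measurable_fun_pair2.
  by apply/measurable_EFinP; exact: measurable_normal_pdf.
- by move=> y _; rewrite mule_ge0// lee_fin normal_pdf_ge0.
- by rewrite lee_fin normal_pdf_ge0.
Qed.

(** A rotation with positive cosine splits into two affine substitutions of one variable:
    [u = c x + s y] at fixed [y], after which the second coordinate reads [(y - s u) / c]. The
    Jacobians [1 / c] and [c] cancel, and the Gaussian weight depends on [x^2 + y^2] only. *)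
Let int2_rot_pos c s (F : RT * RT -> \bar R) : (0 < c)%R -> (c ^+ 2 + s ^+ 2 = 1)%R ->
  measurable_fun setT F -> (forall z, 0 <= F z) ->
  int2 (F \o rot c s) = int2 F.
Proof.
move=> c0 cs mF F0.
have mFr : measurable_fun setT (F \o rot c s) by exact: measurableT_comp.
rewrite (int2E mFr (fun z => F0 _)) (int2E mF F0).
have c1 : c != 0%R by rewrite gt_eqF.
pose H (z : RT * RT) := F z * (normal_pdf 0 1 z.1 * normal_pdf 0 1 z.2)%:E.
have mH : measurable_fun setT H.
  apply: emeasurable_funM => //; apply/measurable_EFinP; apply: measurable_funM;
  by apply: measurableT_comp => //; exact: measurable_normal_pdf.
have H0 z : 0 <= H z by rewrite mule_ge0// lee_fin mulr_ge0// normal_pdf_ge0.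
have s2 : (s ^+ 2 = 1 - c ^+ 2)%R by rewrite -cs; ring.
transitivity (\int[leb]_x \int[leb]_y (H \o rot c s) (x, y)).
  apply: eq_integral => x _; apply: eq_integral => y _.
  rewrite /H/=; congr (_ * _%:E); rewrite !normal_pdf01.
  rewrite mulrACA [RHS]mulrACA; congr (_ * _)%R; rewrite -!expRD; congr expR.
  rewrite -!mulrDl -!opprD; congr (- _ / _)%R.
  rewrite [RHS](_ : _ = (c ^+ 2 + s ^+ 2) * (x ^+ 2 + y ^+ 2))%R; last ring.
  by rewrite cs mul1r.
have mHr : measurable_fun setT (H \o rot c s) by exact: measurableT_comp.
transitivity (\int[leb]_y \int[leb]_x (H \o rot c s) (x, y)).
  exact: (fubini_tonelli (m1 := leb) (m2 := leb) _ mHr (fun z => H0 _)).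
pose K (z : RT * RT) := H (z.1, (z.2 - s * z.1) / c)%R.
have mk : measurable_fun setT (fun z : RT * RT => (z.2 - s * z.1) / c)%R.
  apply: measurable_funM => //; apply: measurable_funB => //; exact: measurable_funM.
have mK : measurable_fun setT K.
  exact: (measurableT_comp mH (measurable_fun_pair measurable_fst mk)).
have K0 z : 0 <= K z by exact: H0.
have ci0 : (0 <= c^-1)%R by rewrite invr_ge0 ltW.
transitivity (\int[leb]_y ((c^-1)%:E * \int[leb]_x K (x, y))).
  apply: eq_integral => y _.
  have mKy : measurable_fun setT (fun x => K (x, y)) by exact: (measurable_fun_pair1 y mK).
  apply: etrans (@ge0_integral_affine R c (s * y) _ c0 mKy (fun x => K0 _)).
  apply: eq_integral => x _; rewrite /K /= /rot/=.
  by congr (H (_, _)); rewrite mulrDr (mulrA s s) -expr2 s2; field; exact: c1.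
apply: (etrans (ge0_integralZl _ _ _ _ _)) => //.
- exact: (measurable_fun_fubini_tonelli_G (m1 := leb) _ mK K0).
- by move=> y _; apply: integral_ge0 => x _; exact: K0.
apply: (etrans (congr1 (fun z => (c^-1)%:E * z)
  (esym (fubini_tonelli (m1 := leb) (m2 := leb) _ mK K0)))).
apply: (etrans (esym (ge0_integralZl _ _ _ _ _))) => //.
- exact: (measurable_fun_fubini_tonelli_F (m2 := leb) _ mK K0).
- by move=> y _; apply: integral_ge0 => x _; exact: K0.
apply: eq_integral => x _.
have mHx : measurable_fun setT (fun y => H (x, y)) by exact: (measurable_fun_pair2 x mH).
have ci : (0 < c^-1)%R by rewrite invr_gt0.
have := @ge0_integral_affine R c^-1 (- s * x / c) _ ci mHx (fun y => H0 _).
rewrite invrK => e.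
transitivity ((c^-1)%:E * \int[leb]_y H (x, c^-1 * y + - s * x / c)%R).
  apply: (congr1 (fun z => (c^-1)%:E * z)); apply: eq_integral => y _.
  by rewrite /K/=; congr (H (_, _)); field.
by rewrite e muleA -EFinM mulVf// mul1e.
Qed.

Let rot_comp c s c' s' (z : RT * RT) :
  rot c' s' (rot c s z) = rot (c' * c - s' * s) (s' * c + c' * s) z.
Proof. by rewrite /rot/=; congr pair; ring. Qed.

Let int2_rot_gtN1 c s (F : RT * RT -> \bar R) : (-1 < c)%R -> (c ^+ 2 + s ^+ 2 = 1)%R ->
  measurable_fun setT F -> (forall z, 0 <= F z) ->
  int2 (F \o rot c s) = int2 F.
Proof.
move=> c0 cs mF F0.
(* [c'] and [s'] are the cosine and sine of the half-angle, whose cosine is positive because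
   [c > -1]; the rotation is the square of that one. *)
pose c' := Num.sqrt ((1 + c) / 2).
have h0 : (0 < (1 + c) / 2)%R by rewrite divr_gt0//; lra.
have c'0 : (0 < c')%R by rewrite sqrtr_gt0.
have c'2 : (c' ^+ 2 = (1 + c) / 2)%R by rewrite sqr_sqrtr// ltW.
pose s' := (s / (2 * c'))%R.
have c'n0 : c' != 0%R by rewrite gt_eqF.
have s'2 : (s' ^+ 2 = (1 - c) / 2)%R.
  have -> : (s' ^+ 2 = s ^+ 2 / (4 * c' ^+ 2))%R by rewrite /s'; field.
  have -> : (s ^+ 2 = 1 - c ^+ 2)%R by rewrite -cs; ring.
  rewrite (_ : 1 - c ^+ 2 = (1 - c) * (1 + c))%R; last ring.
  by rewrite c'2; field; rewrite gt_eqF//; lra.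
have cs' : (c' ^+ 2 + s' ^+ 2 = 1)%R by rewrite c'2 s'2; field.
apply: (etrans _ (int2_rot_pos c'0 cs' mF F0)).
have mFr : measurable_fun setT (F \o rot c' s') by exact: measurableT_comp.
apply: (etrans _ (int2_rot_pos c'0 cs' mFr (fun z => F0 _))).
congr int2; apply/funext => z /=; rewrite rot_comp; congr (F (rot _ _ z)).
  by rewrite -!expr2 c'2 s'2; field.
by rewrite /s'; field.
Qed.

Lemma integral_normal2_rot c s (F : RT * RT -> \bar R) : (c ^+ 2 + s ^+ 2 = 1)%R ->
  measurable_fun setT F -> (forall z, 0 <= F z) ->
  \int[gam R]_x \int[gam R]_y F (c * x + s * y, - s * x + c * y)%R =
  \int[gam R]_x \int[gam R]_y F (x, y).
Proof.
move=> cs mF F0; rewrite -/(int2 F) -[LHS]/(int2 (F \o rot c s)).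
have [c1|c1] := ltP (-1)%R c; first exact: int2_rot_gtN1.
have cN1 : c = (-1)%R.
  apply/eqP; rewrite eq_le c1/=.
  have : (c ^+ 2 <= 1)%R by rewrite -cs lerDl sqr_ge0.
  by move: c1 => /[swap] ; nra.
have s0 : s = 0%R.
  apply/eqP; rewrite -sqrf_eq0; apply/eqP; move: cs; rewrite cN1; lra.
(* The remaining case is the half turn, which is two quarter turns. *)
have h : (0 ^+ 2 + 1 ^+ 2 = 1 :> R)%R by ring.
have h1 : (-1 < 0 :> R)%R by lra.
apply: (etrans _ (int2_rot_gtN1 h1 h mF F0)).
have mFr : measurable_fun setT (F \o rot 0 1) by exact: measurableT_comp.
apply: (etrans _ (int2_rot_gtN1 h1 h mFr (fun z => F0 _))).
congr int2; apply/funext => z /=; rewrite rot_comp cN1 s0; congr (F (rot _ _ z)); ring.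
Qed.

End StdNormal.

Section Tail.
Context {R : realType}.
Local Notation leb := (@lebesgue_measure R).
Local Notation RT := (measurableTypeR R).
Local Open Scope ereal_scope.

(** Translation by [t] multiplies the density at [u] by [exp(- u t - t^2 / 2)], and [u t >= 0] on
    the event disposes of the cross term. *)
Let shift_le (t : R) (A B : set RT) : measurable A -> measurable B ->
  (forall u, A (u + t)%R -> B u /\ (0 <= u * t)%R) ->
  gam R A <= (expR (- t ^+ 2 / 2))%:E * gam R B.
Proof.
move=> mA mB AB.
rewrite -[A]setIT -[B]setIT -!integral_indic//.
have mi (E : set RT) : measurable E -> measurable_fun setT (fun x : RT => (\1_E x)%:E : \bar R).
  by move=> mE; apply/measurable_EFinP; exact: measurable_indic.
rewrite !ge0_integral_normal//; try exact: mi.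
have mp : measurable_fun setT (fun x : RT => (normal_pdf 0 1 x)%:E : \bar R).
  by apply/measurable_EFinP; exact: measurable_normal_pdf.
have := @ge0_integral_affine R 1 t (fun x => (\1_A x)%:E * (normal_pdf 0 1 x)%:E) ltr01.
rewrite invr1 mul1e => <-; first last.
- by move=> x; rewrite mule_ge0// lee_fin normal_pdf_ge0.
- by apply: emeasurable_funM => //; exact: mi.
rewrite -ge0_integralZl//=; first last.
- by move=> x _; rewrite mule_ge0// lee_fin normal_pdf_ge0.
- by apply: emeasurable_funM => //; exact: mi.
apply: ge0_le_integral => //=.
- by move=> x _; rewrite mule_ge0// lee_fin normal_pdf_ge0.
- have mf : measurable_fun setT (fun x : RT => 1 * x + t : RT)%R.
    by apply: measurable_funD => //; exact: measurable_funM.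
  apply: emeasurable_funM.
    exact: (measurableT_comp (mi _ mA) mf).
  exact: (measurableT_comp mp mf).
- by apply: emeasurable_funM => //; apply: emeasurable_funM => //; exact: mi.
move=> x _; rewrite -!EFinM lee_fin mul1r !indicE.
case: (boolP (_ \in A)) => [xA|]; last first.
  by move=> _; rewrite mul0r mulr_ge0// ?expR_ge0// mulr_ge0// normal_pdf_ge0.
rewrite inE in xA; have [xB xt] := AB _ xA.
rewrite mem_set// !mul1r !normal_pdf01 mulrCA ler_wpM2l ?normal_peak_ge0//.
by rewrite -expRD ler_expR -mulrDl ler_pM2r// ; nra.
Qed.

(** Each tail is a translate of a half-line, and the two half-lines have total mass one; hence no
    factor 2. *)
Lemma normal_tail (t : R) : (0 <= t)%R ->
  gam R [set x | (t <= `|x|)%R] <= (expR (- t ^+ 2 / 2))%:E.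
Proof.
move=> t0.
have -> : [set x : R | (t <= `|x|)%R] = `]-oo, (- t)%R] `|` `[t, +oo[.
  apply/seteqP; split => x /=; rewrite !in_itv/= ?andbT lerNr ler_normr.
    by move/orP => [|]; [right|left].
  by move=> [->|->]; rewrite ?orbT.
apply: le_trans; first exact: measureU2.
apply: le_trans.
  apply: leeD.
    apply: (@shift_le (- t) _ `]-oo, 0%R]) => //.
    by move=> u; rewrite /= !in_itv/= => h; split; [lra|nra].
  apply: (@shift_le t _ `[0%R, +oo[) => //.
  by move=> u; rewrite /= !in_itv/= !andbT => h; split; [lra|nra].
rewrite sqrrN -ge0_muleDr//.
rewrite -[leRHS]mule1; apply: lee_wpmul2l; first by rewrite lee_fin expR_ge0.
have -> : gam R `]-oo, 0%R] = gam R `]-oo, 0%R[.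
  rewrite -(setUitv1 (a := -oo%O) true)// measureU//=; last first.
    by apply/seteqP; split => x//= [] + xx; rewrite xx in_itv/= ltxx.
  rewrite [X in _ + X](_ : _ = 0) ?adde0//.
  have := @normal_prob_dominates R 0 1 => /null_content_dominatesP; apply => //.
  exact: lebesgue_measure_set1.
rewrite -measureU//=; last first.
  by apply/seteqP; split => x //= []; rewrite !in_itv/= andbT => ? ?; lra.
rewrite (_ : _ `|` _ = setT) ?probability_setT//.
by apply/seteqP; split => x //= _; rewrite !in_itv/= andbT; case: (ltP x 0%R); [left|right].
Qed.
End Tail.

(** * Families of independent standard normal variables *)

Definition upd (R : Type) (K : eqType) (v : K -> R) (k : K) (x : R) : K -> R :=
  fun k' => if k' == k then x else v k'.

(* Functions on the bare function space [K -> R] that become measurable after composition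
   with any measurable family; this avoids a product sigma-algebra. *)
Definition meas_fam (R : realType) (K : Type) (H : (K -> R) -> \bar R) : Prop :=
  forall d (T : measurableType d) (phi : K -> T -> R),
    (forall k, measurable_fun setT (phi k)) ->
    measurable_fun setT (fun t => H (phi ^~ t)).

Lemma measurable_forall d (T : measurableType d) (I : finType) (A : I -> set T) :
  (forall i, measurable (A i)) -> measurable [set w | forall i, A i w].
Proof.
move=> mA; rewrite (_ : mkset _ = \bigcap_(i in setT) A i).
  by apply: fin_bigcap_measurable => //; exact: finite_finset.
by apply/seteqP; split => w h i //; exact: h.
Qed.

(** The joint law of [(X, Y)] agrees on rectangles with the product of the law of [X] and [Q], hence
    everywhere; Tonelli then integrates [Y] out. *)
Lemma indep_integral d d1 d2 (Om : measurableType d) (T1 : measurableType d1)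
  (T2 : measurableType d2) (R : realType) (P : probability Om R)
  (Q : probability T2 R) (X : Om -> T1) (Y : Om -> T2) (F : T1 * T2 -> \bar R) :
  measurable_fun setT X -> measurable_fun setT Y ->
  (forall A B, measurable A -> measurable B ->
     P (X @^-1` A `&` Y @^-1` B) = (P (X @^-1` A) * Q B)%E) ->
  measurable_fun setT F -> (forall z, 0 <= F z)%E ->
  (\int[P]_w F (X w, Y w) = \int[P]_w \int[Q]_y F (X w, y))%E.
Proof.
move=> mX mY indep mF F0.
pose X' : {mfun Om >-> T1} := mfun_Sub (mem_set mX).
pose XY' : {mfun Om >-> (T1 * T2)%type} :=
  mfun_Sub (mem_set (measurable_fun_pair mX mY)).
transitivity (\int[distribution P XY']_z F z)%E.
  by rewrite ge0_integral_distribution.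
transitivity (\int[(distribution P X' \x Q)%E]_z F z)%E.
  apply: eq_measure_integral => A mA _.
  apply/esym; apply: (product_measure_unique (m1 := distribution P X') (m2 := Q)) => // B C mB mC.
apply: (etrans (fubini_tonelli1 _ mF F0)).
apply: (@ge0_integral_distribution _ _ _ _ _ P X' (fubini_F Q F)).
  exact: (measurable_fun_fubini_tonelli_F (m2 := Q) _ mF F0).
by move=> x; apply: integral_ge0.
Qed.

Section OneCoordinate.
Context (R : realType) (d : measure_display) (Om : measurableType d)
  (P : probability Om R) (K : finType) (f : K -> Om -> R).
Hypothesis iid : iid_std_normal P f.

Let mf k : measurable_fun setT (f k). Proof. by have [] := iid. Qed.

Lemma iid_rect (B : K -> set R) : (forall k, measurable (B k)) ->
  P [set w | forall k, B k (f k w)] = (\prod_k fine (gam R (B k)))%:E.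
Proof.
move=> mB; have [_ fE indep] := iid; rewrite indep//; congr EFin.
by apply: eq_bigr => k _; congr fine; exact: fE.
Qed.

Variable k : K.

(** A pi-system generating the sigma-algebra of the coordinates other than [k]; independence from
    coordinate [k] need only be checked on it. *)
Let rect : set_system Om := [set C | exists B : K -> set R,
  (forall k', measurable (B k')) /\ C = [set w | forall k', k' != k -> B k' (f k' w)]].

Let rectE (B : K -> set R) :
  [set w | forall k', k' != k -> B k' (f k' w)] =
  [set w | forall k', (if k' == k then setT else B k') (f k' w)].
Proof.
apply/seteqP; split => w /= h k'; last by have := h k' => /[swap] /negbTE ->.
by case: eqVneq => [//|/h].
Qed.

Let measurable_pre (B : K -> set R) : (forall k', measurable (B k')) ->
  measurable [set w | forall k', B k' (f k' w)].
Proof.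
move=> mB; apply: (@measurable_forall _ _ _ (fun k' => f k' @^-1` B k')) => k'.
by rewrite -[X in measurable X]setTI; exact: mf.
Qed.

Let measurable_rect : rect `<=` measurable.
Proof.
move=> _ [B [mB ->]]; rewrite rectE; apply: (@measurable_pre (fun k' => if k' == k then setT else B k')) => k'.
by case: ifP.
Qed.

Let rectI : setI_closed rect.
Proof.
move=> _ _ [B [mB ->]] [C [mC ->]]; exists (fun k' => B k' `&` C k'); split.
  by move=> k'; exact: measurableI.
apply/seteqP; split => w /=; first by move=> [h1 h2] k' kk; split; [exact: h1|exact: h2].
by move=> h; split => k' /h[].
Qed.

Let rectT : rect setT.
Proof. by exists (fun=> setT); split => //; apply/seteqP; split. Qed.

Let rect_indep (C : set Om) (B : set R) : <<s rect >> C -> measurable B ->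
  P (C `&` f k @^-1` B) = (P C * gam R B)%E.
Proof.
move=> sC mB.
have mD : measurable (f k @^-1` B) by rewrite -[X in measurable X]setTI; exact: mf.
have gB : gam R B \is a fin_num by rewrite fin_num_measure.
have gB0 : 0 <= fine (gam R B) by rewrite fine_ge0.
transitivity (mscale (NngNum gB0) P C); last first.
  by rewrite /mscale/= fineK// muleC.
transitivity (mrestr P mD C); first by [].
apply: (@g_sigma_algebra_measure_unique _ R Om rect measurable_rect (fun=> setT)) => //.
- by apply/seteqP; split => // x _; exists 0%N.
- move=> _ [B' [mB' ->]].
  rewrite -[LHS]/(P (_ `&` _)) -[RHS]/((fine (gam R B))%:E * P _)%E fineK// [in RHS]rectE.
  rewrite [in RHS](@iid_rect (fun k' => if k' == k then setT else B' k')); last by move=> k'; case: ifP.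
  rewrite (_ : _ `&` _ = [set w | forall k', (if k' == k then B else B' k') (f k' w)]); last first.
    apply/seteqP; split => w /=.
      by move=> [h1 h2] k'; have [->|kk] := eqVneq k' k; [exact: h2|exact: h1].
    move=> h; split; last by have := h k; rewrite eqxx.
    by move=> k' /negbTE kk; have := h k'; rewrite kk.
  rewrite [LHS](@iid_rect (fun k' => if k' == k then B else B' k')); last by move=> k'; case: ifP.
  rewrite (bigD1 k)//= eqxx [in RHS](bigD1 k)//= eqxx probability_setT/= mul1r.
  rewrite EFinM fineK//; congr (_ * (_)%:E)%E; apply: eq_bigr => k' /negbTE ->.
  by [].
- move=> _; rewrite -[X in (X < _)%E]/(P (setT `&` (f k @^-1` B))) setTI.
  by rewrite (le_lt_trans (probability_le1 _ _))// ltry.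
Qed.

Lemma integral_coord (H : (K -> R) -> \bar R) :
  meas_fam H -> (forall v, 0 <= H v)%E ->
  (\int[P]_w H (f ^~ w) = \int[P]_w \int[gam R]_x H (upd (f ^~ w) k x))%E.
Proof.
move=> mH H0.
(* The sample space with the coarser sigma-algebra of the other coordinates stands for their joint
   value: the identity into [T1] is independent of [f k]. *)
pose T1 := g_sigma_algebraType rect.
pose F (z : T1 * R) := H (upd (f ^~ z.1) k z.2).
transitivity (\int[P]_w F (w, f k w))%E.
  apply: eq_integral => w _; rewrite /F/=; congr H; apply/funext => k'.
  by rewrite /upd; case: eqVneq => // ->.
apply: (@indep_integral _ _ _ Om T1 _ R P (gam R) id (f k)) => //.
- move=> _ A mA; rewrite setTI preimage_id.
  exact: (smallest_sub (@sigma_algebra_measurable _ Om) measurable_rect mA).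
- exact: mf.
- apply: (mH _ (T1 * R)%type (fun k' z => upd (f ^~ z.1) k z.2 k')) => k'.
  rewrite /upd; case: eqVneq => kk; first exact: measurable_snd.
  apply: (@measurable_comp _ _ _ _ _ _ setT) => //.
  move=> _ B mB; rewrite setTI; apply: sub_sigma_algebra.
  exists (fun k'' => if k'' == k' then B else setT); split.
    by move=> k''; case: ifP.
  apply/seteqP; split => w /=; last by move=> /(_ k' kk); rewrite eqxx.
  by move=> h k'' _; case: eqVneq => // ->.
- by move=> z; exact: H0.
Qed.

End OneCoordinate.

(** The standard Gaussian integral over [R^n], iterated with the head coordinate outermost; the
    recursion replaces an n-fold product measure. *)
Fixpoint gint (R : realType) (n : nat) : ('cV[R]_n -> \bar R) -> \bar R :=
  match n with
  | 0 => fun F => F 0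
  | n'.+1 => fun F =>
      (\int[gam R]_x gint (fun y : 'cV[R]_n' => F (col_mx (x%:M : 'M[R]_1) y : 'cV[R]_(1 + n'))))%E
  end.

Definition updv (R : Type) (K : eqType) n (v : K -> R) (k : 'I_n -> K) (y : 'cV[R]_n) : K -> R :=
  fun k' => if [pick i | k i == k'] is Some i then y i 0 else v k'.

Definition meas_col (R : realType) (K : Type) n (F : (K -> R) -> 'cV[R]_n -> \bar R) : Prop :=
  forall d (T : measurableType d) (phi : K -> T -> R) (y : T -> 'cV[R]_n),
    (forall k, measurable_fun setT (phi k)) ->
    (forall i, measurable_fun setT (fun t => y t i 0)) ->
    measurable_fun setT (fun t => F (phi ^~ t) (y t)).

Section Gint.
Context {R : realType}.
Local Open Scope ereal_scope.

Lemma gint_ge0 n (F : 'cV[R]_n -> \bar R) : (forall y, 0 <= F y) -> 0 <= gint F.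
Proof.
elim: n F => [|n IH] F F0 /=; first exact: F0.
by apply: integral_ge0 => x _; exact: IH.
Qed.

Lemma col_mx1E n (x : R) (y : 'cV[R]_n) (i : 'I_n.+1) :
  (col_mx (x%:M : 'M[R]_1) y : 'cV[R]_(1 + n)) i 0%R =
  if unlift ord0 i is Some j then y j 0%R else x.
Proof.
case: unliftP => [j ->|->].
  rewrite (_ : lift ord0 j = rshift 1 j); first by rewrite col_mxEd.
  by apply: val_inj.
transitivity ((col_mx (x%:M : 'M[R]_1) y) (lshift n (@ord0 0)) 0%R).
  by apply: (congr1 (fun i => col_mx _ y i 0%R)); apply: val_inj.
by rewrite col_mxEu mxE eqxx.
Qed.

(** The induction ranges over all index types: the head coordinate becomes a further index [None] of
    the family, so that joint measurability in it and in the parameters is a single statement. *)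
Lemma meas_gint (K : Type) n (F : (K -> R) -> 'cV[R]_n -> \bar R) :
  meas_col F -> (forall v y, 0 <= F v y) -> meas_fam (fun v => gint (F v)).
Proof.
elim: n K F => [|n IH] K F mF F0 d T phi mphi /=.
  by apply: (mF _ _ phi (fun=> 0%R)).
pose F' (v : option K -> R) (y : 'cV[R]_n) :=
  F (v \o Some) (col_mx ((v None)%:M : 'M[R]_1) y : 'cV[R]_(1 + n)).
have mF' : meas_col F'.
  move=> d' T' phi' y mphi' my; apply: mF => // i.
  under eq_fun do rewrite col_mx1E.
  by case: (unlift ord0 i) => [j|]; [exact: my|exact: mphi'].
have mG := IH _ F' mF' (fun v y => F0 _ _).
pose G (z : T * measurableTypeR R) :=
  gint (F' (fun o => if o is Some k then phi k z.1 else z.2)).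
have mGz : measurable_fun setT G.
  apply: (mG _ _ (fun (o : option K) (z : T * measurableTypeR R) => if o is Some k then phi k z.1 else z.2)).
  by move=> [k|] /=; [exact: measurableT_comp|exact: measurable_snd].
apply: (measurable_fun_fubini_tonelli_F (m2 := gam R) _ mGz).
by move=> z; apply: gint_ge0 => y; exact: F0.
Qed.

Lemma meas_fam_int (K : eqType) (H : (K -> R) -> \bar R) k :
  meas_fam H -> (forall v, 0 <= H v) ->
  meas_fam (fun v => \int[gam R]_x H (upd v k x)).
Proof.
move=> mH H0 d T phi mphi /=.
pose G (z : T * measurableTypeR R) := H (upd (phi ^~ z.1) k z.2).
have mGz : measurable_fun setT G.
  apply: (mH _ _ (fun k' (z : T * measurableTypeR R) => upd (phi ^~ z.1) k z.2 k')) => k'.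
  rewrite /upd; case: eqVneq => _; first exact: measurable_snd.
  exact: measurableT_comp.
by apply: (measurable_fun_fubini_tonelli_F (m2 := gam R) _ mGz) => z; exact: H0.
Qed.

Lemma meas_col_updv (K : eqType) n (k : 'I_n -> K) (H : (K -> R) -> \bar R) :
  meas_fam H -> meas_col (fun v y => H (updv v k y)).
Proof.
move=> mH d T phi y mphi my.
apply: (mH _ _ (fun k' t => updv (phi ^~ t) k (y t) k')) => k'.
by rewrite /updv; case: pickP.
Qed.

(** Coordinates are resampled one at a time by [integral_coord]; injectivity of [k] ensures that no
    resampled entry is overwritten. *)
Lemma integral_block (d : measure_display) (Om : measurableType d)
  (P : probability Om R) (K : finType) (f : K -> Om -> R) n (k : 'I_n -> K)
  (H : (K -> R) -> \bar R) :
  iid_std_normal P f -> injective k -> meas_fam H -> (forall v, 0 <= H v) ->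
  \int[P]_w H (f ^~ w) = \int[P]_w gint (fun y => H (updv (f ^~ w) k y)).
Proof.
move=> iid; elim: n k H => [|n IH] k H kinj mH H0.
  apply: eq_integral => w _ /=; congr H; apply/funext => k'.
  by rewrite /updv; case: pickP => // -[].
have k'inj : injective (k \o lift ord0) by move=> i j /kinj /lift_inj.
rewrite (IH _ _ k'inj mH H0).
pose H' v := gint (fun y => H (updv v (k \o lift ord0) y)).
have mH' : meas_fam H' by apply: meas_gint => //; exact: meas_col_updv.
rewrite -/(\int[P]_w H' (f ^~ w)) (integral_coord iid (k ord0) mH'); last first.
  by move=> v; apply: gint_ge0.
apply: eq_integral => w _ /=; apply: eq_integral => x _.
rewrite /H'; congr gint; apply/funext => y; congr H; apply/funext => k'.
rewrite /updv /upd; case: pickP => [i /eqP /= <-|kk].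
  case: pickP => [j /eqP /kinj ->|/(_ (lift ord0 i))]; last by rewrite eqxx.
  by rewrite col_mx1E liftK.
case: eqVneq => [->|k'0].
  case: pickP => [j /eqP /kinj ->|/(_ ord0)]; last by rewrite eqxx.
  by rewrite col_mx1E unlift_none.
case: pickP => // i; case: (unliftP ord0 i) => [j ->|->].
  by have := kk j; rewrite /= => ->.
by rewrite eq_sym (negbTE k'0).
Qed.

End Gint.

(** * Rotation invariance of a standard Gaussian family *)

Section Rotation.
Context (R : realType) (d : measure_display) (Om : measurableType d)
  (P : probability Om R) (K : finType).

Lemma iid_of_rect (f : K -> Om -> R) :
  (forall k, measurable_fun setT (f k)) ->
  (forall B : K -> set R, (forall k, measurable (B k)) ->
    P [set w | forall k, B k (f k w)] = (\prod_k fine (gam R (B k)))%:E) ->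
  iid_std_normal P f.
Proof.
move=> mf h.
have marg k (B : set R) : measurable B -> P (f k @^-1` B) = gam R B.
  move=> mB.
  have := h (fun k' => if k' == k then B else setT).
  rewrite (bigD1 k)//= eqxx big1 ?mulr1 ?fineK ?fin_num_measure//; last first.
    by move=> k' /negbTE ->; rewrite probability_setT.
  move=> <-; last by move=> k'; case: ifP.
  congr (P _); apply/seteqP; split => w /=; last by move=> /(_ k); rewrite eqxx.
  by move=> Bw k'; case: eqVneq => // ->.
split => // B mB; rewrite h//; congr EFin; apply: eq_bigr => k _.
by rewrite marg.
Qed.

Definition rotf (c s : R) (k l : K) (v : K -> R) : K -> R := fun i =>
  if i == k then c * v k + s * v l else
  if i == l then - s * v k + c * v l else v i.

(** Only probabilities of rectangles have to be compared; after integrating out the entries [k] and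
    [l] this is the rotation invariance of the planar Gaussian law. *)
Lemma iid_rot (c s : R) (k l : K) (f : K -> Om -> R) :
  k != l -> c ^+ 2 + s ^+ 2 = 1 -> iid_std_normal P f ->
  iid_std_normal P (fun i w => rotf c s k l (f ^~ w) i).
Proof.
move=> kl cs iid; have [mf _ _] := iid.
have mrot d' (T : measurableType d') (phi : K -> T -> R) :
    (forall k, measurable_fun setT (phi k)) ->
    forall i, measurable_fun setT (fun t => rotf c s k l (phi ^~ t) i).
  move=> mphi i; rewrite /rotf; case: eqVneq => _.
    by apply: measurable_funD; apply: measurable_funM.
  by case: eqVneq => _ //; apply: measurable_funD; apply: measurable_funM.
have mI d' (T : measurableType d') (phi : K -> T -> R) (B : K -> set R) :
    (forall k, measurable_fun setT (phi k)) -> (forall k, measurable (B k)) ->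
    measurable [set t | forall i, B i (phi i t)].
  move=> mphi mB; apply: (@measurable_forall _ _ _ (fun i => phi i @^-1` B i)) => i.
  by rewrite -[X in measurable X]setTI; exact: mphi.
apply: iid_of_rect; first exact: mrot.
move=> B mB; rewrite -(iid_rect iid mB).
pose A0 : set (K -> R) := [set v | forall i, B i (v i)].
pose A1 : set (K -> R) := [set v | forall i, B i (rotf c s k l v i)].
pose H0 (v : K -> R) : \bar R := (\1_A0 v)%:E.
pose H1 (v : K -> R) : \bar R := (\1_A1 v)%:E.
have PE (A : set (K -> R)) : measurable [set w | A (f ^~ w)] ->
    P [set w | A (f ^~ w)] = (\int[P]_w (\1_A (f ^~ w))%:E)%E.
  move=> mA; rewrite -[X in P X = _]setIT -integral_indic//.
rewrite -[LHS]/(P [set w | A1 (f ^~ w)]) -[RHS]/(P [set w | A0 (f ^~ w)]).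
rewrite !PE; first last.
- by apply: mI => //; exact: mrot.
- exact: mI.
have ind0 (A : set (K -> R)) v : (0 <= (\1_A v)%:E :> \bar R)%E by rewrite lee_fin.
have mH0 : meas_fam H0.
  move=> d' T phi mphi; apply/measurable_EFinP.
  by apply: (@measurable_indic _ _ _ _ [set t | A0 (phi ^~ t)]); exact: mI.
have mH1 : meas_fam H1.
  move=> d' T phi mphi; apply/measurable_EFinP.
  apply: (@measurable_indic _ _ _ _ [set t | A1 (phi ^~ t)]); apply: (mI _ _ (fun i t => rotf c s k l (phi ^~ t) i)) => //.
  exact: mrot.
have two H : meas_fam H -> (forall v, 0 <= H v)%E ->
    (\int[P]_w H (f ^~ w) =
     \int[P]_w \int[gam R]_y \int[gam R]_x H (upd (upd (f ^~ w) l y) k x))%E.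
  move=> mH Hge0; rewrite (integral_coord iid k mH Hge0).
  rewrite (integral_coord iid l (meas_fam_int k mH Hge0))//.
  by move=> v; apply: integral_ge0.
rewrite (two H1 mH1 (ind0 _)) (two H0 mH0 (ind0 _)).
apply: eq_integral => w _.
pose F (z : measurableTypeR R * measurableTypeR R) := H0 (upd (upd (f ^~ w) l z.1) k z.2).
have mF : measurable_fun setT F.
  apply: (mH0 _ _ (fun i (z : measurableTypeR R * measurableTypeR R) =>
    upd (upd (f ^~ w) l z.1) k z.2 i)) => i.
  rewrite /upd; case: eqVneq => _; first exact: measurable_snd.
  by case: eqVneq => _; [exact: measurable_fst|exact: measurable_cst].
(* The outer variable is the entry at [l] and the inner one that at [k]; in this order the rotation
   has the opposite angle. *)
have cs' : c ^+ 2 + (- s) ^+ 2 = 1 by rewrite sqrrN.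
rewrite -[RHS](integral_normal2_rot cs' mF (fun z => ind0 _ _)).
apply: eq_integral => y _; apply: eq_integral => x _.
rewrite /H1 /F /H0 /=.
transitivity ((\1_A0 (rotf c s k l (upd (upd (f ^~ w) l y) k x)))%:E : \bar R); first by [].
congr (\1_A0 _)%:E.
apply/funext => i; rewrite /rotf /upd !eqxx [l == k]eq_sym (negbTE kl).
have [_|_] := eqVneq i k; first by ring.
by have [_|//] := eqVneq i l; ring.
Qed.

End Rotation.

Definition mxmeas (R : realType) d (T : measurableType d) m n (M : T -> 'M[R]_(m, n)) : Prop :=
  forall i j, measurable_fun setT (fun t => M t i j).

Definition zmx (R : realType) (Om : Type) n p (Z : 'I_n -> 'I_p -> Om -> R) (w : Om) : 'M[R]_(n, p) :=
  \matrix_(i, j) Z i j w.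
Definition gvec (R : realType) (Om : Type) n (G : 'I_n -> Om -> R) (w : Om) : 'cV[R]_n :=
  \col_i G i w.

(** * Orthogonal transformations of the columns of the Gaussian matrix *)

Section ColumnRotation.
Context (R : realType) (d : measure_display) (Om : measurableType d)
  (P : probability Om R) (n p : nat).
Implicit Types (Z : 'I_n -> 'I_p -> Om -> R) (G : 'I_n -> Om -> R).

Definition colact (Q : 'M[R]_p) Z : 'I_n -> 'I_p -> Om -> R :=
  fun i j w => (zmx Z w *m Q) i j.

Lemma zmx_colact Q Z w : zmx (colact Q Z) w = zmx Z w *m Q.
Proof. by apply/matrixP => i j; rewrite mxE. Qed.

(** Invariance of the law is part of the predicate, so products of plane rotations suffice; the
    noise [G] is carried along to keep it jointly independent of the rotated matrix. *)
Definition iid_preserving (Q : 'M[R]_p) : Prop :=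
  Q^T *m Q = 1%:M /\ forall Z G, iid_std_normal P (gauss_family Z G) ->
    iid_std_normal P (gauss_family (colact Q Z) G).

Lemma iid_preserving1 : iid_preserving 1%:M.
Proof.
split; first by rewrite trmx1 mulmx1.
move=> Z G; rewrite (_ : colact 1%:M Z = Z)//.
by apply/funext => i; apply/funext => j; apply/funext => w; rewrite /colact mulmx1 mxE.
Qed.

Lemma iid_preservingM Q1 Q2 : iid_preserving Q1 -> iid_preserving Q2 ->
  iid_preserving (Q1 *m Q2).
Proof.
move=> [e1 h1] [e2 h2]; split.
  by rewrite trmx_mul mulmxA -(mulmxA Q2^T) e1 mulmx1.
move=> Z G /h1 /h2; rewrite (_ : colact (Q1 *m Q2) Z = colact Q2 (colact Q1 Z))//.
apply/funext => i; apply/funext => j; apply/funext => w.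
by rewrite /colact zmx_colact mulmxA.
Qed.

Definition givens (c s : R) (a b : 'I_p) : 'M[R]_p := \matrix_(i, j)
  if j == a then c * (i == a)%:R + s * (i == b)%:R else
  if j == b then - s * (i == a)%:R + c * (i == b)%:R else (i == j)%:R.

Lemma sum_delta (F : 'I_p -> R) a : \sum_i F i * (i == a)%:R = F a.
Proof.
rewrite (bigD1 a)//= eqxx mulr1 big1 ?addr0// => i /negbTE ->.
by rewrite mulr0.
Qed.

Lemma mul_givens m (X : 'M[R]_(m, p)) c s a b i j :
  (X *m givens c s a b) i j =
  if j == a then c * X i a + s * X i b else
  if j == b then - s * X i a + c * X i b else X i j.
Proof.
rewrite mxE; under eq_bigr do rewrite mxE.
case: (j == a); last case: (j == b); last exact: sum_delta.
  rewrite -(sum_delta (X i) a) -(sum_delta (X i) b) !mulr_sumr -big_split/=.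
  by apply: eq_bigr => l _; ring.
rewrite -(sum_delta (X i) a) -(sum_delta (X i) b) !mulr_sumr -big_split/=.
by apply: eq_bigr => l _; ring.
Qed.

(** The rows are rotated one at a time, [rs] listing those already done; each step is [iid_rot] on
    the entries [(r, a)] and [(r, b)]. *)
Lemma iid_preserving_givens c s (a b : 'I_p) : a != b -> c ^+ 2 + s ^+ 2 = 1 ->
  iid_preserving (givens c s a b).
Proof.
move=> ab cs; split.
  apply/matrixP => i j; rewrite mul_givens !mxE.
  have ab' := negbTE ab; have ba' : (b == a) = false by rewrite eq_sym.
  rewrite ?(eqxx, ab', ba').
  have [->|/negbTE ja] := eqVneq j a.
    rewrite ?(eqxx, ab', ba').
    have [iE|/negbTE ia] := eqVneq i a; first by rewrite ?iE ?(eqxx, ab', ba') /= -[RHS]cs; ring.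
    have [iE|/negbTE ib] := eqVneq i b; first by rewrite ?iE ?(eqxx, ab', ba') /=; ring.
    by rewrite /=; ring.
  have [->|/negbTE jb] := eqVneq j b.
    rewrite ?(eqxx, ab', ba').
    have [iE|/negbTE ia] := eqVneq i a; first by rewrite ?iE ?(eqxx, ab', ba') /=; ring.
    have [iE|/negbTE ib] := eqVneq i b; first by rewrite ?iE ?(eqxx, ab', ba') /= -[RHS]cs; ring.
    by rewrite /=; ring.
  have [iE|/negbTE ia] := eqVneq i a; first by rewrite ?iE ?(ja, jb) [a == j]eq_sym ja /=; ring.
  have [iE|/negbTE ib] := eqVneq i b; first by rewrite ?iE ?(ja, jb) [b == j]eq_sym jb /=; ring.
  by rewrite eq_sym.
move=> Z G iid.
pose f (rs : seq 'I_n) : ('I_n * 'I_p) + 'I_n -> Om -> R := fun k w => match k with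
  | inl ij => if ij.1 \in rs then colact (givens c s a b) Z ij.1 ij.2 w else Z ij.1 ij.2 w
  | inr i => G i w end.
have fiid rs : uniq rs -> iid_std_normal P (f rs).
  elim: rs => [|r rs IH] /=.
    move=> _; rewrite (_ : f [::] = gauss_family Z G)//.
    by apply/funext => -[[i j]|i].
  move=> /andP[rrs urs].
  have ab' : inl (r, a) != inl (r, b) :> ('I_n * 'I_p) + 'I_n.
    by apply/eqP => -[] /eqP; rewrite (negbTE ab).
  have := iid_rot ab' cs (IH urs).
  rewrite (_ : (fun i w => _) = f (r :: rs))//.
  apply/funext => -[[i j]|i]; apply/funext => w; rewrite /rotf /f//=.
  rewrite in_cons (negbTE rrs) -![inl _ == inl _]/((_, _) == (_, _)) !xpair_eqE.
  have [->|ir] := eqVneq i r; last by [].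
  rewrite /= /colact mul_givens !mxE (negbTE rrs).
  by case: (j == a).
have := fiid (enum 'I_n) (enum_uniq _).
rewrite (_ : f _ = gauss_family (colact (givens c s a b) Z) G)//.
by apply/funext => -[[i j]|i]; apply/funext => w //=; rewrite mem_enum.
Qed.

(** Induction on the number of nonzero entries of [q] away from [a]: one plane rotation merges the
    entry at [b] into the one at [a], as in a QR factorization by Givens rotations. *)
Lemma iid_preserving_axis (q : 'cV[R]_p) (a : 'I_p) :
  exists Q rho, iid_preserving Q /\ q = rho *: col a Q.
Proof.
have [m] := ubnP #|[pred l | (l != a) && (q l 0 != 0)]|.
elim: m q => // m IH q; rewrite ltnS => qm.
have [b /andP[ba qb]|q0] := pickP [pred l | (l != a) && (q l 0 != 0)]; last first.
  exists 1%:M, (q a 0); split; first exact: iid_preserving1.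
  apply/matrixP => i j; rewrite ord1 !mxE.
  have [->|ia] := eqVneq i a; first by rewrite mulr1.
  by have := q0 i; rewrite /= ia /= => /negbFE/eqP ->; rewrite mulr0.
pose nu := Num.sqrt (q a 0 ^+ 2 + q b 0 ^+ 2).
have nu2 : nu ^+ 2 = q a 0 ^+ 2 + q b 0 ^+ 2 by rewrite sqr_sqrtr// addr_ge0// sqr_ge0.
have nu0 : nu != 0.
  by rewrite -sqrf_eq0 nu2 gt_eqF// ltr_wpDl ?sqr_ge0// lt0r sqr_ge0 sqrf_eq0 qb.
pose c := q a 0 / nu; pose s := q b 0 / nu.
have cs : c ^+ 2 + s ^+ 2 = 1.
  by rewrite /c /s !expr_div_n -mulrDl -nu2 divff// sqrf_eq0.
have ab : a != b by rewrite eq_sym.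
pose Gm := givens c s a b.
pose q' : 'cV[R]_p := \col_i if i == a then nu else if i == b then 0 else q i 0.
have qE : q = Gm *m q'.
  apply/matrixP => i j; rewrite ord1 mxE.
  rewrite (bigD1 a)//= (bigD1 b)/=; last by rewrite eq_sym.
  rewrite !mxE !eqxx [b == a]eq_sym (negbTE ab) mulr0 add0r.
  have [->|ia] := eqVneq i a.
    rewrite (negbTE ab) big1 ?addr0; first by rewrite /c /=; field.
    move=> l /andP[la lb]; rewrite !mxE (negbTE la) (negbTE lb) eq_sym (negbTE la).
    by rewrite mul0r.
  have [->|ib] := eqVneq i b.
    rewrite big1 ?addr0; first by rewrite /s /=; field.
    move=> l /andP[la lb]; rewrite !mxE (negbTE la) (negbTE lb) eq_sym (negbTE lb).
    by rewrite mul0r.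
  rewrite (bigD1 i)/= ?ia// !mxE (negbTE ia) (negbTE ib) eqxx big1 /=; first by ring.
  move=> l /andP[/andP[la lb] li]; rewrite !mxE (negbTE la) (negbTE lb) eq_sym (negbTE li).
  by rewrite mul0r.
have [|Q [rho [iQ q'E]]] := IH q'.
  apply: leq_trans qm; apply: proper_card; apply/properP; split.
    apply/fintype.subsetP => l; rewrite !inE mxE => /andP[la].
    by rewrite la (negbTE la); case: (l == b); rewrite ?eqxx.
  by exists b; rewrite !inE ?ba ?qb// mxE (negbTE ba) !eqxx.
exists (Gm *m Q), rho; split.
  by apply: iid_preservingM => //; exact: iid_preserving_givens.
by rewrite qE q'E -scalemxAr !colE mulmxA.
Qed.

End ColumnRotation.

(** * Measurability of matrix operations *)

Section MatrixMeasurability.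
Context (R : realType) (d : measure_display) (T : measurableType d).

Lemma measurable_realV (f : T -> R) : measurable_fun setT f ->
  measurable_fun setT (fun t => (f t)^-1).
Proof.
move=> mf.
(* Writing [1 / f] as [f / f^2] leaves a power of a nonnegative base; where [f t = 0] both sides are
   0. *)
rewrite (_ : (fun t => _) = fun t => f t * (f t ^+ 2) `^ (-1)).
  apply: measurable_funM => //.
  apply: (@measurableT_comp _ _ _ _ _ _ (fun x : R => x `^ (-1))) => //.
  exact: measurable_funX.
apply/funext => t; rewrite powR_inv1 ?sqr_ge0//.
have [->|f0] := eqVneq (f t) 0; first by rewrite invr0 mul0r.
by field.
Qed.

Lemma measurable_sqrt (f : T -> R) : measurable_fun setT f ->
  measurable_fun setT (fun t => Num.sqrt (f t)).
Proof.
move=> mf; apply: (@measurableT_comp _ _ _ _ _ _ (@Num.sqrt R)) => //.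
by apply: continuous_measurable_fun; exact: sqrt_continuous.
Qed.

Lemma measurable_bigsum (I : Type) (s : seq I) (Q : pred I) (f : I -> T -> R) :
  (forall i, measurable_fun setT (f i)) ->
  measurable_fun setT (fun t => \sum_(i <- s | Q i) f i t).
Proof.
move=> mf; elim: s => [|i s IH].
  by under eq_fun do rewrite big_nil; exact: measurable_cst.
under eq_fun do rewrite big_cons.
by case: (Q i) => //; apply: measurable_funD.
Qed.

Lemma measurable_bigprod (I : Type) (s : seq I) (Q : pred I) (f : I -> T -> R) :
  (forall i, measurable_fun setT (f i)) ->
  measurable_fun setT (fun t => \prod_(i <- s | Q i) f i t).
Proof.
move=> mf; elim: s => [|i s IH].
  by under eq_fun do rewrite big_nil; exact: measurable_cst.
under eq_fun do rewrite big_cons.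
by case: (Q i) => //; apply: measurable_funM.
Qed.

Lemma mxmeas_cst m n (M : 'M[R]_(m, n)) : mxmeas (fun _ : T => M).
Proof. by move=> i j; exact: measurable_cst. Qed.

Lemma mxmeas_mul m n q (A : T -> 'M[R]_(m, n)) (B : T -> 'M[R]_(n, q)) :
  mxmeas A -> mxmeas B -> mxmeas (fun t => A t *m B t).
Proof.
move=> mA mB i j; under eq_fun do rewrite mxE.
by apply: measurable_bigsum => k; apply: measurable_funM.
Qed.

Lemma mxmeas_tr m n (A : T -> 'M[R]_(m, n)) : mxmeas A -> mxmeas (fun t => (A t)^T).
Proof. by move=> mA i j; under eq_fun do rewrite mxE; exact: mA. Qed.

Lemma mxmeas_add m n (A B : T -> 'M[R]_(m, n)) :
  mxmeas A -> mxmeas B -> mxmeas (fun t => A t + B t).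
Proof. by move=> mA mB i j; under eq_fun do rewrite mxE; apply: measurable_funD. Qed.

Lemma mxmeas_opp m n (A : T -> 'M[R]_(m, n)) : mxmeas A -> mxmeas (fun t => - A t).
Proof. by move=> mA i j; under eq_fun do rewrite mxE; apply: measurableT_comp; [exact: oppr_measurable|exact: mA]. Qed.

Lemma mxmeas_scale m n (a : T -> R) (A : T -> 'M[R]_(m, n)) :
  measurable_fun setT a -> mxmeas A -> mxmeas (fun t => a t *: A t).
Proof. by move=> ma mA i j; under eq_fun do rewrite mxE; apply: measurable_funM. Qed.

Lemma mxmeas_det n (A : T -> 'M[R]_n) : mxmeas A -> measurable_fun setT (fun t => \det (A t)).
Proof.
move=> mA; apply: measurable_bigsum => s; apply: measurable_funM => //.
by apply: measurable_bigprod.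
Qed.

Lemma measurable_unitmx n (A : T -> 'M[R]_n) : mxmeas A ->
  measurable_fun setT (fun t => A t \in unitmx).
Proof.
move=> mA; under eq_fun do rewrite unitmxE unitfE.
by apply: measurable_neg; apply: measurable_fun_eqr => //; exact: mxmeas_det.
Qed.

Lemma mxmeas_inv n (A : T -> 'M[R]_n) : mxmeas A -> mxmeas (fun t => invmx (A t)).
Proof.
move=> mA i j.
(* [invmx] returns its argument on singular matrices, so the cofactor formula holds on the units
   only and is glued along a measurable condition. *)
rewrite (_ : (fun t => _) = fun t => if A t \in unitmx then
    (\det (A t))^-1 * ((-1) ^+ (j + i) * \det (row' j (col' i (A t)))) else A t i j).
  apply: measurable_fun_ifT => //; first exact: measurable_unitmx.
  apply: measurable_funM; first exact: measurable_realV (mxmeas_det mA).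
  apply: measurable_funM => //; apply: mxmeas_det => a b.
  by under eq_fun do rewrite !mxE; exact: mA.
by apply/funext => t; rewrite /invmx; case: ifP => // _; rewrite !mxE.
Qed.

Lemma measurable_l2sq n (v : T -> 'cV[R]_n) : mxmeas v ->
  measurable_fun setT (fun t => l2sq (v t)).
Proof. by move=> mv; apply: measurable_bigsum => i; exact: measurable_funX. Qed.

Lemma measurable_l2 n (v : T -> 'cV[R]_n) : mxmeas v ->
  measurable_fun setT (fun t => l2 (v t)).
Proof. by move=> mv; apply: measurable_sqrt; exact: measurable_l2sq. Qed.

Lemma measurable_set_of (b : T -> bool) : measurable_fun setT b -> measurable [set t | b t].
Proof.
move=> mb; rewrite -[X in measurable X]setTI.
by have := mb measurableT [set true] I; rewrite (_ : b @^-1` _ = [set t | b t]).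
Qed.

End MatrixMeasurability.

Definition meas3 (R : realType) n k (H : 'cV[R]_n -> 'M[R]_(n, k) -> 'cV[R]_n -> \bar R) :=
  forall d (T : measurableType d) (y : T -> 'cV[R]_n) (X : T -> 'M[R]_(n, k))
    (g : T -> 'cV[R]_n), mxmeas y -> mxmeas X -> mxmeas g ->
  measurable_fun setT (fun t => H (y t) (X t) (g t)).

Definition meas2 (R : realType) n k (H : 'M[R]_(n, k) -> 'cV[R]_n -> \bar R) :=
  forall d (T : measurableType d) (X : T -> 'M[R]_(n, k))
    (g : T -> 'cV[R]_n), mxmeas X -> mxmeas g ->
  measurable_fun setT (fun t => H (X t) (g t)).

(** * Independence of the noise and of one column direction *)

Section Decoupling.
Context (R : realType) (d : measure_display) (Om : measurableType d)
  (P : probability Om R) (n p : nat) (Z : 'I_n -> 'I_p -> Om -> R) (G : 'I_n -> Om -> R).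
Hypothesis iid : iid_std_normal P (gauss_family Z G).

Lemma mxmeas_zmx : mxmeas (zmx Z).
Proof.
by move=> i j; under eq_fun do rewrite mxE; have [mf _ _] := iid; exact: (mf (inl (i, j))).
Qed.

Lemma mxmeas_gvec : mxmeas (gvec G).
Proof.
by move=> i j; under eq_fun do rewrite mxE; have [mf _ _] := iid; exact: (mf (inr i)).
Qed.

Lemma noise_decoupling (H : 'M[R]_(n, p) -> 'cV[R]_n -> \bar R) :
  meas2 H -> (forall X g, 0 <= H X g)%E ->
  (\int[P]_w H (zmx Z w) (gvec G w) = \int[P]_w gint (H (zmx Z w)))%E.
Proof.
move=> mH H0.
pose H' (v : ('I_n * 'I_p) + 'I_n -> R) :=
  H (\matrix_(i, j) v (inl (i, j))) (\col_i v (inr i)).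
have mH' : meas_fam H'.
  move=> d' T phi mphi; apply: mH => i j; under eq_fun do rewrite mxE;
  exact: mphi.
have inj : injective (@inr ('I_n * 'I_p) 'I_n) by move=> i j [].
apply: (etrans _ (etrans (integral_block iid inj mH' (fun v => H0 _ _)) _)) => //.
apply: eq_integral => w _; congr gint; apply/funext => y; rewrite /H'; congr H.
  by apply/matrixP => i j; rewrite !mxE /updv; case: pickP.
apply/matrixP => i j; rewrite !mxE ord1 /updv; case: pickP => [i' /eqP[->]//|].
by move=> /(_ i); rewrite eqxx.
Qed.

(* An orthogonal Q with Q^T q on an axis turns Z q into a multiple of one column of Z Q,
   while Z M only involves the other columns. *)
Lemma column_decoupling k (q : 'cV[R]_p) (M : 'M[R]_(p, k))
  (H : 'cV[R]_n -> 'M[R]_(n, k) -> 'cV[R]_n -> \bar R) (beta : R) :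
  q != 0 -> q^T *m M = 0 -> meas3 H -> (forall y X g, 0 <= H y X g)%E ->
  (forall (rho : R) X g, (rho ^+ 2 = l2sq q)%R -> gint (fun y => H (rho *: y) X g) <= beta%:E)%E ->
  (\int[P]_w H (zmx Z w *m q) (zmx Z w *m M) (gvec G w) <= beta%:E)%E.
Proof.
move=> q0 qM mH H0 Hb.
have [a qa] : exists a, q a 0 != 0.
  have [a h|h] := pickP [pred a | q a 0 != 0]; first by exists a.
  move/eqP: q0; case; apply/matrixP => i j; rewrite ord1 mxE.
  by have := h i => /= /negbFE/eqP.
have [Q [rho [[QQ Qiid] qE]]] := iid_preserving_axis P n q a.
have QQ' : Q *m Q^T = 1%:M by exact: mulmx1C.
have rho0 : rho != 0 by apply: contraNneq q0 => r0; rewrite qE r0 scale0r.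
have rho2 : rho ^+ 2 = l2sq q.
  transitivity (rho ^+ 2 * (Q^T *m Q) a a); first by rewrite QQ mxE eqxx mulr1.
  rewrite mxE mulr_sumr; apply: eq_bigr => i _; rewrite qE !mxE; ring.
have iid' := Qiid _ _ iid.
(* [q] is a multiple of column [a] of [Q], so [q^T M = 0] says that [Z M = (Z Q) (Q^T M)] does not
   read column [a] of [Z Q]. *)
have rowa : row a (Q^T *m M) = 0.
  have : rho *: row a (Q^T *m M) = 0.
    by rewrite row_mul -tr_col scalemxAl -linearZ/= -qE.
  by move/eqP; rewrite scaler_eq0 (negbTE rho0) => /eqP.
pose H' (v : ('I_n * 'I_p) + 'I_n -> R) :=
  H (rho *: \col_i v (inl (i, a))) ((\matrix_(i, j) v (inl (i, j))) *m (Q^T *m M))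
    (\col_i v (inr i)).
have mH' : meas_fam H'.
  move=> d' T phi mphi; apply: mH.
  - by apply: mxmeas_scale => // i j; under eq_fun do rewrite mxE; exact: mphi.
  - apply: mxmeas_mul; last exact: mxmeas_cst.
    by move=> i j; under eq_fun do rewrite mxE; exact: mphi.
  - by move=> i j; under eq_fun do rewrite mxE; exact: mphi.
have H'0 v : (0 <= H' v)%E by exact: H0.
have inj : injective (fun i : 'I_n => @inl ('I_n * 'I_p) 'I_n (i, a)) by move=> i j [].
have -> : (\int[P]_w H (zmx Z w *m q) (zmx Z w *m M) (gvec G w) =
    \int[P]_w H' ((gauss_family (colact Q Z) G) ^~ w))%E.
  apply: eq_integral => w _; rewrite /H' /=.
  have e : \matrix_(i, j) colact Q Z i j w = zmx Z w *m Q.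
    by rewrite -zmx_colact; apply/matrixP => i j; rewrite !mxE.
  rewrite e; congr H.
    rewrite qE -scalemxAr; congr (_ *: _).
    apply/matrixP => i j; rewrite !mxE /colact mxE; apply: eq_bigr => l _.
    by rewrite !mxE.
  by rewrite mulmxA -(mulmxA (zmx Z w)) QQ' mulmx1.
rewrite (integral_block iid' inj mH' H'0).
have mg : meas_fam (fun v => gint (fun y => H' (updv v (fun i : 'I_n => inl (i, a)) y))).
  by apply: meas_gint => [|v y]; [exact: meas_col_updv|exact: H'0].
have beta0 : (0 <= beta%:E)%E.
  by apply: le_trans (Hb rho 0 0 rho2); apply: gint_ge0 => y.
apply: (@le_trans _ _ (\int[P]_w beta%:E)%E); last by rewrite integral_cst//= -[leRHS]mule1 lee_wpmul2l// probability_le1.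
have [mf' _ _] := iid'.
apply: ge0_le_integral => //.
- by move=> w _; apply: gint_ge0 => y; exact: H'0.
- exact: (mg _ _ _ mf').
move=> w _; set v := _ ^~ w.
rewrite (_ : (fun y => _) = fun y => H (rho *: y)
   ((\matrix_(i, j) v (inl (i, j))) *m (Q^T *m M)) (\col_i v (inr i))); first exact: Hb.
apply/funext => y; rewrite /H'; congr H.
- congr (_ *: _); apply/matrixP => i j; rewrite !mxE ord1 /updv.
  by case: pickP => [i' /eqP[->]//|/(_ i)]; rewrite eqxx.
- apply/matrixP => i j; rewrite !mxE (bigD1 a)//= [RHS](bigD1 a)//=.
  have -> : (Q^T *m M) a j = 0 by have /matrixP/(_ 0 j) := rowa; rewrite !mxE.
  rewrite !mulr0 !add0r; apply: eq_bigr => l /negbTE la; rewrite !mxE; congr (_ * _).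
  by rewrite /updv; case: pickP => // i' /eqP[_ al]; rewrite al eqxx in la.
- by apply/matrixP => i j; rewrite !mxE /updv; case: pickP.
Qed.

End Decoupling.

(** * Gaussian integrals over column vectors *)

Section LinearAlgebra.
Context {R : realType}.

Definition dot n (u v : 'cV[R]_n) : R := (u^T *m v) 0 0.

Lemma dotE n (u v : 'cV[R]_n) : dot u v = \sum_i u i 0 * v i 0.
Proof. by rewrite /dot mxE; apply: eq_bigr => i _; rewrite mxE. Qed.

Lemma dotC n (u v : 'cV[R]_n) : dot u v = dot v u.
Proof. by rewrite !dotE; apply: eq_bigr => i _; rewrite mulrC. Qed.

Lemma dotDl n (u v w : 'cV[R]_n) : dot (u + v) w = dot u w + dot v w.
Proof. by rewrite /dot linearD/= mulmxDl mxE. Qed.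

Lemma dotDr n (u v w : 'cV[R]_n) : dot w (u + v) = dot w u + dot w v.
Proof. by rewrite /dot mulmxDr mxE. Qed.

Lemma dotZl n (c : R) (u v : 'cV[R]_n) : dot (c *: u) v = c * dot u v.
Proof. by rewrite !dotE mulr_sumr; apply: eq_bigr => i _; rewrite mxE mulrA. Qed.

Lemma dotZr n (c : R) (u v : 'cV[R]_n) : dot u (c *: v) = c * dot u v.
Proof. by rewrite dotC dotZl dotC. Qed.

Lemma dotNl n (u v : 'cV[R]_n) : dot (- u) v = - dot u v.
Proof. by rewrite -scaleN1r dotZl mulN1r. Qed.

Lemma dotNr n (u v : 'cV[R]_n) : dot u (- v) = - dot u v.
Proof. by rewrite dotC dotNl dotC. Qed.

Lemma dotBl n (u v w : 'cV[R]_n) : dot (u - v) w = dot u w - dot v w.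
Proof. by rewrite dotDl dotNl. Qed.

Lemma dotBr n (u v w : 'cV[R]_n) : dot w (u - v) = dot w u - dot w v.
Proof. by rewrite dotDr dotNr. Qed.

Lemma dot0l n (v : 'cV[R]_n) : dot 0 v = 0.
Proof. by rewrite -(scale0r 0) dotZl mul0r. Qed.

Lemma dot0r n (v : 'cV[R]_n) : dot v 0 = 0.
Proof. by rewrite dotC dot0l. Qed.

Lemma dot_mull m n (A : 'M[R]_(m, n)) u v : dot (A *m u) v = dot u (A^T *m v).
Proof. by rewrite /dot trmx_mul mulmxA. Qed.

Lemma dot_mulr m n (A : 'M[R]_(m, n)) u v : dot u (A *m v) = dot (A^T *m u) v.
Proof. by rewrite dotC dot_mull dotC. Qed.

Lemma dot_col_mx m n (a b : 'cV[R]_m) (c d : 'cV[R]_n) :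
  dot (col_mx a c) (col_mx b d) = dot a b + dot c d.
Proof. by rewrite /dot tr_col_mx mul_row_col mxE. Qed.

Lemma dot_recl n (u v : 'cV[R]_n.+1) :
  dot u v = u 0 0 * v 0 0 +
    dot (dsubmx (u : 'cV[R]_(1 + n))) (dsubmx (v : 'cV[R]_(1 + n))).
Proof.
rewrite !dotE big_ord_recl; congr (_ + _); apply: eq_bigr => i _; rewrite !mxE.
by congr (u _ _ * v _ _); apply: val_inj.
Qed.

Lemma col_mx_head n (x : R) (y : 'cV[R]_n) :
  (col_mx (x%:M : 'M[R]_1) y : 'cV[R]_(1 + n)) 0 0 = x.
Proof.
rewrite (_ : 0 = lshift n (0 : 'I_1)); last by apply: val_inj.
by rewrite col_mxEu mxE eqxx.
Qed.

Lemma dot1E (a b : 'cV[R]_1) : dot a b = a 0 0 * b 0 0.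
Proof. by rewrite dotE big_ord1. Qed.

Lemma l2sqE n (u : 'cV[R]_n) : l2sq u = dot u u.
Proof. by rewrite dotE; apply: eq_bigr => i _; rewrite expr2. Qed.

Lemma l2sq_ge0 n (u : 'cV[R]_n) : 0 <= l2sq u.
Proof. by apply: sumr_ge0 => i _; exact: sqr_ge0. Qed.

Lemma l2sq_eq0 n (u : 'cV[R]_n) : (l2sq u == 0) = (u == 0).
Proof.
apply/eqP/eqP => [h|->]; last by rewrite l2sqE dot0l.
apply/matrixP => i j; rewrite ord1 mxE; apply/eqP; rewrite -sqrf_eq0.
by apply/eqP; apply: (psumr_eq0P (fun i _ => sqr_ge0 (u i 0)) h).
Qed.

Lemma l2sq_gt0 n (u : 'cV[R]_n) : u != 0 -> 0 < l2sq u.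
Proof. by move=> u0; rewrite lt0r l2sq_eq0 u0 l2sq_ge0. Qed.

Lemma l2_ge0 n (u : 'cV[R]_n) : 0 <= l2 u. Proof. exact: sqrtr_ge0. Qed.

Lemma l2_sqr n (u : 'cV[R]_n) : l2 u ^+ 2 = l2sq u.
Proof. by rewrite sqr_sqrtr// l2sq_ge0. Qed.

Lemma l2sqZ n (c : R) (u : 'cV[R]_n) : l2sq (c *: u) = c ^+ 2 * l2sq u.
Proof. by rewrite !l2sqE dotZl dotZr mulrA. Qed.

Lemma qformE n (A : 'M[R]_n) u : qform A u = dot u (A *m u).
Proof. by rewrite /qform /dot mulmxA. Qed.

Lemma cauchy_dot n (u v : 'cV[R]_n) : dot u v ^+ 2 <= l2sq u * l2sq v.
Proof.
have [->|v0] := eqVneq v 0; first by rewrite dot0r expr0n/= mulr_ge0// l2sq_ge0.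
have lv := l2sq_gt0 v0.
have := l2sq_ge0 (l2sq v *: u - dot u v *: v).
rewrite l2sqE dotBl !dotBr !(dotZl, dotZr) -!l2sqE (dotC v u) => h.
by rewrite -(ler_pM2l lv); nra.
Qed.

Definition posdef n (S : 'M[R]_n) : Prop :=
  S^T = S /\ forall u : 'cV[R]_n, u != 0 -> 0 < dot u (S *m u).

Lemma unitmx_inj n (S : 'M[R]_n) :
  (forall u : 'cV[R]_n, S *m u = 0 -> u = 0) -> S \in unitmx.
Proof.
move=> h; rewrite -unitmx_tr -row_free_unit -kermx_eq0; apply/eqP/row_matrixP => i.
rewrite row0; apply: trmx_inj; rewrite trmx0; apply: h.
by apply: trmx_inj; rewrite trmx_mul trmxK -row_mul mulmx_ker row0 trmx0.
Qed.

Lemma posdef_unit n (S : 'M[R]_n) : posdef S -> S \in unitmx.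
Proof.
move=> [_ h]; apply: unitmx_inj => u Su; apply/eqP; apply: contraT => /h.
by rewrite Su dot0r ltxx.
Qed.

Lemma gram_unitP m n (X : 'M[R]_(m, n)) :
  reflect (forall u : 'cV[R]_n, X *m u = 0 -> u = 0) (X^T *m X \in unitmx).
Proof.
apply: (iffP idP) => [h u Xu|h].
  by rewrite -(mulKmx h u) -mulmxA Xu !mulmx0.
apply: unitmx_inj => u; rewrite -mulmxA => XXu; apply: h.
by apply/eqP; rewrite -l2sq_eq0 l2sqE dot_mull XXu dot0r.
Qed.

(** One block matrix factors as upper times lower triangular with corner [1 - A B], and as lower
    times upper triangular with corner [1 - B A]. *)
Lemma det_sub_mulC m n (A : 'M[R]_(m, n)) (B : 'M[R]_(n, m)) :
  \det (1%:M - A *m B) = \det (1%:M - B *m A).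
Proof.
pose M := block_mx (1%:M : 'M[R]_m) A B (1%:M : 'M[R]_n).
transitivity (\det M).
  have -> : M = block_mx (1%:M - A *m B) A 0 1%:M *m block_mx 1%:M 0 B 1%:M.
    by rewrite mulmx_block !mulmx1 !mul0mx !mulmx0 mul1mx !add0r subrK.
  by rewrite det_mulmx det_ublock det_lblock !det1 !mulr1.
have -> : M = block_mx 1%:M 0 B 1%:M *m block_mx 1%:M A 0 (1%:M - B *m A).
  by rewrite mulmx_block !mulmx1 !mul0mx !mulmx0 !mul1mx !addr0 addrC subrK.
by rewrite det_mulmx det_ublock det_lblock !det1 !mul1r.
Qed.

End LinearAlgebra.

Section BlockPosdef.
Context {R : realType}.

(** The Schur complement is the value of the quadratic form at [(1, - D^-1 cc)], hence positive;
    block elimination gives the determinant. *)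
Lemma posdef_block n (sg : R) (cc : 'cV[R]_n) (D : 'M[R]_n) :
  posdef (block_mx (sg%:M : 'M[R]_1) cc^T cc D) ->
  [/\ posdef D, 0 < sg - dot cc (invmx D *m cc) &
    \det (block_mx (sg%:M : 'M[R]_1) cc^T cc D) = (sg - dot cc (invmx D *m cc)) * \det D].
Proof.
move=> [sym pos].
have pD : posdef D.
  split; first by move: sym; rewrite tr_block_mx => /eq_block_mx[].
  move=> u u0; have := pos (col_mx 0 u); rewrite mul_block_col !mulmx0 !add0r dot_col_mx dot0l add0r.
  by apply; apply: contraNneq u0 => /(congr1 dsubmx); rewrite col_mxKd linear0 => ->.
have uD := posdef_unit pD.
split => //.
  have := pos (col_mx 1%:M (- (invmx D *m cc))).
  rewrite mul_block_col !mulmx1 !mulmxN mulKVmx// subrr dot_col_mx dot0r addr0 dot1E.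
  rewrite mxE eqxx mul1r mxE [X in X + _]mxE [X in _ + X]mxE eqxx mulr1n; apply.
  apply/eqP => /(congr1 usubmx)/matrixP/(_ 0 0).
  by rewrite col_mxKu linear0 !mxE eqxx => /eqP; rewrite oner_eq0.
set t := _ - _.
have -> : block_mx (sg%:M : 'M[R]_1) cc^T cc D =
    block_mx (1%:M : 'M[R]_1) (cc^T *m invmx D) 0 1%:M *m block_mx (t%:M : 'M[R]_1) 0 cc D.
  rewrite mulmx_block !mul1mx !mul0mx !add0r mulmxKV//; congr block_mx.
  apply/matrixP => i j; rewrite !ord1 -mulmxA [RHS]mxE -/(dot cc (invmx D *m cc)) !mxE eqxx !mulr1n.
  by rewrite subrK.
by rewrite det_mulmx det_ublock det_lblock !det1 !mul1r det_scalar expr1.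
Qed.

(** Block elimination in [S z = (a0, a)]; the splitting is the step by which [gint_quad] descends
    from [S] to [D]. *)
Lemma posdef_block_inv n (sg a0 : R) (cc a : 'cV[R]_n) (D : 'M[R]_n) :
  let S := block_mx (sg%:M : 'M[R]_1) cc^T cc D in
  let t := sg - dot cc (invmx D *m cc) in
  posdef S ->
  dot (col_mx a0%:M a) (invmx S *m col_mx a0%:M a) =
  dot a (invmx D *m a) + (a0 - dot cc (invmx D *m a)) ^+ 2 / t.
Proof.
move=> S t pS; have [pD t0 _] := posdef_block pS.
have uD := posdef_unit pD; have uS := posdef_unit pS.
have Dsym : (invmx D)^T = invmx D by rewrite trmx_inv; have [-> _] := pD.
pose z0 := (a0 - dot cc (invmx D *m a)) / t.
pose z' := invmx D *m (a - z0 *: cc).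
have -> : invmx S *m col_mx a0%:M a = col_mx (z0%:M : 'M[R]_1) z'.
  apply: (canLR (mulKmx uS)); rewrite mul_block_col; congr col_mx.
    apply/matrixP => i j; rewrite !ord1 !mxE !eqxx !mulr1n big_ord1 !mxE eqxx !mulr1n.
    rewrite -[X in _ + X](_ : dot cc z' = _); last by rewrite /dot mxE.
    rewrite /z' mulmxBr -scalemxAr dotBr dotZr /z0.
    by rewrite -[sg](subrK (dot cc (invmx D *m cc))) -/t; field; rewrite gt_eqF.
  by rewrite /z' mulKVmx// mul_mx_scalar addrC subrK.
rewrite dot_col_mx dot1E !mxE eqxx !mulr1n /z' mulmxBr -scalemxAr dotBr dotZr.
have -> : dot a (invmx D *m cc) = dot cc (invmx D *m a).
  by rewrite dot_mulr Dsym dotC.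
by rewrite /z0; field; rewrite gt_eqF.
Qed.

End BlockPosdef.

(** * Closed forms for Gaussian integrals *)

Section GintFormulas.
Context {R : realType}.

(** By induction the tail of [a] contributes one Gaussian variable of scale [l2 a']; a plane
    rotation then aligns [(a0, l2 a')] with an axis. *)
Lemma gint_linear n (a : 'cV[R]_n) (F : R -> \bar R) :
  measurable_fun setT F -> (forall x, 0 <= F x)%E ->
  gint (fun y => F (dot a y)) = (\int[gam R]_x F (l2 a * x)%R)%E.
Proof.
elim: n a F => [|n IH] a F mF F0 /=.
  rewrite dotE big_ord0 /l2 /l2sq big_ord0 sqrtr0.
  under eq_integral do rewrite mul0r.
  by rewrite integral_cst//= probability_setT mule1.
pose a0 := a 0 0; pose a' : 'cV[R]_n := dsubmx (a : 'cV_(1 + n)).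
pose nu := l2 a.
have nu2 : nu ^+ 2 = a0 ^+ 2 + l2 a' ^+ 2.
  by rewrite !l2_sqr !l2sqE dot_recl -expr2.
transitivity (\int[gam R]_x \int[gam R]_z F (a0 * x + l2 a' * z)%R)%E.
  apply: eq_integral => x _.
  rewrite -(IH a' (fun u => F (a0 * x + u)))//.
    congr gint; apply/funext => y; congr F.
    by rewrite dot_recl col_mx_head col_mxKd.
  by apply: (measurableT_comp mF); exact: measurable_funD.
have [nu0|nu0] := eqVneq nu 0.
  have [a00 a'0] : a0 = 0 /\ l2 a' = 0.
    move: nu2; rewrite nu0 expr0n/= => /esym/eqP.
    by rewrite paddr_eq0 ?sqr_ge0// !sqrf_eq0 => /andP[/eqP -> /eqP ->].
  rewrite -/nu nu0 a00 a'0; apply: eq_integral => x _.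
  under eq_integral do rewrite !mul0r addr0.
  by rewrite mul0r integral_cst//= probability_setT mule1.
have cs : (a0 / nu) ^+ 2 + (l2 a' / nu) ^+ 2 = 1.
  by rewrite !expr_div_n -mulrDl -nu2 divff// sqrf_eq0.
pose F2 (z : measurableTypeR R * measurableTypeR R) := F (nu * z.1).
have mF2 : measurable_fun setT F2.
  by apply: (measurableT_comp mF); apply: measurable_funM => //; exact: measurable_fst.
transitivity (\int[gam R]_x \int[gam R]_y F2 (x, y))%E; last first.
  apply: eq_integral => x _; rewrite /F2/=.
  by rewrite integral_cst//= probability_setT mule1.
rewrite -(integral_normal2_rot cs mF2 (fun z => F0 _)).
apply: eq_integral => x _; apply: eq_integral => z _; rewrite /F2/=; congr F.
by field.
Qed.

Lemma gint_tail n (a : 'cV[R]_n) (mu : R) : 0 < mu ->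
  (gint (fun y => ((mu <= `|dot a y|)%R%:R)%:E) <= (expR (- mu ^+ 2 / (2 * l2sq a))%R)%:E)%E.
Proof.
move=> mu0.
have mF : measurable_fun setT (fun x : R => ((mu <= `|x|)%R%:R)%:E : \bar R).
  apply/measurable_EFinP.
  rewrite (_ : (fun x => _) = \1_[set x : R | mu <= `|x|]); last first.
    by apply/funext => x; rewrite indicE; congr (nat_of_bool _)%:R; apply/idP/idP; rewrite inE.
  apply: measurable_indic; apply: measurable_set_of; apply: measurable_fun_ler => //.
have := gint_linear a mF (fun x => _); rewrite /= => ->; last by move=> x; rewrite lee_fin.
(* For [a = 0] the division by zero makes the right side 1, while the left side vanishes because
   [mu > 0]. *)
have [a0|a0] := eqVneq (l2sq a) 0.
  rewrite /l2 a0 sqrtr0 mulr0 invr0 mulr0 expR0.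
  under eq_integral do rewrite mul0r normr0 leNgt mu0/=.
  by rewrite integral0 lee_fin.
have la : 0 < l2 a by rewrite sqrtr_gt0 lt0r a0 l2sq_ge0.
have mS : measurable [set x : R | mu / l2 a <= `|x|].
  by apply: measurable_set_of; apply: measurable_fun_ler.
apply: le_trans (_ : (_ <= gam R [set x : R | (mu / l2 a <= `|x|)%R])%E) _; last first.
  apply: le_trans; first by apply: normal_tail; rewrite divr_ge0 ?ltW.
  rewrite lee_fin ler_expR !mulNr lerN2 expr_div_n l2_sqr invfM.
  by rewrite mulrCA mulrC mulrAC.
rewrite -[X in gam R X]setIT -integral_indic//.
rewrite le_eqVlt; apply/orP; left; apply/eqP; apply: eq_integral => x _; rewrite indicE; congr (_%:R)%:E.
have -> : (mu <= `|l2 a * x|)%R = (mu / l2 a <= `|x|)%R.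
  by rewrite normrM gtr0_norm// ler_pdivrMr// mulrC.
by congr nat_of_bool; apply/idP/idP; rewrite inE.
Qed.

Lemma gint_sqr n (c s : R) : s < 1 ->
  gint (fun y : 'cV[R]_n => (expR (c + s * l2sq y / 2))%:E) =
  (expR c * (Num.sqrt (1 - s))^-1 ^+ n)%:E.
Proof.
move=> s1; elim: n c => [|n IH] c.
  by rewrite /= /l2sq big_ord0 mulr0 mul0r addr0 expr0 mulr1.
transitivity (\int[gam R]_x ((expR c * (Num.sqrt (1 - s))^-1 ^+ n)%:E *
    (expR (0 * x - (- s) * x ^+ 2 / 2))%:E))%E.
  apply: eq_integral => x _ /=.
  rewrite -EFinM mulrAC -expRD -IH; congr gint; apply/funext => y; congr (expR _)%:E.
  rewrite [X in _ + _ * X / _](_ : _ = x ^+ 2 + l2sq y); first by field.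
  by rewrite !l2sqE dot_recl col_mx_head col_mxKd -expr2.
have mf : measurable_fun setT (fun x : R => (expR (0 * x - (- s) * x ^+ 2 / 2))%:E).
  apply/measurable_EFinP; apply: measurableT_comp => //.
  apply: measurable_funB; first exact: measurable_funM.
  apply: measurable_funM => //; apply: measurable_funM => //; exact: measurable_funX.
rewrite ge0_integralZl//=.
rewrite integral_normal_expR; last by lra.
by rewrite expr0n/= mul0r expR0 mulr1 -EFinM -mulrA -exprSr.
Qed.

(** The weight [exp(- |y|^2 / 2)] is already inside [gint], which is why [l2sq y] is subtracted from
    the form of [S]. The tail variables are integrated first, with matrix [D]; the head variable is
    then left with the Schur complement [t] as its coefficient. *)
Lemma gint_quad n (S : 'M[R]_n) (a : 'cV[R]_n) (c : R) : posdef S ->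
  gint (fun y : 'cV[R]_n => (expR (c + dot a y - (dot y (S *m y) - l2sq y) / 2))%:E) =
  (expR c * (Num.sqrt (\det S))^-1 * expR (dot a (invmx S *m a) / 2))%:E.
Proof.
elim: n S a c => [|n IH] S a c pS.
  rewrite /= det_mx00 sqrtr1 invr1 mulr1 !dotE !big_ord0 mul0r expR0 mulr1.
  by rewrite /l2sq big_ord0 subr0 mul0r subr0 addr0.
pose sg := S 0 0.
pose cc : 'cV[R]_n := dlsubmx (S : 'M[R]_(1 + n)).
pose D : 'M[R]_n := drsubmx (S : 'M[R]_(1 + n)).
pose a0 := a 0 0; pose a' : 'cV[R]_n := dsubmx (a : 'cV[R]_(1 + n)).
have SE : S = block_mx (sg%:M : 'M[R]_1) cc^T cc D :> 'M[R]_(1 + n).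
  apply: (etrans (esym (submxK (S : 'M[R]_(1 + n))))); congr block_mx.
    apply/matrixP => i j; rewrite !ord1 !mxE eqxx mulr1n; congr (S _ _); exact: val_inj.
  have [{2}<- _] := pS.
  by apply/matrixP => i j; rewrite !mxE.
have aE : a = col_mx (a0%:M : 'M[R]_1) a' :> 'cV[R]_(1 + n).
  apply: (etrans (esym (vsubmxK (a : 'cV[R]_(1 + n))))); congr col_mx.
  by apply/matrixP => i j; rewrite !ord1 !mxE eqxx mulr1n; congr (a _ _); exact: val_inj.
have pS' : posdef (block_mx (sg%:M : 'M[R]_1) cc^T cc D) by rewrite -SE.
have [pD t0 detS] := posdef_block pS'.
set t := sg - _ in t0 detS.
have Dsym : (invmx D)^T = invmx D by rewrite trmx_inv; have [-> _] := pD.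
have -> : dot a (invmx S *m a) = dot a' (invmx D *m a') + (a0 - dot cc (invmx D *m a')) ^+ 2 / t.
  by rewrite -(posdef_block_inv a0 a' pS') -SE -aE.
have -> : \det S = t * \det D by rewrite -detS -SE.
pose K := expR c * (Num.sqrt (\det D))^-1 * expR (dot a' (invmx D *m a') / 2).
pose A := a0 - dot cc (invmx D *m a').
transitivity (\int[gam R]_x (K%:E * (expR (A * x - (t - 1) * x ^+ 2 / 2))%:E))%E.
  apply: eq_integral => x _.
  transitivity (gint (fun y : 'cV[R]_n => (expR ((c + a0 * x - (sg - 1) * x ^+ 2 / 2) +
     dot (a' - x *: cc) y - (dot y (D *m y) - l2sq y) / 2))%:E)).
    congr gint; apply/funext => y; congr (expR _)%:E.
    have -> : dot a (col_mx (x%:M : 'M[R]_1) y) = a0 * x + dot a' y.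
      by rewrite dot_recl col_mx_head col_mxKd.
    have -> : l2sq (col_mx (x%:M : 'M[R]_1) y) = x ^+ 2 + l2sq y.
      by rewrite !l2sqE dot_col_mx dot1E mxE eqxx mulr1n expr2.
    have -> : dot (col_mx (x%:M : 'M[R]_1) y) (S *m col_mx (x%:M : 'M[R]_1) y) =
        sg * x ^+ 2 + 2 * x * dot cc y + dot y (D *m y).
      transitivity (dot (col_mx (x%:M : 'M[R]_1) y)
        (block_mx (sg%:M : 'M[R]_1) cc^T cc D *m col_mx (x%:M : 'M[R]_1) y)); first by rewrite -SE.
      rewrite mul_block_col dot_col_mx dot1E !mul_mx_scalar dotDr dotZr (dotC y cc).
      have -> : (x%:M : 'M[R]_1) 0 0 = x by rewrite mxE eqxx.
      have -> : (x *: sg%:M + cc^T *m y : 'M[R]_1) 0 0 = x * sg + dot cc y.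
        by rewrite mxE [X in X + _]mxE [X in _ * X]mxE eqxx mulr1n.
      by ring.
    by rewrite dotBl dotZl; field.
  rewrite IH// -EFinM; congr EFin.
  rewrite /K.
  have -> : expR (c + a0 * x - (sg - 1) * x ^+ 2 / 2) * (Num.sqrt (\det D))^-1 *
     expR (dot (a' - x *: cc) (invmx D *m (a' - x *: cc)) / 2) =
    (Num.sqrt (\det D))^-1 * expR (c + a0 * x - (sg - 1) * x ^+ 2 / 2 +
      dot (a' - x *: cc) (invmx D *m (a' - x *: cc)) / 2) by rewrite [in RHS]expRD; ring.
  transitivity ((Num.sqrt (\det D))^-1 * expR (c + dot a' (invmx D *m a') / 2 +
     (A * x - (t - 1) * x ^+ 2 / 2))); last by rewrite !expRD; ring.
  congr (_ * expR _).
  rewrite mulmxBr -scalemxAr dotBl !dotBr !(dotZl, dotZr) [dot a' (invmx D *m cc)]dot_mulr Dsym.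
  by rewrite (dotC _ cc) /A /t; field.
have K0 : 0 <= K by rewrite !mulr_ge0 ?expR_ge0// invr_ge0 sqrtr_ge0.
have mf : measurable_fun setT (fun x : R => (expR (A * x - (t - 1) * x ^+ 2 / 2))%:E).
  apply/measurable_EFinP; apply: measurableT_comp => //.
  apply: measurable_funB; first exact: measurable_funM.
  apply: measurable_funM => //; apply: measurable_funM => //; exact: measurable_funX.
rewrite ge0_integralZl//=.
have tE : 1 + (t - 1) = t by ring.
have t1 : 0 < 1 + (t - 1) by rewrite tE.
rewrite (integral_normal_expR _ t1) -EFinM tE; congr EFin.
have -> : A ^+ 2 / (2 * t) = A ^+ 2 / t / 2 by field; rewrite gt_eqF.
rewrite sqrtrM ?ltW// [(Num.sqrt _ * _)^-1]invfM /K -/A.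
by rewrite mulrDl expRD; ring.
Qed.

End GintFormulas.

(** * Projection on a column space and the chi-square residual *)

Definition colproj (R : realType) n k (X : 'M[R]_(n, k)) : 'M[R]_n :=
  X *m invmx (X^T *m X) *m X^T.
Definition resid (R : realType) n k (X : 'M[R]_(n, k)) (y : 'cV[R]_n) : 'cV[R]_n :=
  y - colproj X *m y.

Section Projection.
Context {R : realType} (n k : nat) (X : 'M[R]_(n, k)).
Hypothesis uX : X^T *m X \in unitmx.

Lemma colproj_sym : (colproj X)^T = colproj X.
Proof. by rewrite /colproj !trmx_mul trmx_inv trmx_mul !trmxK mulmxA. Qed.

Lemma colprojX : colproj X *m X = X.
Proof. by rewrite /colproj -mulmxA mulmxKV. Qed.

Lemma residX u : resid X (X *m u) = 0.
Proof. by rewrite /resid mulmxA colprojX subrr. Qed.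

Lemma tr_resid y : X^T *m resid X y = 0.
Proof.
have XP : X^T *m colproj X = X^T.
  by apply: trmx_inj; rewrite trmx_mul colproj_sym trmxK colprojX.
by rewrite /resid mulmxBr mulmxA XP subrr.
Qed.

Lemma dot_resid y z : dot (resid X y) (X *m z) = 0.
Proof. by rewrite dot_mulr tr_resid dot0l. Qed.

Lemma colprojE (y : 'cV[R]_n) : exists z : 'cV[R]_k, colproj X *m y = X *m z.
Proof. by exists (invmx (X^T *m X) *m X^T *m y); rewrite !mulmxA. Qed.

Lemma dot_resid_resid y z : dot (resid X y) (resid X z) = dot (resid X y) z.
Proof.
by have [u e] := colprojE z; rewrite {2}/resid e dotBr dot_resid subr0.
Qed.

Lemma l2sq_resid y : l2sq (resid X y) = l2sq y - dot y (colproj X *m y).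
Proof. by rewrite l2sqE dot_resid_resid dotC dotBr -l2sqE. Qed.

Lemma l2sq_resid_le y : l2sq (resid X y) <= l2sq y.
Proof.
have h : l2sq (resid X y) ^+ 2 <= l2sq (resid X y) * l2sq y.
  by rewrite {1}l2sqE dot_resid_resid cauchy_dot.
have [->|r0] := eqVneq (resid X y) 0; first by rewrite {1}l2sqE dot0l l2sq_ge0.
by rewrite -(ler_pM2l (l2sq_gt0 r0)) -expr2.
Qed.

(* Sylvester's identity det (1 - AB) = det (1 - BA) reduces the determinant to size k. *)
Lemma det_resid (s : R) : 0 <= s ->
  \det ((1 + s) *: 1%:M - s *: colproj X) = (1 + s) ^+ n / (1 + s) ^+ k.
Proof.
move=> s0; have s1 : 1 + s != 0 by rewrite gt_eqF//; lra.
pose tau := s / (1 + s).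
have -> : (1 + s) *: 1%:M - s *: colproj X =
    (1 + s) *: (1%:M - (tau *: (X *m invmx (X^T *m X))) *m X^T).
  by rewrite scalerBr -scalemxAl scalerA /tau mulrC divfK.
rewrite detZ det_sub_mulC -scalemxAr mulmxA mulmxV//.
rewrite (_ : 1%:M - tau *: 1%:M = (1 - tau) *: 1%:M); last by rewrite scalerBl scale1r.
rewrite scalemx1 det_scalar -exprVn; congr (_ * _ ^+ _).
by rewrite /tau; field.
Qed.

(** The Laplace transform of a chi-square variable with [n - k] degrees of freedom, read off
    [gint_quad] for the matrix [1 + s (1 - P)] with [P] the projection. *)
Lemma gint_resid (c s : R) : 0 <= s ->
  gint (fun y => (expR (c - s * l2sq (resid X y) / 2))%:E) =
  (expR c * (Num.sqrt ((1 + s) ^+ n / (1 + s) ^+ k))^-1)%:E.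
Proof.
move=> s0; pose S := (1 + s) *: 1%:M - s *: colproj X.
have SE y : dot y (S *m y) = l2sq y + s * l2sq (resid X y).
  rewrite /S mulmxBl -!scalemxAl mul1mx dotBr !dotZr l2sq_resid -l2sqE; ring.
have pS : posdef S.
  split; first by rewrite /S linearB/= !linearZ/= trmx1 colproj_sym.
  by move=> u u0; rewrite SE; apply: ltr_pwDl; [exact: l2sq_gt0|rewrite mulr_ge0// l2sq_ge0].
have := gint_quad 0 c pS; rewrite /S det_resid// mulmx0 dot0l mul0r expR0 mulr1 => <-.
congr gint; apply/funext => y; congr (expR _)%:E.
by rewrite -/S SE dot0l; field.
Qed.

End Projection.

Lemma residZ (R : realType) n k (X : 'M[R]_(n, k)) (c : R) y : resid X (c *: y) = c *: resid X y.
Proof. by rewrite /resid -scalemxAr scalerBr. Qed.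

(** A rational lower bound for [ln (1 + s)]; it keeps the later exponents rational in [s], within
    reach of polynomial arithmetic. *)
Lemma expR_div1D_le (R : realType) (s : R) : 0 <= s -> expR (s / (1 + s)) <= 1 + s.
Proof.
move=> s0; have s1 : 0 < 1 + s by lra.
have := expR_ge1Dx (- (s / (1 + s))).
rewrite expRN (_ : 1 + - _ = (1 + s)^-1); last by field; rewrite gt_eqF.
by rewrite lef_pV2 ?posrE ?expR_gt0.
Qed.

Lemma sqrt_pow_expR_le (R : realType) (s : R) (n k : nat) : 0 <= s -> (k <= n)%N ->
  (Num.sqrt ((1 + s) ^+ n / (1 + s) ^+ k))^-1 <= expR (- ((n%:R - k%:R) / 2 * (s / (1 + s)))).
Proof.
move=> s0 kn; have s1 : 0 < 1 + s by lra.
rewrite -expfB_cond ?kn ?orbT// ; last by rewrite gt_eqF.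
rewrite expRN lef_pV2 ?posrE ?expR_gt0 ?sqrtr_gt0 ?exprn_gt0//.
rewrite -[leLHS]ger0_norm ?expR_ge0// -sqrtr_sqr ler_wsqrtr//.
rewrite -expRM_natl.
rewrite (_ : 2%:R * _ = (n - k)%:R * (s / (1 + s))); last by rewrite natrB//; field; rewrite gt_eqF.
by rewrite expRM_natl; apply: lerXn2r; rewrite ?nnegrE ?expR_ge0 ?(ltW s1)//; exact: expR_div1D_le.
Qed.

(** * Concentration *)

Section BoolEvents.
Context (R : realType) d (T : measurableType d).
Implicit Types b : T -> bool.

Lemma measurable_natb b : measurable_fun setT b ->
  measurable_fun setT (fun t => ((b t)%:R)%:E : \bar R).
Proof.
move=> mb; apply/measurable_EFinP.
rewrite (_ : (fun t => _) = fun t => if b t then 1 else 0 : R); last first.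
  by apply/funext => t; case: (b t).
exact: measurable_fun_ifT.
Qed.

Lemma prob_bool (P : probability T R) b : measurable_fun setT b ->
  P [set w | b w] = (\int[P]_w ((b w)%:R)%:E)%E.
Proof.
move=> mb; have mB := measurable_set_of mb.
rewrite -[X in P X]setIT -integral_indic//; apply: eq_integral => w _.
by rewrite indicE; congr (_%:R)%:E; congr nat_of_bool; apply/idP/idP; rewrite inE.
Qed.

Lemma prob_bool_le (P : probability T R) b (F : T -> \bar R) : measurable_fun setT b ->
  measurable_fun setT F -> (forall w, 0 <= F w)%E -> (forall w, b w -> 1 <= F w)%E ->
  (P [set w | b w] <= \int[P]_w F w)%E.
Proof.
move=> mb mF F0 bF; rewrite prob_bool//; apply: ge0_le_integral => //.
- exact: measurable_natb.
- by move=> w _; case: (boolP (b w)) => [/bF|_]; rewrite ?mulr1n.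
Qed.

Lemma measurable_resid n k (X : T -> 'M[R]_(n, k)) (y : T -> 'cV[R]_n) :
  mxmeas X -> mxmeas y -> mxmeas (fun t => resid (X t) (y t)).
Proof.
move=> mX my; apply: mxmeas_add => //; apply: mxmeas_opp; apply: mxmeas_mul => //.
apply: mxmeas_mul; last exact: mxmeas_tr.
apply: mxmeas_mul => //; apply: mxmeas_inv; apply: mxmeas_mul => //; exact: mxmeas_tr.
Qed.

Lemma measurable_gram_unit n k (X : T -> 'M[R]_(n, k)) : mxmeas X ->
  measurable_fun setT (fun t => (X t)^T *m X t \in unitmx).
Proof. by move=> mX; apply: measurable_unitmx; apply: mxmeas_mul => //; exact: mxmeas_tr. Qed.

Lemma measurable_dot n (u v : T -> 'cV[R]_n) : mxmeas u -> mxmeas v ->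
  measurable_fun setT (fun t => dot (u t) (v t)).
Proof. by move=> mu mv; apply: mxmeas_mul => //; exact: mxmeas_tr. Qed.

Lemma measurable_expR_comp (f : T -> R) : measurable_fun setT f ->
  measurable_fun setT (fun t => expR (f t)).
Proof. by move=> mf; apply: measurableT_comp. Qed.

End BoolEvents.

Lemma gint_cst (R : realType) n (c : \bar R) : gint (fun _ : 'cV[R]_n => c) = c.
Proof.
elim: n => [//|n IH] /=; under eq_integral do rewrite IH.
by rewrite integral_cst//= probability_setT mule1.
Qed.

Section Concentration.
Context (R : realType) (d : measure_display) (Om : measurableType d)
  (P : probability Om R) (n p : nat) (Z : 'I_n -> 'I_p -> Om -> R) (G : 'I_n -> Om -> R).
Hypothesis iid : iid_std_normal P (gauss_family Z G).

Let mZ := mxmeas_zmx iid.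
Let mG := mxmeas_gvec iid.

Let mZM k (M : 'M[R]_(p, k)) : mxmeas (fun w => zmx Z w *m M).
Proof. by apply: mxmeas_mul => //; exact: mxmeas_cst. Qed.

(** [Z q] is independent of [Z M], so the normalised residual is chi-square given [Z M] when the
    Gram matrix is invertible. The indicator discards the singular case, where [resid] is no
    projection residual. *)
Lemma integral_resid k (q : 'cV[R]_p) (M : 'M[R]_(p, k)) (c s : R) :
  q != 0 -> q^T *m M = 0 -> (k <= n)%N -> 0 <= s ->
  (\int[P]_w ((((zmx Z w *m M)^T *m (zmx Z w *m M) \in unitmx)%:R *
     expR (c - s * (l2sq (resid (zmx Z w *m M) (zmx Z w *m q)) / l2sq q) / 2))%:E)
   <= (expR (c - (n%:R - k%:R) / 2 * (s / (1 + s))))%:E)%E.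
Proof.
move=> q0 qM kn s0; have lq := l2sq_gt0 q0.
pose H (y : 'cV[R]_n) (X : 'M[R]_(n, k)) (g : 'cV[R]_n) : \bar R :=
  ((X^T *m X \in unitmx)%:R * expR (c - s * (l2sq (resid X y) / l2sq q) / 2))%:E.
apply: (column_decoupling iid (H := H)) => //.
- move=> d' T y X g my mX mg; rewrite /H.
  under eq_fun do rewrite EFinM.
  apply: emeasurable_funM; first by apply: measurable_natb; exact: measurable_gram_unit.
  apply/measurable_EFinP; apply: measurable_expR_comp; apply: measurable_funB => //.
  do ! apply: measurable_funM => //.
  by apply: measurable_l2sq; exact: measurable_resid.
- by move=> y X g; rewrite lee_fin mulr_ge0// expR_ge0.
move=> rho X g rho2; rewrite /H; case: (boolP (_ \in _)) => uX; last first.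
  rewrite (_ : (fun y => _) = fun=> 0%E); first by rewrite gint_cst lee_fin expR_ge0.
  by apply/funext => y; rewrite mul0r.
rewrite (_ : (fun y => _) = fun y => (expR (c - s * l2sq (resid X y) / 2))%:E); last first.
  by apply/funext => y; rewrite mul1r residZ l2sqZ rho2 [l2sq q * _]mulrC mulfK ?gt_eqF.
rewrite gint_resid// lee_fin expRD ler_wpM2l ?expR_ge0//.
exact: sqrt_pow_expR_le.
Qed.

(** Chernoff's bound for the lower tail of a chi-square variable; the parameter [s] is left open
    because its uses need different values. *)
Lemma prob_resid_small k (q : 'cV[R]_p) (M : 'M[R]_(p, k)) (th s : R) :
  q != 0 -> q^T *m M = 0 -> (k <= n)%N -> 0 <= s ->
  (P [set w | ((zmx Z w *m M)^T *m (zmx Z w *m M) \in unitmx) &&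
      (l2sq (resid (zmx Z w *m M) (zmx Z w *m q)) <= th * l2sq q)%R]
   <= (expR (s * th / 2 - (n%:R - k%:R) / 2 * (s / (1 + s))))%:E)%E.
Proof.
move=> q0 qM kn s0; have lq := l2sq_gt0 q0.
apply: le_trans (integral_resid (s * th / 2) q0 qM kn s0).
have mr : measurable_fun setT (fun w => l2sq (resid (zmx Z w *m M) (zmx Z w *m q))).
  by apply: measurable_l2sq; apply: measurable_resid.
have mu := measurable_gram_unit (mZM M).
apply: prob_bool_le.
- by apply: measurable_and => //; exact: measurable_fun_ler.
- under eq_fun do rewrite EFinM.
  apply: emeasurable_funM; first exact: measurable_natb.
  apply/measurable_EFinP; apply: measurable_expR_comp; apply: measurable_funB => //.
  by do ! apply: measurable_funM => //.
- by move=> w; rewrite lee_fin mulr_ge0// expR_ge0.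
- move=> w /andP[-> h]; rewrite mul1r lee_fin -[leLHS]expR0 ler_expR subr_ge0.
  by rewrite ler_pM2r// ler_wpM2l// ler_pdivrMr.
Qed.

Lemma expR_9_10 : (2 <= expR (9 / 10) :> R)%R.
Proof.
have e : (9 / 10 = 2%:R * (9 / 20) :> R)%R by field.
have h := @expR_ge1Dx R (9 / 20).
apply: (@le_trans _ _ ((1 + 9 / 20) ^+ 2)); first by lra.
by rewrite e expRM_natl; apply: lerXn2r => //; rewrite nnegrE; lra.
Qed.

(** Chernoff's bound at twice the mean: [E exp(|y|^2 / 4) = 2^(n/2) <= exp(9 n / 20)], and
    [1/2 - 9/20 = 1/20]. *)
Lemma chisq_bound : (expR (- (n%:R / 2)) * (Num.sqrt (1 - 1 / 2))^-1 ^+ n <= expR (- (n%:R / 20)) :> R)%R.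
Proof.
have e : (Num.sqrt (1 - 1 / 2))^-1 <= expR (9 / 20) :> R.
  rewrite -[leRHS]ger0_norm ?expR_ge0// -sqrtr_sqr -expRM_natl -sqrtrV; last by lra.
  rewrite ler_wsqrtr// (_ : 2%:R * _ = 9 / 10); last by field.
  by apply: le_trans expR_9_10; rewrite (_ : (1 - 1 / 2)^-1 = 2 :> R)//; field.
apply: (@le_trans _ _ (expR (- (n%:R / 2)) * expR (9 / 20) ^+ n)).
  by rewrite ler_wpM2l ?expR_ge0// lerXn2r ?nnegrE ?expR_ge0 ?invr_ge0 ?sqrtr_ge0.
by rewrite -expRM_natl -expRD ler_expR; lra.
Qed.

Lemma prob_sqr_large (q : 'cV[R]_p) : q != 0 ->
  (P [set w | (2 * n%:R * l2sq q < l2sq (zmx Z w *m q))%R] <= (expR (- (n%:R / 20)))%:E)%E.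
Proof.
move=> q0; have lq := l2sq_gt0 q0.
(* Nothing is conditioned on here, so the decoupling is applied to a matrix with no columns. *)
pose H (y : 'cV[R]_n) (X : 'M[R]_(n, 0)) (g : 'cV[R]_n) : \bar R :=
  (expR (- (n%:R / 2) + 1 / 2 * (l2sq y / l2sq q) / 2))%:E.
have me T d' (T' : measurableType d') (y : T' -> 'cV[R]_n) : mxmeas y ->
    measurable_fun setT (fun t => (expR (- (n%:R / 2) + 1 / 2 * (l2sq (y t) / l2sq q) / 2))%:E : \bar R).
  move=> my; apply/measurable_EFinP; apply: measurable_expR_comp.
  apply: measurable_funD => //; do ! apply: measurable_funM => //.
  exact: measurable_l2sq.
have mZq : mxmeas (fun w => zmx Z w *m q) by [].
apply: (@le_trans _ _ (\int[P]_w H (zmx Z w *m q) (zmx Z w *m 0) (gvec G w))%E).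
  apply: prob_bool_le.
  - apply: measurable_fun_ltr => //; exact: measurable_l2sq.
  - exact: me.
  - by move=> w; rewrite lee_fin expR_ge0.
  - move=> w h; rewrite lee_fin -[leLHS]expR0 ler_expR.
    have : 2 * n%:R <= l2sq (zmx Z w *m q) / l2sq q by rewrite ler_pdivlMr// ltW.
    move: (_ / l2sq q) => t. by lra.
apply: (column_decoupling iid (H := H)) => //.
- by rewrite mulmx0.
- by move=> d' T y X g my _ _; exact: me.
- by move=> *; rewrite lee_fin expR_ge0.
move=> rho X g rho2; rewrite /H.
rewrite (_ : (fun y => _) = fun y => (expR (- (n%:R / 2) + 1 / 2 * l2sq y / 2))%:E); last first.
  by apply/funext => y; rewrite l2sqZ rho2 [l2sq q * _]mulrC mulfK ?gt_eqF.
by rewrite gint_sqr ?lee_fin ?chisq_bound//; lra.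
Qed.

Lemma prob_noise_sqr_large :
  (P [set w | (2 * n%:R < l2sq (gvec G w))%R] <= (expR (- (n%:R / 20)))%:E)%E.
Proof.
pose H (X : 'M[R]_(n, p)) (y : 'cV[R]_n) : \bar R :=
  (expR (- (n%:R / 2) + 1 / 2 * l2sq y / 2))%:E.
have me T d' (T' : measurableType d') (y : T' -> 'cV[R]_n) : mxmeas y ->
    measurable_fun setT (fun t => (expR (- (n%:R / 2) + 1 / 2 * l2sq (y t) / 2))%:E : \bar R).
  move=> my; apply/measurable_EFinP; apply: measurable_expR_comp.
  apply: measurable_funD => //; do ! apply: measurable_funM => //.
  exact: measurable_l2sq.
apply: (@le_trans _ _ (\int[P]_w H (zmx Z w) (gvec G w))%E).
  apply: prob_bool_le.
  - apply: measurable_fun_ltr => //; exact: measurable_l2sq.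
  - exact: me.
  - by move=> w; rewrite lee_fin expR_ge0.
  - by move=> w h; rewrite lee_fin -[leLHS]expR0 ler_expR; lra.
have mH : meas2 H by move=> d' T X g _ mg; exact: me.
rewrite (noise_decoupling iid mH); last by move=> *; rewrite lee_fin expR_ge0.
have gE X : gint (H X) = (expR (- (n%:R / 2)) * (Num.sqrt (1 - 1 / 2))^-1 ^+ n)%:E.
  by apply: gint_sqr; lra.
apply: (@le_trans _ _ (\int[P]_w (expR (- (n%:R / 20)))%:E)%E).
  apply: ge0_le_integral => //.
  - by move=> w _; apply: gint_ge0 => y; rewrite lee_fin expR_ge0.
  - by under eq_fun do rewrite gE; exact: measurable_cst.
  - by move=> w _; rewrite gE lee_fin; exact: chisq_bound.
by rewrite integral_cst//= probability_setT mule1.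
Qed.

(** The vector [a] is a function of [Z M] and of the noise, hence independent of [Z q]; given [a],
    the product is centred Gaussian with deviation [l2 a * l2 q]. Strictness of the inequality makes
    the event empty when [a = 0]. *)
Lemma prob_linear k (q : 'cV[R]_p) (M : 'M[R]_(p, k))
  (a : 'M[R]_(n, k) -> 'cV[R]_n -> 'cV[R]_n) (x : R) :
  q != 0 -> q^T *m M = 0 -> 0 < x ->
  (forall d' (T : measurableType d') (X : T -> 'M[R]_(n, k)) (g : T -> 'cV[R]_n),
    mxmeas X -> mxmeas g -> mxmeas (fun t => a (X t) (g t))) ->
  (P [set w | (x * l2 (a (zmx Z w *m M) (gvec G w)) * l2 q <
       `|dot (a (zmx Z w *m M) (gvec G w)) (zmx Z w *m q)|)%R] <= (expR (- (x ^+ 2 / 2)))%:E)%E.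
Proof.
move=> q0 qM x0 ma.
pose H (y : 'cV[R]_n) (X : 'M[R]_(n, k)) (g : 'cV[R]_n) : \bar R :=
  (((l2 (a X g) != 0) && (x * l2 (a X g) * l2 q <= `|dot (a X g) y|)%R)%:R)%:E.
have mH : meas3 H.
  move=> d' T y X g my mX mg; apply: measurable_natb; apply: measurable_and.
    by apply: measurable_neg; apply: measurable_fun_eqr => //; apply: measurable_l2; exact: ma.
  apply: measurable_fun_ler.
    by do ! apply: measurable_funM => //; apply: measurable_l2; exact: ma.
  by apply: measurableT_comp => //; apply: measurable_dot => //; exact: ma.
apply: (@le_trans _ _ (\int[P]_w H (zmx Z w *m q) (zmx Z w *m M) (gvec G w))%E).
  apply: prob_bool_le.
  - apply: measurable_fun_ltr.
      by do ! apply: measurable_funM => //; apply: measurable_l2; exact: ma.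
    by apply: measurableT_comp => //; apply: measurable_dot => //; exact: ma.
  - exact: mH.
  - by move=> w; rewrite lee_fin.
  - move=> w h; rewrite /H (ltW h) andbT lee_fin.
    case: eqVneq => [e|//].
    have a0 : a (zmx Z w *m M) (gvec G w) = 0.
      by apply/eqP; rewrite -l2sq_eq0 -l2_sqr e expr0n.
    by move: h; rewrite a0 dot0l normr0 /l2 l2sqE dot0l sqrtr0 mulr0 mul0r ltxx.
apply: (column_decoupling iid (H := H)) => //.
  by move=> *; rewrite lee_fin.
move=> rho X g rho2; rewrite /H; have [e|a0] := eqVneq (l2 (a X g)) 0.
  by rewrite -[X in (X <= _)%E]/(gint (fun=> 0%E)) gint_cst lee_fin expR_ge0.
have la : 0 < l2 (a X g) by rewrite lt0r a0 l2_ge0.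
have lq : 0 < l2 q by rewrite sqrtr_gt0 l2sq_gt0.
have rq : `|rho| = l2 q.
  by rewrite /l2 -rho2 sqrtr_sqr.
rewrite (_ : (fun y => _) = fun y => ((x * l2 (a X g) <= `|dot (a X g) y|)%R%:R)%:E); last first.
  apply/funext => y; rewrite /= dotZr normrM rq mulrC ler_pM2l//.
have mu0 : 0 < x * l2 (a X g) by rewrite mulr_gt0.
apply: le_trans (gint_tail _ mu0) _; rewrite lee_fin ler_expR exprMn l2_sqr.
rewrite le_eqVlt; apply/orP; left; apply/eqP; field.
by rewrite -l2_sqr sqrf_eq0.
Qed.

(** The bound is conditional on the design, and its right side stays an integral over [Z] so that
    the random variance can later be averaged. *)
Lemma prob_noise_tail (h : 'M[R]_(n, p) -> 'cV[R]_n) (b : 'M[R]_(n, p) -> bool) (mu : 'M[R]_(n, p) -> R) :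
  (forall d' (T : measurableType d') (X : T -> 'M[R]_(n, p)),
    mxmeas X -> mxmeas (fun t => h (X t))) ->
  (forall d' (T : measurableType d') (X : T -> 'M[R]_(n, p)),
    mxmeas X -> measurable_fun setT (fun t => b (X t))) ->
  (forall d' (T : measurableType d') (X : T -> 'M[R]_(n, p)),
    mxmeas X -> measurable_fun setT (fun t => mu (X t))) ->
  (forall X, b X -> 0 < mu X) ->
  (P [set w | b (zmx Z w) && (mu (zmx Z w) <= `|dot (h (zmx Z w)) (gvec G w)|)%R] <=
   \int[P]_w ((b (zmx Z w))%:R * expR (- mu (zmx Z w) ^+ 2 / (2 * l2sq (h (zmx Z w)))))%:E)%E.
Proof.
move=> mh mb mmu mu0.
pose H (X : 'M[R]_(n, p)) (y : 'cV[R]_n) : \bar R :=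
  ((b X && (mu X <= `|dot (h X) y|)%R)%:R)%:E.
have mH' d' (T : measurableType d') (X : T -> 'M[R]_(n, p)) (g : T -> 'cV[R]_n) :
    mxmeas X -> mxmeas g -> measurable_fun setT (fun t => b (X t) && (mu (X t) <= `|dot (h (X t)) (g t)|)%R).
  move=> mX mg; apply: measurable_and; first exact: mb.
  apply: measurable_fun_ler; first exact: mmu.
  by apply: measurableT_comp => //; apply: measurable_dot => //; exact: mh.
have mH : meas2 H by move=> d' T X g mX mg; apply: measurable_natb; exact: mH'.
have H0 X g : (0 <= H X g)%E by rewrite lee_fin.
rewrite prob_bool; last exact: mH'.
rewrite -/(\int[P]_w H (zmx Z w) (gvec G w))%E (noise_decoupling iid mH H0).
apply: ge0_le_integral => //.
- by move=> w _; apply: gint_ge0.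
- pose F (v : 'I_n * 'I_p -> R) (y : 'cV[R]_n) := H (\matrix_(i, j) v (i, j)) y.
  have mF : meas_col F.
    move=> d' T phi y mphi my; apply: mH.
      by move=> i j; under eq_fun do rewrite mxE; exact: mphi.
    by move=> i j; rewrite ord1; exact: my.
  have := meas_gint mF (fun v y => H0 _ _).
  move=> /(_ _ _ (fun ij w => zmx Z w ij.1 ij.2) (fun ij => mZ _ _)).
  rewrite /F; apply: eq_measurable_fun => w _; congr gint; apply/funext => y.
  by congr H; apply/matrixP => i j; rewrite mxE.
- under eq_fun do rewrite EFinM.
  apply: emeasurable_funM; first by apply: measurable_natb; exact: mb.
  apply/measurable_EFinP; apply: measurable_expR_comp; apply: measurable_funM.
    by apply: measurableT_comp => //; apply: measurable_funX; exact: mmu.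
  by apply: measurable_realV; apply: measurable_funM => //; apply: measurable_l2sq; exact: mh.
move=> w _; rewrite /H; case: (boolP (b _)) => bX /=.
  by rewrite mul1r; apply: gint_tail; exact: mu0.
by rewrite gint_cst mul0r.
Qed.

Lemma prob_noise_linear (h : 'M[R]_(n, p) -> 'cV[R]_n) (x : R) : 0 < x ->
  (forall d' (T : measurableType d') (X : T -> 'M[R]_(n, p)),
    mxmeas X -> mxmeas (fun t => h (X t))) ->
  (P [set w | (x * l2 (h (zmx Z w)) < `|dot (h (zmx Z w)) (gvec G w)|)%R]
     <= (expR (- (x ^+ 2 / 2)))%:E)%E.
Proof.
move=> x0 mh.
have ml d' (T : measurableType d') (X : T -> 'M[R]_(n, p)) : mxmeas X ->
    measurable_fun setT (fun t => x * l2 (h (X t))).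
  by move=> mX; apply: measurable_funM => //; apply: measurable_l2; exact: mh.
pose b (X : 'M[R]_(n, p)) := x * l2 (h X) != 0.
have mb d' (T : measurableType d') (X : T -> 'M[R]_(n, p)) : mxmeas X ->
    measurable_fun setT (fun t => b (X t)).
  by move=> mX; apply: measurable_neg; apply: measurable_fun_eqr => //; exact: ml.
have b0 X : b X -> 0 < x * l2 (h X).
  by move=> bX; rewrite lt0r; apply/andP; split => //; rewrite mulr_ge0 ?l2_ge0// ltW.
have mabs : measurable_fun setT (fun w => `|dot (h (zmx Z w)) (gvec G w)|).
  by apply: measurableT_comp => //; apply: measurable_dot => //; exact: mh.
apply: (@le_trans _ _ (P [set w | b (zmx Z w) && (x * l2 (h (zmx Z w)) <= `|dot (h (zmx Z w)) (gvec G w)|)%R])).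
  apply: le_measure; rewrite ?inE.
  - by apply: measurable_set_of; apply: measurable_fun_ltr => //; exact: ml.
  - apply: measurable_set_of; apply: measurable_and; first exact: mb.
    by apply: measurable_fun_ler => //; exact: ml.
  move=> w /= hw; rewrite (ltW hw) andbT /b mulf_neq0 ?gt_eqF//.
  rewrite lt0r l2_ge0 andbT; apply: contraTneq hw => e.
  have -> : h (zmx Z w) = 0 by apply/eqP; rewrite -l2sq_eq0 -l2_sqr e expr0n.
  by rewrite dot0l normr0 /l2 l2sqE dot0l sqrtr0 mulr0 ltxx.
apply: le_trans; first exact: (prob_noise_tail mh mb ml b0).
apply: (@le_trans _ _ (\int[P]_w (expR (- (x ^+ 2 / 2)))%:E)%E); last first.
  by rewrite integral_cst//= probability_setT mule1.
apply: ge0_le_integral => //.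
- under eq_fun do rewrite EFinM.
  apply: emeasurable_funM; first by apply: measurable_natb; exact: mb.
  apply/measurable_EFinP; apply: measurable_expR_comp; apply: measurable_funM.
    by apply: measurableT_comp => //; apply: measurable_funX; exact: ml.
  by apply: measurable_realV; apply: measurable_funM => //; apply: measurable_l2sq; exact: mh.
move=> w _; rewrite lee_fin; case: (boolP (b _)) => [bw|_]; last by rewrite mul0r expR_ge0.
rewrite mul1r ler_expR exprMn l2_sqr le_eqVlt; apply/orP; left; apply/eqP; field.
by rewrite -l2_sqr sqrf_eq0; move: bw; rewrite /b mulf_eq0 negb_or => /andP[].
Qed.

End Concentration.

(** * Invertibility of the Gram matrix *)

Section Invertibility.
Context (R : realType) (d : measure_display) (Om : measurableType d)
  (P : probability Om R) (n p : nat) (Z : 'I_n -> 'I_p -> Om -> R) (G : 'I_n -> Om -> R).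
Hypothesis iid : iid_std_normal P (gauss_family Z G).

Lemma residDl k (X : 'M[R]_(n, k)) y z : resid X (y + z) = resid X y + resid X z.
Proof. by rewrite /resid mulmxDr opprD addrACA. Qed.

Lemma gram_row_mx_unit k (x : 'cV[R]_n) (X : 'M[R]_(n, k)) (v : 'cV[R]_k) :
  X^T *m X \in unitmx -> resid X (x - X *m v) != 0 ->
  (row_mx x X)^T *m row_mx x X \in unitmx.
Proof.
move=> uX r0; apply/gram_unitP => u; rewrite -[u]vsubmxK mul_row_col.
set a := usubmx u; set b := dsubmx u => h.
have xa : x *m a = a 0 0 *: x by rewrite {1}[a]mx11_scalar mul_mx_scalar.
have a0 : a 0 0 = 0.
  have := congr1 (resid X) h; rewrite residDl residX// addr0 xa residZ.
  have -> : resid X 0 = 0 by rewrite /resid mulmx0 subrr.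
  move/eqP; rewrite scaler_eq0 => /orP[/eqP//|]; move: r0.
  by rewrite residDl -mulmxN residX// addr0 => /negbTE ->.
have a1 : a = 0 by rewrite [LHS]mx11_scalar a0 raddf0.
move: h; rewrite xa a0 scale0r add0r => /(elimT (gram_unitP X) uX) ->.
by rewrite a1 col_mx0.
Qed.

(** Columns are adjoined one at a time, and a first failure forces the residual of the new column to
    vanish. The exact probability is zero, but Chernoff's bound with threshold 0 and [s = 1] gives
    enough; [k0] fixes one rate for the whole induction. *)
Lemma prob_not_unit k0 k (M : 'M[R]_(p, k)) : M^T *m M \in unitmx ->
  (k <= k0)%N -> (k0 <= n)%N ->
  (P [set w | (zmx Z w *m M)^T *m (zmx Z w *m M) \notin unitmx] <=
    (k%:R * expR (- ((n%:R - k0%:R) / 4)))%:E)%E.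
Proof.
have mZ := mxmeas_zmx iid.
have mZM j (M' : 'M[R]_(p, j)) : mxmeas (fun w => zmx Z w *m M').
  by apply: mxmeas_mul => //; exact: mxmeas_cst.
have mun j (M' : 'M[R]_(p, j)) : measurable [set w | (zmx Z w *m M')^T *m (zmx Z w *m M') \notin unitmx].
  by apply: measurable_set_of; apply: measurable_neg; apply: measurable_gram_unit.
elim: k M => [|k IH] M uM kk0 k0n.
  rewrite mul0r (_ : [set w | _] = set0) ?measure0//.
  apply/seteqP; split => w //=; rewrite (_ : _ *m _ = 1%:M) ?unitmx1//.
  by apply/matrixP => -[].
pose c : 'cV[R]_p := lsubmx (M : 'M[R]_(p, 1 + k)).
pose M' : 'M[R]_(p, k) := rsubmx (M : 'M[R]_(p, 1 + k)).
have ME : M = row_mx c M' :> 'M[R]_(p, 1 + k) by rewrite hsubmxK.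
have injM : forall u : 'cV[R]_(1 + k), row_mx c M' *m u = 0 -> u = 0.
  by apply/gram_unitP; rewrite -ME.
have uM' : M'^T *m M' \in unitmx.
  apply/gram_unitP => u M'u; have := injM (col_mx 0 u).
  by rewrite mul_row_col mulmx0 add0r => /(_ M'u) /(congr1 dsubmx); rewrite col_mxKd linear0.
pose v := invmx (M'^T *m M') *m (M'^T *m c).
(* [q] is orthogonal to the columns of [M'], as decoupling requires, and [Z q] has the same residual
   on [Z M'] as [Z c]. *)
pose q := c - M' *m v.
have q0 : q != 0.
  apply/eqP => q0; have := injM (col_mx 1%:M (- v)).
  rewrite mul_row_col mulmx1 mulmxN -/q => /(_ q0) /(congr1 usubmx)/matrixP/(_ 0 0).
  by rewrite col_mxKu linear0 !mxE eqxx => /eqP; rewrite oner_eq0.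
have qM : q^T *m M' = 0.
  apply: trmx_inj; rewrite trmx_mul trmxK trmx0 /q mulmxBr.
  by rewrite /v mulmxA mulKVmx// subrr.
have kn : (k <= n)%N by apply: leq_trans k0n; exact: ltnW.
have h2 := prob_resid_small iid 0 q0 qM kn ler01.
have h1 := IH M' uM' (ltnW kk0) k0n.
rewrite mulr0 mul0r sub0r in h2.
have m2 : measurable [set w | ((zmx Z w *m M')^T *m (zmx Z w *m M') \in unitmx) &&
      (l2sq (resid (zmx Z w *m M') (zmx Z w *m q)) <= 0 * l2sq q)%R].
  apply: measurable_set_of; apply: measurable_and; first exact: measurable_gram_unit.
  by apply: measurable_fun_ler => //; apply: measurable_l2sq; apply: measurable_resid.
apply: (@le_trans _ _ (P ([set w | (zmx Z w *m M')^T *m (zmx Z w *m M') \notin unitmx] `|`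
   [set w | ((zmx Z w *m M')^T *m (zmx Z w *m M') \in unitmx) &&
      (l2sq (resid (zmx Z w *m M') (zmx Z w *m q)) <= 0 * l2sq q)%R])))%E.
  apply: le_measure; rewrite ?inE//.
    by apply: measurableU.
  move=> w /= nu; case: (boolP (_ \in _)) => uX'; [right|by left].
  rewrite /= mul0r; rewrite leNgt; apply: contra nu => r0.
  rewrite -[X in X^T *m _]/(zmx Z w *m (M : 'M[R]_(p, 1 + k))) ME mul_mx_row.
  apply: (gram_row_mx_unit (v := v)) => //.
  rewrite -l2sq_eq0 gt_eqF//; move: r0; rewrite /q mulmxBr mulmxA.
  by [].
apply: le_trans; first by apply: measureU2.
apply: le_trans; first exact: (leeD h1 h2).
rewrite -EFinD lee_fin (_ : k.+1%:R = k%:R + 1); last by rewrite natr1.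
rewrite [leRHS]mulrDl [1 * expR _]mul1r lerD2l ler_expR.
have -> : 1 / (1 + 1) = 2^-1 :> R by rewrite mul1r.
have : k%:R <= k0%:R :> R by rewrite ler_nat ltnW.
by lra.
Qed.

End Invertibility.

(** * Deterministic analysis of the Lasso *)

Section Directional.
Context {R : realType} (n m k : nat) (X : 'M[R]_(n, m)) (u xu : 'cV[R]_m) (N : 'M[R]_(m, k)).
Hypothesis uS : X^T *m X \in unitmx.
Hypothesis u0 : u != 0.
Hypothesis d0 : dot u xu != 0.
Hypothesis N0 : N^T *m u = 0.
Hypothesis Ns : forall z, dot u z = 0 -> exists y, z = N *m y.
Hypothesis Ni : forall y : 'cV[R]_k, N *m y = 0 -> y = 0.

Let S := X^T *m X.
Let h := X *m (invmx S *m u).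
Let rho := dot u (invmx S *m u).
Let r := resid (X *m N) (X *m xu).

Lemma gram_mul_unit : (X *m N)^T *m (X *m N) \in unitmx.
Proof.
by apply/gram_unitP => y; rewrite -mulmxA => /(elimT (gram_unitP X) uS) /Ni.
Qed.

Let Ssym : (invmx S)^T = invmx S.
Proof. by rewrite trmx_inv /S trmx_mul trmxK. Qed.

Let trXsol (b : 'cV[R]_m) : X^T *m (X *m (invmx S *m b)) = b.
Proof. by rewrite mulmxA mulKVmx. Qed.

Lemma l2sq_sol (b : 'cV[R]_m) : l2sq (X *m (invmx S *m b)) = dot b (invmx S *m b).
Proof. by rewrite l2sqE dot_mull trXsol dotC. Qed.

Lemma directional_rho_gt0 : 0 < rho.
Proof.
rewrite /rho -l2sq_sol l2sq_gt0//; apply: contraNneq u0 => e.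
by rewrite -(trXsol u) e mulmx0.
Qed.

(** [h] is orthogonal to the columns of [X N], because [N^T X^T h = N^T u = 0]; and [X xu] minus
    this multiple of [h] is [X] applied to a vector orthogonal to [u], hence in the span of
    [X N]. *)
Let rE : r = (dot u xu / rho) *: h.
Proof.
have rho0 : rho != 0 by rewrite gt_eqF// directional_rho_gt0.
have [c cE] := colprojE (X *m N) (X *m xu).
pose z := xu - N *m c - (dot u xu / rho) *: (invmx S *m u).
have e : r - (dot u xu / rho) *: h = X *m z.
  by rewrite /r /resid cE /z /h !mulmxBr -scalemxAr !mulmxA.
have [|y zE] := Ns (z := z).
  by rewrite /z !dotBr dotZr dot_mulr N0 dot0l subr0 divfK// subrr.
apply/eqP; rewrite -subr_eq0 -l2sq_eq0 l2sqE {2}e zE mulmxA dot_mulr.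
rewrite mulmxBr -scalemxAr (tr_resid gram_mul_unit) trmx_mul -mulmxA.
by rewrite trXsol N0 scaler0 subr0 dot0l.
Qed.

Lemma directional_rho : rho * l2sq r = dot u xu ^+ 2.
Proof.
have rho0 : rho != 0 by rewrite gt_eqF// directional_rho_gt0.
by rewrite rE l2sqZ l2sq_sol -/rho; field.
Qed.

(** The projection of [X S^-1 b] on the columns of [X N]. As [X^T X S^-1 b = b], it can be written
    with [N^T b], which exhibits it as a function of [X N] alone and lets [prob_linear] apply to its
    product with [X xu]. *)
Definition cross_vec (b : 'cV[R]_m) (Y : 'M[R]_(n, k)) : 'cV[R]_n :=
  Y *m (invmx (Y^T *m Y) *m (N^T *m b)).

Let cross_vecE (b : 'cV[R]_m) : cross_vec b (X *m N) = colproj (X *m N) *m (X *m (invmx S *m b)).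
Proof.
rewrite /cross_vec /colproj -!mulmxA; congr (_ *m (_ *m (_ *m _))).
by rewrite trmx_mul -!mulmxA; congr (_ *m _); rewrite -{1}(trXsol b).
Qed.

(** Since [h] is a multiple of [r], the entry equals, up to the factor [rho / (u . xu)], its
    population value minus a product of [X xu] with a vector depending on [X N] only. *)
Lemma directional_inv (b : 'cV[R]_m) : dot u (invmx S *m b) =
  rho / dot u xu * (dot b xu - dot (cross_vec b (X *m N)) (X *m xu)).
Proof.
have rho0 : rho != 0 by rewrite gt_eqF// directional_rho_gt0.
have -> : dot u (invmx S *m b) = dot h (X *m (invmx S *m b)).
  by rewrite dot_mull trXsol dot_mull Ssym.
have -> : h = (rho / dot u xu) *: r.
  rewrite rE scalerA (_ : rho / dot u xu * (dot u xu / rho) = 1) ?scale1r//.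
  by field; rewrite rho0 d0.
rewrite dotZl; congr (_ * _).
rewrite /r /resid dotBl; congr (_ - _).
  by rewrite dot_mull trXsol dotC.
by rewrite cross_vecE dot_mull colproj_sym dotC.
Qed.

Lemma l2sq_cross_vec (b : 'cV[R]_m) : l2sq (cross_vec b (X *m N)) <= dot b (invmx S *m b).
Proof.
rewrite -l2sq_sol cross_vecE.
set y := X *m (invmx S *m b).
have P2 : dot (colproj (X *m N) *m y) (colproj (X *m N) *m y) = dot y (colproj (X *m N) *m y).
  rewrite dot_mull colproj_sym; congr (dot y _).
  by have [c ->] := colprojE (X *m N) y; rewrite mulmxA (colprojX gram_mul_unit).
rewrite l2sqE P2 -subr_ge0 -(l2sq_resid gram_mul_unit); exact: l2sq_ge0.
Qed.

End Directional.

Lemma orthogonal_basis (R : realType) m (u : 'cV[R]_m) :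
  exists k (N : 'M[R]_(m, k)), [/\ (k <= m)%N, N^T *m u = 0,
    forall z, dot u z = 0 -> exists y, z = N *m y &
    forall y : 'cV[R]_k, N *m y = 0 -> y = 0].
Proof.
exists (\rank (kermx u)), (row_base (kermx u))^T; split.
- exact: rank_leq_row.
- by rewrite trmxK; apply/sub_kermxP; rewrite eq_row_base.
- move=> z uz; have : (z^T <= row_base (kermx u))%MS.
    rewrite eq_row_base; apply/sub_kermxP.
    by apply/matrixP => i j; rewrite !ord1 -/(dot z u) dotC uz mxE.
  case/submxP => D zD; exists D^T.
  by apply: trmx_inj; rewrite zD trmx_mul !trmxK.
- move=> y h; have : y^T *m row_base (kermx u) = 0.
    by apply: trmx_inj; rewrite trmx_mul trmxK h trmx0.
  move=> /(congr1 (mulmx^~ (pinvmx (row_base (kermx u))))).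
  rewrite mul0mx -mulmxA mulmxVp ?row_base_free// mulmx1 => /(congr1 trmx).
  by rewrite trmxK trmx0.
Qed.

Section Certificate.
Context {R : realType} (n p : nat).

(** Optimality of [th] gives [|X del|^2 + 2 n lam sum_j (|th_j| - z_j th_j) <= 0] for
    [del = th - ths]. Both terms are nonnegative, so both vanish; strict feasibility of [z] kills
    [th] off the support of [ths], and injectivity on that support gives [del = 0]. *)
Lemma lasso_certificate (X : 'M[R]_(n, p)) (Y : 'cV[R]_n) (lam : R) (th ths z : 'cV[R]_p) :
  (0 < n)%N -> 0 < lam ->
  X^T *m (Y - X *m ths) = (n%:R * lam) *: z ->
  (forall j, ths j 0 != 0 -> z j 0 = Num.sg (ths j 0)) ->
  (forall j, ths j 0 = 0 -> `|z j 0| < 1) ->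
  (forall v : 'cV[R]_p, (forall j, ths j 0 = 0 -> v j 0 = 0) -> X *m v = 0 -> v = 0) ->
  is_lasso X Y lam th -> th = ths.
Proof.
move=> n0 lam0 kkt zs zlt inj /(_ ths).
have nR : 0 < n%:R :> R by rewrite ltr0n.
have [del thE] : exists del, th = ths + del by exists (th - ths); rewrite addrC subrK.
have e1 : l2sq (Y - X *m th) = l2sq (Y - X *m ths) - 2 * (n%:R * lam) * dot z del + l2sq (X *m del).
  have -> : Y - X *m th = (Y - X *m ths) - X *m del by rewrite thE mulmxDr opprD addrA.
  move: (Y - X *m ths) (X *m del) (fun e => @dot_mulr _ _ _ X e del) kkt => e Xd dm kkt.
  rewrite !l2sqE dotBl !dotBr [dot Xd e]dotC (dm e) kkt dotZl; ring.
have zths : dot z ths = l1 ths.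
  rewrite dotE; apply: eq_bigr => j _; have [->|t0] := eqVneq (ths j 0) 0.
    by rewrite mulr0 normr0.
  by rewrite zs// -normrEsg.
rewrite /lasso_obj e1 => h.
have ge j : 0 <= `|th j 0| - z j 0 * th j 0.
  have zj : `|z j 0| <= 1.
    have [e|t0] := eqVneq (ths j 0) 0; first by rewrite ltW// zlt.
    by rewrite zs// normr_sg; case: (_ != _).
  rewrite subr_ge0 (le_trans (ler_norm _))// normrM ler_piMl//.
have sum0 : l2sq (X *m del) + (2 * n%:R * lam) * (\sum_j (`|th j 0| - z j 0 * th j 0)) <= 0.
  rewrite sumrB -/(l1 th) -(dotE z th) thE dotDr zths -thE.
  move: h; rewrite [(2 * n%:R)^-1]invfM.
  set a := l2sq (Y - _); set b := l2sq (X *m del); set c := dot z del.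
  set l := l1 th; set l' := l1 ths => h.
  have : 2 * n%:R * (2^-1 / n%:R * (a - 2 * (n%:R * lam) * c + b) + lam * l) <=
     2 * n%:R * (2^-1 / n%:R * a + lam * l') by rewrite ler_pM2l// mulr_gt0.
  rewrite (_ : 2 * n%:R * (2^-1 / n%:R * (a - 2 * (n%:R * lam) * c + b) + lam * l) =
    a - 2 * (n%:R * lam) * c + b + 2 * n%:R * lam * l); last by field; rewrite gt_eqF.
  rewrite (_ : 2 * n%:R * (2^-1 / n%:R * a + lam * l') = a + 2 * n%:R * lam * l'); last by field; rewrite gt_eqF.
  move=> h'; rewrite -subr_le0 in h'; apply: le_trans h'.
  by rewrite le_eqVlt; apply/orP; left; apply/eqP; ring.
have s0 : \sum_j (`|th j 0| - z j 0 * th j 0) = 0.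
  apply/eqP; rewrite eq_le sumr_ge0// andbT.
  have c0 : 0 < 2 * n%:R * lam by rewrite !mulr_gt0.
  rewrite -(ler_pM2l c0) mulr0; apply: le_trans sum0.
  by rewrite lerDr l2sq_ge0.
have Xd : X *m del = 0.
  by apply/eqP; rewrite -l2sq_eq0 eq_le l2sq_ge0 andbT; move: sum0; rewrite s0 mulr0 addr0.
have del0 : del = 0.
  apply: inj => // j tj.
  have <- : th j 0 = del j 0 by rewrite thE mxE tj add0r.
  have : `|th j 0| - z j 0 * th j 0 = 0 by exact: (psumr_eq0P (fun i _ => ge i) s0).
  move/eqP.
  rewrite subr_eq0 => /eqP e; apply/eqP; apply: contraT => t0.
  have : `|th j 0| < `|th j 0|.
    rewrite {1}e (le_lt_trans (ler_norm _))// normrM gtr_pMl ?normr_gt0//; exact: zlt.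
  by rewrite ltxx.
by rewrite thE del0 addr0.
Qed.

End Certificate.

(** * Selection matrices and bases of orthogonal complements *)

Section Selection.
Context {R : realType} (p : nat) (T : {set 'I_p}).

(** The selection matrix of [T]: restriction, extension by zero and submatrices all become products,
    and reindexing becomes associativity. *)
Definition emb : 'M[R]_(p, #|T|) := subcols T 1%:M.

Lemma subcolsE n (X : 'M[R]_(n, p)) : subcols T X = X *m emb.
Proof. by rewrite /emb /subcols mulmx_colsub mulmx1. Qed.

Lemma embE i k : emb i k = (i == enum_val k)%:R.
Proof. by rewrite !mxE. Qed.

Lemma emb_mulE (u : 'cV[R]_#|T|) k : (emb *m u) (enum_val k) 0 = u k 0.
Proof.
rewrite mxE (bigD1 k)//= embE eqxx mul1r big1 ?addr0// => l lk.
by rewrite embE (inj_eq enum_val_inj) eq_sym (negbTE lk) mul0r.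
Qed.

Lemma emb_mul_notin (u : 'cV[R]_#|T|) i : i \notin T -> (emb *m u) i 0 = 0.
Proof.
move=> iT; rewrite mxE big1// => l _; rewrite embE.
by case: eqVneq iT => [->|]; rewrite ?mul0r// enum_valP.
Qed.

Lemma extvE (u : 'cV[R]_#|T|) : extv u = emb *m u.
Proof.
apply/matrixP => i j; rewrite ord1 !mxE big_mkcond; apply: eq_bigr => k _.
by rewrite embE eq_sym; case: eqP => _; rewrite ?mul1r ?mul0r.
Qed.

Lemma tr_emb_mulE m (v : 'M[R]_(p, m)) k j : (emb^T *m v) k j = v (enum_val k) j.
Proof.
rewrite mxE (bigD1 (enum_val k))//= mxE embE eqxx mul1r big1 ?addr0// => i ik.
by rewrite mxE embE (negbTE ik) mul0r.
Qed.

Lemma subvE (v : 'cV[R]_p) : subv T v = emb^T *m v.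
Proof. by apply/matrixP => i j; rewrite tr_emb_mulE mxE ord1. Qed.

Lemma emb_tr_emb : emb^T *m emb = 1%:M.
Proof.
apply/matrixP => i j; rewrite tr_emb_mulE embE mxE (inj_eq enum_val_inj)//.
Qed.

Lemma embK (v : 'cV[R]_p) : vsupp v \subset T -> emb *m (emb^T *m v) = v.
Proof.
move=> /fintype.subsetP sT; apply/matrixP => i j; rewrite ord1.
case: (boolP (i \in T)) => iT; last first.
  rewrite emb_mul_notin//; apply/esym/eqP; apply: contraNT iT => vi.
  by apply: sT; rewrite inE.
by rewrite -(enum_rankK_in iT iT) emb_mulE tr_emb_mulE.
Qed.

End Selection.

Lemma submE (R : realType) p (I J : {set 'I_p}) (A : 'M[R]_p) :
  subm I J A = (emb I)^T *m A *m emb J.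
Proof.
apply/matrixP => i j; rewrite -mulmxA tr_emb_mulE -subcolsE.
by rewrite !mxE.
Qed.

Section PerpBasis.
Context {R : realType} (m : nat).

(** A basis is chosen once for each [u], so that the deterministic analysis and the probability
    bounds refer to the same one. *)
Definition perp_dim (u : 'cV[R]_m) : nat := projT1 (cid (orthogonal_basis u)).
Definition perp_mx (u : 'cV[R]_m) : 'M[R]_(m, perp_dim u) :=
  projT1 (cid (projT2 (cid (orthogonal_basis u)))).

Lemma perp_mxP (u : 'cV[R]_m) : [/\ (perp_dim u <= m)%N, (perp_mx u)^T *m u = 0,
    forall z, dot u z = 0 -> exists y, z = perp_mx u *m y &
    forall y : 'cV[R]_(perp_dim u), perp_mx u *m y = 0 -> y = 0].
Proof. exact: (projT2 (cid (projT2 (cid (orthogonal_basis u))))). Qed.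

End PerpBasis.

Lemma sgr_perturb (R : realDomainType) (a b : R) : `|b| < `|a| -> Num.sg (a + b) = Num.sg a.
Proof.
case: (ltrgtP a 0) => [a0|a0|->]; last by rewrite normr0 ltNge normr_ge0.
  rewrite (ltr0_norm a0) ltr_norml opprK => /andP[_ ?].
  by rewrite !ltr0_sg//; lra.
rewrite (gtr0_norm a0) ltr_norml => /andP[? _].
by rewrite !gtr0_sg//; lra.
Qed.

Lemma ler_normB_sqr (R : realDomainType) (a b : R) : 0 <= b -> a ^+ 2 <= b ^+ 2 -> `|a| <= b.
Proof. by move=> b0 h; rewrite -(ger0_norm b0) -ler_sqr ?nnegrE// !real_normK ?num_real. Qed.

(** * Good events and their deterministic consequences *)

Section GoodEvent.
Context (R : realType) (n p m : nat) (AT : 'M[R]_(p, m)) (v : 'cV[R]_m) (L : R).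

Definition popinv (u : 'cV[R]_m) : 'cV[R]_m := invmx (AT^T *m AT) *m u.
Definition popvar (u : 'cV[R]_m) : R := dot u (popinv u).
Definition unitv (i : 'I_m) : 'cV[R]_m := delta_mx i 0.
Definition gsol (X : 'M[R]_(n, m)) (u : 'cV[R]_m) : 'cV[R]_n := X *m (invmx (X^T *m X) *m u).

(* [Zm] is the n x p standard Gaussian matrix, [g] the standardised noise and
   [X = Zm *m AT] the design restricted to the support of [v]. *)
Definition good_resid (Zm : 'M[R]_(n, p)) (u : 'cV[R]_m) : Prop :=
  2 / 3 * n%:R * popvar u < l2sq (resid (Zm *m (AT *m perp_mx u)) (Zm *m (AT *m popinv u))).
Definition good_sqr (Zm : 'M[R]_(n, p)) (u : 'cV[R]_m) : Prop :=
  l2sq (Zm *m (AT *m popinv u)) <= 2 * n%:R * popvar u.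
(** [4 * L] is the square of the Gaussian threshold [2 sqrt L]; squares keep roots and absolute
    values out of the deterministic part. *)
Definition good_cross (Zm : 'M[R]_(n, p)) (u : 'cV[R]_m) : Prop :=
  let a := cross_vec (perp_mx u) v (Zm *m (AT *m perp_mx u)) in
  dot a (Zm *m (AT *m popinv u)) ^+ 2 <= 4 * L * l2sq a * popvar u.
Definition good_noise (Zm : 'M[R]_(n, p)) (g : 'cV[R]_n) (u : 'cV[R]_m) : Prop :=
  dot (gsol (Zm *m AT) u) g ^+ 2 <= 4 * L * l2sq (gsol (Zm *m AT) u).
(** For [tau = sigma / (n lam)] this is the Lasso residual divided by [n lam], provided the signs on
    the support are [v]. *)
Definition dual_vec (tau : R) (X : 'M[R]_(n, m)) (g : 'cV[R]_n) : 'cV[R]_n :=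
  gsol X v + tau *: resid X g.
Definition good_dual (tau : R) (Zm : 'M[R]_(n, p)) (g : 'cV[R]_n) (q : 'cV[R]_p) : Prop :=
  dot (dual_vec tau (Zm *m AT) g) (Zm *m q) ^+ 2 <=
    4 * L * l2sq (dual_vec tau (Zm *m AT) g) * l2sq q.

End GoodEvent.

Section Directions.
Context (R : realType) (n p m : nat) (AT : 'M[R]_(p, m)) (v : 'cV[R]_m) (L Cmin : R)
  (Zm : 'M[R]_(n, p)).
Hypothesis uSig : AT^T *m AT \in unitmx.
Hypothesis Cmin0 : 0 < Cmin.
Hypothesis n0 : 0 < n%:R :> R.
Hypothesis varle : forall u : 'cV[R]_m, popvar AT u <= l2sq u / Cmin.
Local Notation X := (Zm *m AT).
Hypothesis uS : X^T *m X \in unitmx.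

Lemma popvar_gt0 u : u != 0 -> 0 < popvar AT u.
Proof.
move=> u0; rewrite /popvar /popinv.
have := l2sq_sol uSig u; rewrite -/(popvar AT u) => <-.
rewrite l2sq_gt0//; apply: contraNneq u0 => e.
have : AT^T *m (AT *m (invmx (AT^T *m AT) *m u)) = u by rewrite mulmxA mulKVmx.
by rewrite e mulmx0 => <-.
Qed.

Lemma dot_popinv u w : dot u (popinv AT w) = dot (popinv AT u) w.
Proof. by rewrite /popinv dot_mulr trmx_inv trmx_mul trmxK. Qed.

Let rho u := dot u (invmx (X^T *m X) *m u).

Lemma l2sq_gsol u : l2sq (gsol X u) = rho u.
Proof. exact: l2sq_sol. Qed.

Lemma good_rho_ub u : u != 0 -> good_resid AT Zm u -> rho u <= 3 / 2 * popvar AT u / n%:R.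
Proof.
move=> u0; rewrite /good_resid => h; have d0 := popvar_gt0 u0.
have [_ N0 Ns Ni] := perp_mxP u.
have := directional_rho (popinv AT u) uS u0 N0 Ns Ni; rewrite -/(rho u) -/(popvar AT u).
have r0 := directional_rho_gt0 uS u0; rewrite -/(rho u) in r0.
move: h; rewrite !mulmxA; set r := l2sq _ => h e.
rewrite ler_pdivlMr// -(ler_pM2r d0).
have -> : 3 / 2 * popvar AT u * popvar AT u = 3 / 2 * (rho u * r) by rewrite e; ring.
rewrite -subr_ge0 (_ : _ - _ = rho u * (3 / 2 * r - n%:R * popvar AT u)); last by ring.
by rewrite mulr_ge0 ?(ltW r0)//; lra.
Qed.

Lemma good_rho_lb u : u != 0 -> good_sqr AT Zm u -> popvar AT u / (2 * n%:R) <= rho u.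
Proof.
move=> u0; rewrite /good_sqr => h; have d0 := popvar_gt0 u0.
have [_ N0 Ns Ni] := perp_mxP u.
have := directional_rho (popinv AT u) uS u0 N0 Ns Ni; rewrite -/(rho u) -/(popvar AT u).
have r0 := directional_rho_gt0 uS u0; rewrite -/(rho u) in r0.
have := l2sq_resid_le (gram_mul_unit uS Ni) (X *m popinv AT u).
rewrite -[X *m popinv _ _]mulmxA; set r := l2sq _ => rle e.
rewrite ler_pdivrMr ?mulr_gt0// -(ler_pM2r d0) -expr2 -e -mulrA ler_pM2l//.
exact: le_trans h.
Qed.

(** [kap] is [n] times the ratio of [rho] to its population value [popvar]; its bounds 1/2 and 3/2
    come from the constants 2 and 2/3 of the good events, and 3/2 is the factor in the minimal
    signal condition. [x] is the cross term of [directional_inv], whose coefficient vector has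
    squared norm at most [rho v]. *)
Lemma good_inv u : u != 0 -> v != 0 -> good_resid AT Zm u -> good_sqr AT Zm u ->
  good_resid AT Zm v -> good_cross AT v L Zm u -> 0 <= L ->
  exists kap x, [/\ n%:R * dot u (invmx (X^T *m X) *m v) = kap * (dot u (popinv AT v) - x),
    1 / 2 <= kap, kap <= 3 / 2 &
    x ^+ 2 <= 6 * L * l2sq v / (n%:R * Cmin) * (l2sq u / Cmin)].
Proof.
move=> u0 v0 g1 g2 gv g3 L0; have d0 := popvar_gt0 u0.
have [_ N0 Ns Ni] := perp_mxP u.
have dn : dot u (popinv AT u) != 0 by rewrite gt_eqF.
have E := directional_inv uS u0 dn N0 Ns Ni v.
have Ca := l2sq_cross_vec uS Ni v.
have ub := good_rho_ub u0 g1; have lb := good_rho_lb u0 g2; have vub := good_rho_ub v0 gv.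
exists (n%:R * rho u / popvar AT u), (dot (cross_vec (perp_mx u) v (X *m perp_mx u)) (X *m popinv AT u)).
split.
- by rewrite E -/(rho u) -/(popvar AT u) (dotC v) -dot_popinv; ring.
- rewrite ler_pdivlMr//; move: lb; rewrite ler_pdivrMr ?mulr_gt0//; lra.
- by rewrite ler_pdivrMr//; move: ub; rewrite ler_pdivlMr//; lra.
move: g3; rewrite /good_cross !mulmxA; set a := cross_vec _ _ _ => g3.
rewrite -/a in Ca.
apply: le_trans g3 _.
have a1 : l2sq a <= 3 / 2 * (l2sq v / Cmin) / n%:R.
  apply: le_trans Ca _; apply: le_trans vub _.
  by rewrite ler_pM2r ?invr_gt0// ler_pM2l//; exact: varle.
have a2 := varle u.
rewrite (_ : 6 * L * l2sq v / (n%:R * Cmin) * (l2sq u / Cmin) =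
   4 * L * (3 / 2 * (l2sq v / Cmin) / n%:R) * (l2sq u / Cmin)); last first.
  by field; rewrite !gt_eqF.
by apply: ler_pM => //; rewrite ?(ltW d0)// ?mulr_ge0// ?l2sq_ge0// ler_wpM2l// mulr_ge0.
Qed.

Lemma good_noise_bound g u : u != 0 -> good_resid AT Zm u -> good_noise AT L Zm g u -> 0 <= L ->
  dot (gsol X u) g ^+ 2 <= 6 * L * (l2sq u / Cmin) / n%:R.
Proof.
move=> u0 g1 g4 L0; apply: le_trans g4 _; rewrite l2sq_gsol.
rewrite (_ : 6 * L * (l2sq u / Cmin) / n%:R = 4 * L * (3 / 2 * (l2sq u / Cmin) / n%:R)); last first.
  by field; rewrite !gt_eqF.
rewrite ler_wpM2l ?mulr_ge0//; apply: le_trans (good_rho_ub u0 g1) _.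
by rewrite ler_pM2r ?invr_gt0// ler_pM2l//; exact: varle.
Qed.

(** Pythagoras: the first part of [dual_vec] lies in the column space of [X] and the second is
    orthogonal to it. *)
Lemma good_dual_bound tau g : v != 0 -> good_resid AT Zm v -> l2sq g <= 2 * n%:R ->
  l2sq (dual_vec v tau X g) <= 3 / 2 * (l2sq v / Cmin) / n%:R + tau ^+ 2 * (2 * n%:R).
Proof.
move=> v0 gv g5.
have -> : l2sq (dual_vec v tau X g) = rho v + tau ^+ 2 * l2sq (resid X g).
  rewrite /dual_vec l2sqE dotDl !dotDr -!l2sqE l2sqZ l2sq_gsol.
  rewrite /gsol dotZl dotZr [dot (X *m _) _]dotC dot_resid//; ring.
apply: lerD.
  apply: le_trans (good_rho_ub v0 gv) _.
  by rewrite ler_pM2r ?invr_gt0// ler_pM2l//; exact: varle.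
rewrite ler_wpM2l ?sqr_ge0//; apply: le_trans g5; exact: l2sq_resid_le.
Qed.

End Directions.

Lemma unitvE (R : realType) m (i : 'I_m) (x : 'cV[R]_m) : dot (unitv R i) x = x i 0.
Proof.
rewrite dotE (bigD1 i)//= mxE !eqxx mul1r big1 ?addr0// => j /negbTE ji.
by rewrite mxE ji mul0r.
Qed.

Lemma l2sq_unitv (R : realType) m (i : 'I_m) : l2sq (unitv R i) = 1.
Proof. by rewrite l2sqE unitvE mxE !eqxx. Qed.

Lemma unitv_neq0 (R : realType) m (i : 'I_m) : unitv R i != 0.
Proof. by rewrite -l2sq_eq0 l2sq_unitv oner_eq0. Qed.

(** * Support recovery on the good events *)

Section SupportRecovery.
Context (R : realType) (n p : nat) (A : 'M[R]_p) (th0 v0 : 'cV[R]_p)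
  (sigma lam eta c2 Cmin L : R) (Zm : 'M[R]_(n, p)) (g : 'cV[R]_n).
Local Notation S := (vsupp th0).
Local Notation T := (vsupp v0).
Local Notation E := (emb (R := R) T).
Local Notation AT := (A *m E).
Local Notation v := (E^T *m v0).
Local Notation X := (Zm *m AT).
Local Notation tau := (sigma / (n%:R * lam)).
Local Notation m := #|T|.

(** The part of column [j] of [A] orthogonal to the columns of [AT]; its image under [Z] is the
    component of the [j]-th design column that is independent of [X]. *)
Definition dual_dir (j : 'I_p) : 'cV[R]_p := col j A - AT *m popinv AT (AT^T *m col j A).

Hypothesis n0 : (0 < n)%N.
Hypothesis sigma0 : 0 < sigma.
Hypothesis lam0 : 0 < lam.
Hypothesis eta0 : 0 < eta.
Hypothesis c20 : 0 < c2.
Hypothesis Cmin0 : 0 < Cmin.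
Hypothesis L0 : 0 < L.
Hypothesis lam2 : n%:R * lam ^+ 2 * eta ^+ 2 = 16 * sigma ^+ 2 * L.
Hypothesis etac : eta ^+ 2 <= c2 ^+ 2 * Cmin.
Hypothesis n74 : 74 * L * m%:R <= n%:R * (eta ^+ 2 * Cmin).
Hypothesis n1024 : 1024 * L * m%:R <= n%:R * (c2 ^+ 2 * Cmin ^+ 2).
Hypothesis uSig : AT^T *m AT \in unitmx.
Hypothesis varle : forall u : 'cV[R]_m, popvar AT u <= l2sq u / Cmin.
Hypothesis vn0 : v != 0.
Hypothesis lv : l2sq v = m%:R.
Hypothesis ST : S \subset T.
Hypothesis sgS : forall i, i \in S -> v0 i 0 = Num.sg (th0 i 0).
Hypothesis sgT : forall i, i \in T -> i \notin S -> v0 i 0 = Num.sg (- (E *m popinv AT v) i 0).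
Hypothesis w0S : forall i, i \in S ->
  c2 * lam + 3 / 2 * lam * `|(E *m popinv AT v) i 0| <= `|th0 i 0|.
Hypothesis w0T : forall i, i \in T -> i \notin S -> 2 * c2 <= `|(E *m popinv AT v) i 0|.
Hypothesis dualT : forall j, j \notin T ->
  `|dot (popinv AT (AT^T *m col j A)) v| <= 1 - eta.
Hypothesis ldual : forall j, j \notin T -> l2sq (dual_dir j) <= 1.

Hypothesis uS : X^T *m X \in unitmx.
Hypothesis gv : good_resid AT Zm v.
Hypothesis g1 : forall i, good_resid AT Zm (unitv R i).
Hypothesis g2 : forall i, good_sqr AT Zm (unitv R i).
Hypothesis g3 : forall i, good_cross AT v L Zm (unitv R i).
Hypothesis g4 : forall i, good_noise AT L Zm g (unitv R i).
Hypothesis g5 : l2sq g <= 2 * n%:R.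
Hypothesis g6 : forall j, j \notin T -> good_dual AT v L tau Zm g (dual_dir j).

Let nR : 0 < n%:R :> R. Proof. by rewrite ltr0n. Qed.

(** The solution of the stationarity equations on [T] if its signs are [v]; that they are is checked
    in [thT_sgn]. *)
Let thT : 'cV[R]_m := E^T *m th0 - (n%:R * lam) *: (invmx (X^T *m X) *m v) +
  sigma *: (invmx (X^T *m X) *m (X^T *m g)).
Let D := dual_vec v tau X g.

Let th0E : E *m (E^T *m th0) = th0. Proof. exact: embK. Qed.

Let resE : Zm *m A *m th0 + sigma *: g - Zm *m A *m (E *m thT) = (n%:R * lam) *: D.
Proof.
have -> : Zm *m A *m th0 = X *m (E^T *m th0) by rewrite -{1}th0E !mulmxA.
rewrite [Zm *m A *m (E *m thT)](_ : _ = X *m thT); last by rewrite !mulmxA.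
rewrite /thT /D /dual_vec /gsol /resid mulmxDr mulmxBr -!scalemxAr.
rewrite scalerDr scalerA (_ : n%:R * lam * tau = sigma); last first.
  by field; rewrite !gt_eqF.
rewrite scalerBr /colproj !mulmxA.
by rewrite opprD addrACA subKr.
Qed.

Let trD : X^T *m D = v.
Proof.
by rewrite /D /dual_vec mulmxDr -scalemxAr tr_resid// scaler0 addr0 /gsol mulmxA mulKVmx.
Qed.

(** The bias is [lam kap] times the population vector [w], and the cross term and the noise perturb
    it by at most [(1/8 + 5/8) c2 lam]. On [S] the signal exceeds the bias, at most [3/2 lam |w|],
    by [c2 lam]; off [S] the bias is at least [c2 lam] and sets the sign. *)
Let thT_sgn (k : 'I_m) : Num.sg (thT k 0) = v0 (enum_val k) 0.
Proof.
have c2p := c20; have lamp := lam0.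
have [kap [x [Ekx kap1 kap2 x2]]] :=
  good_inv uSig Cmin0 nR varle uS (unitv_neq0 R k) vn0 (g1 k) (g2 k) gv (g3 k) (ltW L0).
have nb := good_noise_bound uSig Cmin0 nR varle uS (unitv_neq0 R k) (g1 k) (g4 k) (ltW L0).
rewrite !unitvE in Ekx; rewrite l2sq_unitv in x2; rewrite l2sq_unitv in nb.
set nu := dot _ g in nb.
set i := enum_val k; set w := (E *m popinv AT v) i 0.
have wE : popinv AT v k 0 = w by rewrite /w emb_mulE.
have nuE : (invmx (X^T *m X) *m (X^T *m g)) k 0 = nu.
  rewrite /nu /gsol dot_mull.
  by rewrite -[LHS]unitvE [LHS]dot_mulr trmx_inv trmx_mul trmxK.
have thE : thT k 0 = th0 i 0 + (- (lam * kap * (w - x)) + sigma * nu).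
  rewrite -[LHS]unitvE /thT dotDr dotBr !dotZr !unitvE nuE tr_emb_mulE -/i -wE.
  rewrite -addrA; congr (_ + (- _ + _)).
  by rewrite [n%:R * lam]mulrC -!mulrA Ekx.
have cb : 1024 * (L * m%:R / (n%:R * Cmin ^+ 2)) <= c2 ^+ 2.
  rewrite mulrA ler_pdivrMr ?mulr_gt0// ?exprn_gt0//; apply: le_trans (_ : 1024 * L * m%:R <= _).
    by rewrite le_eqVlt mulrA eqxx.
  by apply: le_trans n1024 _; rewrite le_eqVlt; apply/orP; left; apply/eqP; ring.
(* By [n1024] the square is at most [6 c2^2 / 1024], and [6 / 1024 <= 1 / 144]. *)
have xb : `|x| <= c2 / 12.
  apply: ler_normB_sqr; first by rewrite divr_ge0// ltW.
  apply: le_trans x2 _; rewrite lv.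
  rewrite (_ : 6 * L * m%:R / (n%:R * Cmin) * (1 / Cmin) = 6 * (L * m%:R / (n%:R * Cmin ^+ 2))); last first.
    by field; rewrite !gt_eqF.
  rewrite expr_div_n; move: cb; set q := L * _ / _; have : 0 <= c2 ^+ 2 by exact: sqr_ge0.
  by lra.
(* The choice of [lam] and [eta^2 <= c2^2 Cmin] bound the square by [3/8 (c2 lam)^2], and
   [3/8 <= 25/64]. *)
have nub : `|sigma * nu| <= 5 / 8 * (c2 * lam).
  apply: ler_normB_sqr; first by rewrite mulr_ge0// mulr_ge0// ltW.
  rewrite exprMn; apply: (@le_trans _ _ (sigma ^+ 2 * (6 * L * (1 / Cmin) / n%:R))).
    by rewrite ler_wpM2l// sqr_ge0.
  have e1 : sigma ^+ 2 * L / n%:R = lam ^+ 2 * eta ^+ 2 / 16.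
    have -> : sigma ^+ 2 * L = n%:R * lam ^+ 2 * eta ^+ 2 / 16 by rewrite lam2; field.
    by field; rewrite gt_eqF.
  rewrite (_ : sigma ^+ 2 * (6 * L * (1 / Cmin) / n%:R) = 6 * (sigma ^+ 2 * L / n%:R) / Cmin); last first.
    by field; rewrite !gt_eqF.
  rewrite e1 ler_pdivrMr// !exprMn.
  have h : lam ^+ 2 * eta ^+ 2 <= lam ^+ 2 * (c2 ^+ 2 * Cmin) by rewrite ler_wpM2l ?sqr_ge0.
  rewrite [leRHS](_ : _ = 25 / 64 * (lam ^+ 2 * (c2 ^+ 2 * Cmin))); last by field.
  have : 0 <= lam ^+ 2 * (c2 ^+ 2 * Cmin) by rewrite mulr_ge0 ?sqr_ge0// mulr_ge0 ?sqr_ge0// ltW.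
  by lra.
have kx : `|lam * kap * x| <= 1 / 8 * (c2 * lam).
  rewrite !normrM (gtr0_norm lam0) (gtr0_norm (_ : 0 < kap)); last by lra.
  rewrite (_ : 1 / 8 * (c2 * lam) = lam * (3 / 2) * (c2 / 12)); last by field.
  apply: ler_pM => //; [apply: mulr_ge0; [exact: ltW|lra]|by rewrite ler_pM2l].
have iT : i \in T by exact: enum_valP.
have kap0 : 0 < kap by lra.
have clam : 0 < c2 * lam by rewrite mulr_gt0.
case: (boolP (i \in S)) => iS.
  rewrite thE sgr_perturb ?sgS//.
  apply: lt_le_trans (w0S iS).
  rewrite -/w (_ : - (lam * kap * (w - x)) + sigma * nu = - (lam * kap * w) + (lam * kap * x + sigma * nu)); last by ring.
  apply: le_lt_trans (ler_normD _ _) _; rewrite normrN.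
  apply: le_lt_trans (lerD (lexx _) (ler_normD _ _)) _.
  have : `|lam * kap * w| <= 3 / 2 * lam * `|w|.
    rewrite !normrM (gtr0_norm lam0) (gtr0_norm kap0) ler_wpM2r//.
    by rewrite [3 / 2 * _]mulrC ler_pM2l.
  by lra.
have th00 : th0 i 0 = 0 by apply/eqP; move: iS; rewrite inE negbK.
rewrite thE th00 add0r (sgT iT iS) -/w.
rewrite (_ : - (lam * kap * (w - x)) + sigma * nu = lam * kap * (- w) + (lam * kap * x + sigma * nu)); last by ring.
rewrite sgr_perturb; first by rewrite !sgrM (gtr0_sg lam0) (gtr0_sg kap0) !mul1r.
apply: le_lt_trans (ler_normD _ _) _; rewrite !normrM normrN (gtr0_norm lam0) (gtr0_norm kap0).
have wl := w0T iT iS; rewrite -/w in wl.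
have : lam * c2 <= lam * kap * `|w|.
  rewrite -mulrA ler_pM2l//; apply: (@le_trans _ _ (1 / 2 * (2 * c2))); first by lra.
  by apply: ler_pM => //; rewrite mulr_ge0// ltW.
move: kx nub; rewrite !normrM (gtr0_norm lam0) (gtr0_norm kap0); lra.
Qed.

Let ths := E *m thT.

Let v0T i : i \in T -> v0 i 0 != 0. Proof. by rewrite inE. Qed.

Let ths0 i : (ths i 0 == 0) = (i \notin T).
Proof.
case: (boolP (i \in T)) => iT; last by rewrite emb_mul_notin ?eqxx.
rewrite -(enum_rankK_in iT iT) /ths emb_mulE -sgr_eq0 thT_sgn.
by apply/negbTE; apply: v0T; exact: enum_valP.
Qed.

Lemma support_recovery th :
  is_lasso (Zm *m A) (Zm *m A *m th0 + sigma *: g) lam th -> vsupp th = T.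
Proof.
move=> las.
have -> : th = ths.
  apply: (lasso_certificate n0 lam0 _ _ _ _ las (z := (Zm *m A)^T *m D)).
  - by rewrite resE scalemxAr.
  - move=> j; rewrite ths0 negbK => jT.
    have : (E^T *m ((Zm *m A)^T *m D)) (enum_rank_in jT j) 0 = v (enum_rank_in jT j) 0.
      by rewrite mulmxA -trmx_mul -mulmxA trD.
    rewrite !tr_emb_mulE enum_rankK_in// => ->.
    by rewrite -{2}(enum_rankK_in jT jT) /ths emb_mulE thT_sgn enum_rankK_in.
  - move=> j /eqP; rewrite ths0 => jT.
    (* Column [j] is split into its regression on [AT], which gives the population term bounded by
       [1 - eta], and the independent part, for which a bound below [eta] remains to be shown. *)
    have -> : ((Zm *m A)^T *m D) j 0 = dot (popinv AT (AT^T *m col j A)) v + dot D (Zm *m dual_dir j).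
      have -> : ((Zm *m A)^T *m D) j 0 = dot (Zm *m col j A) D.
        by rewrite -unitvE dot_mulr trmxK [unitv _ _]/(delta_mx _ _) -mulmxA -colE.
      have cE : col j A = AT *m popinv AT (AT^T *m col j A) + dual_dir j.
        by rewrite /dual_dir addrC subrK.
      rewrite {1}cE mulmxDr dotDl; congr (_ + _); last by rewrite dotC.
      by rewrite mulmxA dot_mull trD.
    apply: le_lt_trans (ler_normD _ _) _.
    suff : `|dot D (Zm *m dual_dir j)| < eta by have := dualT jT; lra.
    have lD := good_dual_bound uSig nR varle uS tau vn0 gv g5; rewrite -/D lv in lD.
    have tauE : tau ^+ 2 * (2 * n%:R) = eta ^+ 2 / (8 * L).
      have -> : tau ^+ 2 * (2 * n%:R) = 2 * sigma ^+ 2 * eta ^+ 2 / (n%:R * lam ^+ 2 * eta ^+ 2).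
        by field; rewrite !gt_eqF.
      by rewrite lam2; field; rewrite !gt_eqF.
    have mb : m%:R / Cmin / n%:R <= eta ^+ 2 / (74 * L).
      rewrite ler_pdivrMr// ler_pdivrMr//.
      rewrite [leRHS](_ : _ = n%:R * (eta ^+ 2 * Cmin) / (74 * L)); last by ring.
      by rewrite ler_pdivlMr ?mulr_gt0// mulrC.
    have : dot D (Zm *m dual_dir j) ^+ 2 < eta ^+ 2.
      apply: le_lt_trans (g6 jT) _; rewrite -/D.
      have l1 := ldual jT.
      have L4 : 0 < 4 * L by rewrite mulr_gt0.
      apply: (@le_lt_trans _ _ (4 * L * l2sq D)).
        by rewrite ler_piMr// mulr_ge0 ?l2sq_ge0// ltW.
      (* The sign part of [D] contributes [6/74 eta^2], through [n74], and the noise part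
         [eta^2 / 2], through the choice of [lam]. *)
      apply: (@le_lt_trans _ _ (4 * L * (3 / 2 * (eta ^+ 2 / (74 * L)) + eta ^+ 2 / (8 * L)))).
        rewrite ler_pM2l//; apply: le_trans lD _; rewrite tauE lerD2r.
        by rewrite -mulrA ler_pM2l.
      rewrite (_ : _ * (_ + _) = (6 / 74 + 1 / 2) * eta ^+ 2); last by field; rewrite gt_eqF.
      have : 0 < eta ^+ 2 by rewrite exprn_gt0.
      by lra.
    by move=> h; rewrite -(gtr0_norm eta0) -ltr_sqr ?nnegrE// !real_normK ?num_real.
  - move=> u uT Xu.
    have uE : E *m (E^T *m u) = u.
      apply: embK; apply/fintype.subsetP => i; rewrite inE; apply: contraR => iT.
      by apply/eqP/uT/eqP; rewrite ths0.
    move: Xu; rewrite -uE mulmxA -(mulmxA Zm) => /(elimT (gram_unitP _) uS) ->.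
    by rewrite mulmx0.
by apply/setP => i; rewrite inE ths0 negbK.
Qed.

End SupportRecovery.

Lemma gauss_lasso_error (R : realType) n p (X : 'M[R]_(n, p)) (th0 th : 'cV[R]_p)
  (g : 'cV[R]_n) (T : {set 'I_p}) :
  vsupp th = T -> vsupp th0 \subset T ->
  (X *m emb T)^T *m (X *m emb T) \in unitmx ->
  gauss_lasso X (X *m th0 + g) th - th0 =
    emb T *m (invmx ((X *m emb T)^T *m (X *m emb T)) *m ((X *m emb T)^T *m g)).
Proof.
move=> supp sub u; rewrite /gauss_lasso supp extvE subcolsE.
have -> : X *m th0 = X *m emb T *m ((emb T)^T *m th0) by rewrite -mulmxA embK.
move: (X *m emb T) u => XT u.
by rewrite -mulmxA !mulmxDr [XT^T *m (XT *m _)]mulmxA mulKmx// embK// addrC addKr.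
Qed.

(** * The population problem *)

Import numFieldNormedType.Exports.

Lemma sum_continuous (R : realType) (T : topologicalType) (I : Type) (s : seq I) (f : I -> T -> R) :
  (forall i, continuous (f i)) -> continuous (fun x => \sum_(i <- s) f i x).
Proof.
move=> cf; elim: s => [|i s IH].
  by under eq_fun do rewrite big_nil; exact: cst_continuous.
under eq_fun do rewrite big_cons.
by move=> x; apply: continuousD; [exact: cf|exact: IH].
Qed.

Lemma mul_continuous (R : realType) (T : topologicalType) (f g : T -> R) :
  continuous f -> continuous g -> continuous (fun x => f x * g x).
Proof. by move=> cf cg x; exact: (continuousM (cf x) (cg x)). Qed.

Section PopulationMinimizer.
Context (R : realType) (p : nat) (Sig A : 'M[R]_p) (th0 : 'cV[R]_p).
Hypothesis AA : A^T *m A = Sig.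

Lemma qform_gram (u : 'cV[R]_p) : qform Sig u = l2sq (A *m u).
Proof. by rewrite qformE -AA -mulmxA -dot_mull l2sqE. Qed.

(** The objective is at least [xi |th|_1], so outside the cube of radius [F 0 / xi] it exceeds its
    value at 0, and the cube is compact. Existence gives content to the sign hypothesis, which
    speaks of every minimizer. *)
Lemma pop_min_exists (xi : R) : 0 < xi -> exists th, is_pop_min Sig th0 xi th.
Proof.
move=> xi0.
pose F (r : 'rV[R]_p) := pop_obj Sig th0 xi r^T.
have FE r : F r = 2^-1 * (\sum_i \sum_j (r 0 i - th0 i 0) * Sig i j * (r 0 j - th0 j 0)) + xi * \sum_i `|r 0 i|.
  rewrite /F /pop_obj; congr (_ * _ + _ * _); last by apply: eq_bigr => i _; rewrite mxE.
  rewrite /qform mxE exchange_big; apply: eq_bigr => j _.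
  rewrite mxE mulr_suml; apply: eq_bigr => i _.
  by rewrite !mxE.
have coordc (i : 'I_p) : continuous (fun r : 'rV[R]_p => r 0 i) by exact: coord_continuous.
have Fc : continuous F.
  rewrite (_ : F = fun r => 2^-1 * (\sum_i \sum_j (r 0 i - th0 i 0) * Sig i j * (r 0 j - th0 j 0)) +
      xi * \sum_i `|r 0 i|); last by apply/funext => r; exact: FE.
  have coordB (i : 'I_p) : continuous (fun r : 'rV[R]_p => r 0 i - th0 i 0).
    by move=> r; apply: continuousB; [exact: coordc|exact: cst_continuous].
  have c1 : continuous (fun r : 'rV[R]_p => \sum_i \sum_j (r 0 i - th0 i 0) * Sig i j * (r 0 j - th0 j 0)).
    apply: (sum_continuous (f := fun i (r : 'rV[R]_p) => \sum_j (r 0 i - th0 i 0) * Sig i j * (r 0 j - th0 j 0))) => i.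
    apply: (sum_continuous (f := fun j (r : 'rV[R]_p) => (r 0 i - th0 i 0) * Sig i j * (r 0 j - th0 j 0))) => j.
    apply: mul_continuous => //; apply: mul_continuous => //; exact: cst_continuous.
  have c2 : continuous (fun r : 'rV[R]_p => \sum_i `|r 0 i|).
    apply: (sum_continuous (f := fun i (r : 'rV[R]_p) => `|r 0 i|)) => i r'.
    by apply: continuous_comp; [exact: coordc|exact: norm_continuous].
  have c3 := mul_continuous (@cst_continuous _ _ (2^-1 : R)) c1.
  have c4 := mul_continuous (@cst_continuous _ _ xi) c2.
  by move=> r; exact: (continuousD (c3 r) (c4 r)).
pose M := F 0 / xi.
have obj_ge th : xi * l1 th <= pop_obj Sig th0 xi th.
  by rewrite lerDr mulr_ge0// ?invr_ge0// qform_gram l2sq_ge0.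
have F00 : 0 <= F 0.
  by apply: le_trans (obj_ge _); rewrite mulr_ge0 ?(ltW xi0)// sumr_ge0.
pose K := [set r : 'rV[R]_p | forall i, `[- M, M]%classic (r 0 i)].
have Kc : compact K.
  by apply: (@rV_compact _ p (fun=> `[- M, M]%classic)) => i; exact: segment_compact.
have M0 : 0 <= M by rewrite divr_ge0// ltW.
have K0 : K 0 by move=> i /=; rewrite mxE in_itv/= oppr_le0 M0.
have [c _ cmin] := compact_EVT_min (ex_intro _ 0 K0) Kc (continuous_subspaceT Fc).
exists c^T => th'.
have [thK|thK] := pselect (K th'^T).
  by have := cmin th'^T (mem_set thK); rewrite /F trmxK.
have [i iM] : exists i, M < `|th' i 0|.
  apply: contrapT => h; apply: thK => i /=; rewrite mxE in_itv/= -ler_norml leNgt.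
  by apply/negP => hi; apply: h; exists i.
apply: (@le_trans _ _ (F 0)); first exact: (cmin 0 (mem_set K0)).
apply: le_trans (obj_ge th'); apply: (@le_trans _ _ (xi * M)).
  by rewrite /M mulrCA mulfV ?mulr1// gt_eqF.
rewrite ler_pM2l//; apply: (le_trans (ltW iM)).
by rewrite /l1 (bigD1 i)//= lerDl sumr_ge0.
Qed.

Lemma quadratic_slope0 (B C r : R) : 0 < r -> 0 <= C ->
  (forall eps, `|eps| < r -> 0 <= eps * B + eps ^+ 2 * C) -> B = 0.
Proof.
move=> r0 C0 h; apply/eqP; apply: contraT => B0.
have nB : 0 < `|B| by rewrite normr_gt0.
(* The test point is [eps = - t B]; the summands of the denominator ensure [t C < 1] and
   [|t B| < r]. *)
pose t := (C + 1 + `|B| / r)^-1.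
have den : 0 < C + 1 + `|B| / r by rewrite addr_gt0 ?divr_gt0//; lra.
have t0 : 0 < t by rewrite invr_gt0.
have tC : t * C < 1.
  have h1 : 0 < `|B| / r by rewrite divr_gt0.
  by rewrite /t mulrC ltr_pdivrMr// mul1r; lra.
have tB : `|- (t * B)| < r.
  rewrite normrN normrM (gtr0_norm t0) /t mulrC ltr_pdivrMr//.
  rewrite mulrDr mulrCA mulfV ?gt_eqF// mulr1 ltrDr mulr_gt0//; lra.
have := h _ tB.
have -> : - (t * B) * B + (- (t * B)) ^+ 2 * C = (t * B ^+ 2) * (t * C - 1) by ring.
have q0 : 0 < t * B ^+ 2 by rewrite mulr_gt0// exprn_even_gt0.
by rewrite (pmulr_rge0 _ q0) subr_ge0 leNgt tC.
Qed.

(** A nonzero entry moved by less than its modulus keeps its sign, so the l1 norm is affine along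
    the move and optimality is an equation. *)
Lemma pop_min_kkt (xi : R) th i : 0 < xi -> is_pop_min Sig th0 xi th -> th i 0 != 0 ->
  (Sig *m (th - th0)) i 0 + xi * Num.sg (th i 0) = 0.
Proof.
move=> xi0 min thi.
apply: (@quadratic_slope0 _ (l2sq (A *m unitv R i) / 2) `|th i 0|).
- by rewrite normr_gt0.
- by rewrite divr_ge0// l2sq_ge0.
move=> eps he; have := min (th + eps *: unitv R i); rewrite -subr_ge0.
have l1E : l1 (th + eps *: unitv R i) = l1 th + eps * Num.sg (th i 0).
  rewrite /l1 (bigD1 i)//= [in RHS](bigD1 i)//=.
  have -> : \sum_(j | j != i) `|(th + eps *: unitv R i) j 0| = \sum_(j | j != i) `|th j 0|.
    by apply: eq_bigr => j /negbTE ji; rewrite !mxE ji mulr0 addr0.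
  rewrite addrAC; congr (_ + _); rewrite !mxE !eqxx mulr1.
  rewrite [in LHS]normrEsg sgr_perturb// [in RHS]normrEsg; ring.
have qE : qform Sig (th + eps *: unitv R i - th0) =
    qform Sig (th - th0) + 2 * eps * (Sig *m (th - th0)) i 0 + eps ^+ 2 * l2sq (A *m unitv R i).
  rewrite !qform_gram addrAC mulmxDr -scalemxAr.
  rewrite -[(Sig *m (th - th0)) i 0]unitvE -AA -mulmxA -dot_mull.
  move: (A *m (th - th0)) (A *m unitv R i) => a b.
  by rewrite !l2sqE dotDl !dotDr !(dotZl, dotZr) [dot b a]dotC; ring.
rewrite /pop_obj l1E qE => h.
by apply: le_trans h _; rewrite le_eqVlt; apply/orP; left; apply/eqP; field.
Qed.

Hypothesis Sigpos : forall u : 'cV[R]_p, u != 0 -> 0 < qform Sig u.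

Lemma gramA_unit : A^T *m A \in unitmx.
Proof.
apply/gram_unitP => u Au; apply/eqP; apply: contraT => /Sigpos.
by rewrite qform_gram Au l2sqE dot0l ltxx.
Qed.

(* The objective at [th0] bounds the quadratic part at the minimizer; hence the minimizer tends
   to [th0] as [xi] tends to 0, which gives the signs on the support of [th0]. *)
Lemma pop_min_close (xi : R) th i : 0 < xi -> is_pop_min Sig th0 xi th ->
  (th i 0 - th0 i 0) ^+ 2 <=
    l2sq (A *m (invmx (A^T *m A) *m unitv R i)) * (2 * xi * l1 th0).
Proof.
move=> xi0 min.
have -> : th i 0 - th0 i 0 = dot (A *m (invmx (A^T *m A) *m unitv R i)) (A *m (th - th0)).
  by rewrite dotC dot_mull mulmxA mulKVmx ?gramA_unit// dotC unitvE !mxE.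
apply: le_trans (cauchy_dot _ _) _; rewrite ler_wpM2l ?l2sq_ge0//.
rewrite -qform_gram.
have := min th0; rewrite /pop_obj subrr qform_gram [qform _ 0]qform_gram mulmx0 l2sqE.
rewrite [l2sq 0]l2sqE dot0l mulr0 add0r -l2sqE -qform_gram.
have : 0 <= xi * l1 th by rewrite mulr_ge0 ?(ltW xi0)// sumr_ge0.
by lra.
Qed.

Variables (xi0 : R) (v0 : 'cV[R]_p).
Hypothesis xi00 : 0 < xi0.
Hypothesis minsg : forall xi, 0 < xi < xi0 -> forall th, is_pop_min Sig th0 xi th ->
     map_mx Num.sg th = v0.

Lemma pop_sign i : i \in vsupp th0 -> v0 i 0 = Num.sg (th0 i 0).
Proof.
rewrite inE => ti.
set K := l2sq (A *m (invmx (A^T *m A) *m unitv R i)).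
have K0 : 0 <= K by exact: l2sq_ge0.
have l0 : 0 <= l1 th0 by rewrite sumr_ge0.
have ti2 : 0 < th0 i 0 ^+ 2 by rewrite exprn_even_gt0.
(* The first summand ensures [xi < xi0]; the second makes the bound of [pop_min_close] smaller than
   [th0_i^2], so that the sign of entry [i] survives. *)
pose den := 2 / xi0 + (2 * K * l1 th0 + 1) / th0 i 0 ^+ 2.
have Kl : 0 <= K * l1 th0 by rewrite mulr_ge0.
have d1 : 0 < 2 / xi0 by rewrite divr_gt0.
have d2 : 0 < (2 * K * l1 th0 + 1) / th0 i 0 ^+ 2 by rewrite divr_gt0//; lra.
have den0 : 0 < den by rewrite addr_gt0.
pose xi := den^-1.
have xip : 0 < xi by rewrite invr_gt0.
have xilt : xi < xi0.
  rewrite /xi -[ltRHS]invrK ltf_pV2 ?posrE ?invr_gt0//.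
  have : 0 < xi0^-1 by rewrite invr_gt0.
  by rewrite /den; lra.
have [th min] := pop_min_exists xip.
have xib : 0 < xi < xi0 by rewrite xip.
have <- := minsg xib min; rewrite mxE.
rewrite -[th i 0](subrK (th0 i 0)) addrC sgr_perturb//.
rewrite -ltr_sqr ?nnegrE// !real_normK ?num_real//.
apply: le_lt_trans (pop_min_close i xip min) _; rewrite -/K.
have -> : K * (2 * xi * l1 th0) = (2 * K * l1 th0) / den by rewrite /xi; ring.
rewrite ltr_pdivrMr// /den mulrDr [X in _ < _ + X]mulrCA mulfV ?gt_eqF// mulr1.
have : 0 < th0 i 0 ^+ 2 * (2 / xi0) by rewrite mulr_gt0.
by lra.
Qed.

Lemma pop_supp_sub : vsupp th0 \subset vsupp v0.
Proof.
apply/fintype.subsetP => i iS; rewrite inE pop_sign// sgr_eq0.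
by move: iS; rewrite inE.
Qed.

Local Notation E := (emb (R := R) (vsupp v0)).
Local Notation AT := (A *m E).
Local Notation v := (E^T *m v0).

Lemma gramAT_unit : AT^T *m AT \in unitmx.
Proof.
apply/gram_unitP => u; rewrite -mulmxA => /(elimT (gram_unitP A) gramA_unit) Eu.
by rewrite -[u]mul1mx -emb_tr_emb -mulmxA Eu mulmx0.
Qed.

Lemma pop_entry i : i \in vsupp v0 -> v0 i 0 ^+ 2 = 1.
Proof.
have h0 : 0 < xi0 / 2 by rewrite divr_gt0.
have [th min] := pop_min_exists h0; have h1 := xi00.
have <- : map_mx Num.sg th = v0 by apply: (minsg _ min); apply/andP; split; lra.
by rewrite inE mxE sgr_eq0 sqr_sg => ->.
Qed.

(** Stationarity on the support reads [Sigma_TT (th - th0)_T = - xi v]; where [th0] vanishes, the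
    minimizer is therefore [- xi] times an entry of [Sigma_TT^-1 v]. The value [xi0 / 2] is one
    admissible [xi]. *)
Lemma pop_sign_compl i : i \in vsupp v0 -> i \notin vsupp th0 ->
  v0 i 0 = Num.sg (- (E *m popinv AT v) i 0).
Proof.
move=> iT; rewrite inE negbK => /eqP ti.
have h0 : 0 < xi0 / 2 by rewrite divr_gt0.
have [th min] := pop_min_exists h0; have h1 := xi00.
have thv : map_mx Num.sg th = v0 by apply: (minsg _ min); apply/andP; split; lra.
have thvj j : Num.sg (th j 0) = v0 j 0 by rewrite -thv mxE.
have supp : vsupp th = vsupp v0.
  by apply/setP => j; rewrite !inE -thv mxE sgr_eq0.
have thE : E *m (E^T *m th) = th by apply: embK; rewrite supp.
have th0E : E *m (E^T *m th0) = th0 by apply: embK; exact: pop_supp_sub.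
have kkt : E^T *m (Sig *m (th - th0)) = - ((xi0 / 2) *: v).
  apply/matrixP => k j; rewrite ord1 tr_emb_mulE.
  have -> : (- ((xi0 / 2) *: v)) k 0 = - (xi0 / 2 * Num.sg (th (enum_val k) 0)).
    by rewrite mxE; congr (- _); rewrite mxE tr_emb_mulE thvj.
  have tk : th (enum_val k) 0 != 0 by have := enum_valP k; rewrite inE -thvj sgr_eq0.
  by have /eqP := pop_min_kkt h0 min tk; rewrite addr_eq0 => /eqP ->.
have dE : E^T *m th - E^T *m th0 = - ((xi0 / 2) *: popinv AT v).
  rewrite -[RHS](_ : invmx (AT^T *m AT) *m - ((xi0 / 2) *: v) = _); last by rewrite mulmxN -scalemxAr.
  rewrite -kkt [E^T *m (_ *m _)](_ : _ = AT^T *m AT *m (E^T *m th - E^T *m th0)).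
    by rewrite mulKmx ?gramAT_unit.
  by rewrite -AA -{1}thE -{1}th0E trmx_mul !mulmxBr !mulmxA.
have thi : th i 0 = - (xi0 / 2 * (E *m popinv AT v) i 0).
  rewrite -thE -[E^T *m th](subrK (E^T *m th0)) dE mulmxDr th0E mxE ti addr0.
  by rewrite mulmxN -scalemxAr !mxE.
by rewrite -thvj thi -mulrN sgrM gtr0_sg// mul1r.
Qed.

End PopulationMinimizer.

Section PopulationBounds.
Context (R : realType) (p m : nat) (A : 'M[R]_p) (AT : 'M[R]_(p, m)) (Cmin : R).
Hypothesis uSig : AT^T *m AT \in unitmx.
Hypothesis Cmin0 : 0 < Cmin.
Hypothesis Csig : Cmin <= sigma_min (AT^T *m AT).

Lemma sigma_min_le (u : 'cV[R]_m) : Cmin * l2 u <= l2 (AT^T *m AT *m u).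
Proof.
have [->|u0] := eqVneq u 0.
  by rewrite mulmx0 /l2 l2sqE dot0l sqrtr0 mulr0.
have lu : 0 < l2 u by rewrite sqrtr_gt0 l2sq_gt0.
rewrite -ler_pdivlMr//; apply: le_trans Csig _.
apply: ge_inf; last by exists u.
by exists 0 => _ [w _ <-]; rewrite divr_ge0// l2_ge0.
Qed.

(** With [w = Sigma_TT^-1 u], the singular value bound gives [Cmin |w| <= |u|], and Cauchy-Schwarz
    concludes. *)
Lemma popvar_le (u : 'cV[R]_m) : popvar AT u <= l2sq u / Cmin.
Proof.
have h := sigma_min_le (popinv AT u).
rewrite /popinv mulKVmx// -/(popinv AT u) in h.
rewrite /popvar ler_pdivlMr//.
have c := cauchy_dot u (popinv AT u).
apply: le_trans (ler_norm _) _; apply: ler_normB_sqr; first exact: l2sq_ge0.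
rewrite exprMn; apply: (@le_trans _ _ (l2sq u * l2sq (popinv AT u) * Cmin ^+ 2)).
  by rewrite ler_pM2r ?exprn_gt0.
rewrite -mulrA expr2 ler_wpM2l ?l2sq_ge0// -!l2_sqr -exprMn mulrC.
by rewrite ler_sqr ?nnegrE ?l2_ge0// mulr_ge0 ?l2_ge0// ltW.
Qed.

(** Cauchy-Schwarz for the dual pair [AT e_i], [AT Sigma_TT^-1 e_i], whose product is 1. With
    [eta <= 1] this turns [n74] into [n >= 74 t L], the form that the probability bounds use. *)
Lemma Cmin_le1 (i : 'I_m) : l2sq (col i AT) <= 1 -> Cmin <= 1.
Proof.
move=> li.
have e : dot (AT *m unitv R i) (AT *m popinv AT (unitv R i)) = 1.
  by rewrite dot_mull /popinv mulmxA mulKVmx// -l2sqE l2sq_unitv.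
have := cauchy_dot (AT *m unitv R i) (AT *m popinv AT (unitv R i)).
rewrite e expr1n -colE (l2sq_sol uSig) -/(popvar AT (unitv R i)) => h.
have := popvar_le (unitv R i); rewrite l2sq_unitv mul1r => h2.
have p0 := ltW (popvar_gt0 uSig (unitv_neq0 R i)).
have : 1 <= Cmin^-1.
  by apply: le_trans h _; apply: le_trans h2; rewrite ler_piMl.
by rewrite -[leLHS]invr1 lef_pV2 ?posrE.
Qed.

End PopulationBounds.

Lemma dual_dirE (R : realType) p (A : 'M[R]_p) (v0 : 'cV[R]_p) j :
  dual_dir A v0 j = resid (A *m emb (vsupp v0)) (col j A).
Proof. by rewrite /dual_dir /popinv /resid /colproj !mulmxA. Qed.

(** * Measurability and selection *)

Section Selection.
Variable R : realType.

(** Counting replaces sorting, which makes the selected model measurable and easy to identify. The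
    [k]-th largest entry has index [k.-1], hence [0 < k]. *)
Lemma nth_sorted_le (s : seq R) k x : sorted >=%R s -> (0 < k <= size s)%N ->
  (nth 0 s k.-1 <= x) = (count (fun y => x < y)%R s < k)%N.
Proof.
case: k => // k sorts /= ks.
have ge_tr : transitive (>=%R : rel R) by move=> a b c ab bc; exact: le_trans bc ab.
have ge_refl : reflexive (>=%R : rel R) by move=> a /=.
have nthle i j : (i <= j < size s)%N -> nth 0 s j <= nth 0 s i.
  move=> /andP[ij js]; apply: (sorted_leq_nth ge_tr ge_refl 0 sorts) => //.
  by rewrite inE (leq_ltn_trans ij).
rewrite -[in count _ s](cat_take_drop k s) count_cat.
case: leP => [lex|gtx].
  have -> : count (fun y => x < y) (drop k s) = 0%N.
    apply/eqP; rewrite -leqn0 leqNgt -has_count; apply/negP => /(has_nthP 0)[i].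
    rewrite size_drop nth_drop => iks; apply/negP; rewrite -leNgt.
    by apply: le_trans lex; apply: nthle; rewrite leq_addr -ltn_subRL.
  by rewrite addn0 (leq_ltn_trans (count_size _ _))// size_take ks ltnS.
have /eqP ct : count (fun y => x < y) (take k s) == size (take k s).
  rewrite -all_count; apply/(all_nthP 0) => i; rewrite size_take ks => ik.
  by rewrite nth_take// (lt_le_trans gtx)// nthle// (ltnW ik).
rewrite ct size_take ks ltnS; apply/esym/negbTE; rewrite -ltnNge -[ltnLHS]addn0 ltn_add2l.
by rewrite (drop_nth 0)//= gtx.
Qed.

Lemma selected_modelE p (v : 'cV[R]_p) k i : (0 < k <= p)%N ->
  (i \in selected_model v k) = (\sum_j (`|v i 0| < `|v j 0|)%R < k)%N.
Proof.
move=> kp; rewrite inE nth_sorted_le.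
- rewrite (permP (permEl (perm_sort _ _))) count_map -sum1_count -big_mkcond/=.
  by rewrite big_enum_cond/= sum1_card; congr (_ < _)%N; rewrite -sum1_card; apply: eq_bigl.
- by apply: sort_sorted => a b; exact: le_total.
- by rewrite size_sort size_map size_enum_ord.
Qed.

(** With errors below [c] and signals of at least [2 c], the level [c] separates the entries on the
    support from the others. *)
Lemma selected_model_eq p (v th : 'cV[R]_p) c : (0 < #|vsupp th|)%N ->
  linf (v - th) < c -> (forall i, i \in vsupp th -> 2 * c <= `|th i 0|) ->
  selected_model v #|vsupp th| = vsupp th.
Proof.
move=> s0 /bigmax_ltP[c0 vc] thc.
have {}vc i : `|v i 0 - th i 0| < c by have := vc i isT; rewrite !mxE.
have bS i : i \in vsupp th -> c < `|v i 0|.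
  move=> iS; have := thc i iS; have := vc i.
  have := lerB_dist (th i 0) (v i 0); rewrite distrC; lra.
have bN i : i \notin vsupp th -> `|v i 0| < c.
  by rewrite inE negbK => /eqP t0; have := vc i; rewrite t0 subr0.
apply/setP => i; rewrite selected_modelE; last first.
  by rewrite s0 -[leqRHS]card_ord max_card.
have [iS|iS] := boolP (i \in vsupp th); last first.
  apply/negbTE; rewrite -leqNgt -sum1_card big_mkcond leq_sum// => j _.
  by case: ifP => // jS; rewrite (lt_trans (bN i iS) (bS j jS)).
rewrite (@leq_ltn_trans (#|vsupp th :\ i|))//; last by rewrite [ltnRHS](cardsD1 i) iS.
rewrite -sum1_card [leqRHS]big_mkcond leq_sum// => j _; rewrite in_setD1.
have [->|ji] := eqVneq j i; first by rewrite ltxx.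
case: (boolP (j \in _)) => jS /=; first by case: (_ < _).
by rewrite ltNge (ltW (lt_trans (bN j jS) (bS i iS))).
Qed.

Lemma linf_ge p (v : 'cV[R]_p) mu : 0 < mu -> mu <= linf v -> exists i, mu <= `|v i 0|.
Proof.
move=> mu0 muv; have [//|/forallNP vmu] := pselect (exists i, mu <= `|v i 0|).
suff : linf v < mu by rewrite ltNge muv.
by apply/bigmax_ltP; split=> // i _; rewrite ltNge; apply/negP/vmu.
Qed.

End Selection.

Section MeasurableEstimator.
Context (R : realType) d (T : measurableType d).

Lemma measurable_linf p (v : T -> 'cV[R]_p) : mxmeas v ->
  measurable_fun setT (fun w => linf (v w)).
Proof.
move=> mv; rewrite /linf; elim: (index_enum _) => [|i s IH].
  by under eq_fun do rewrite big_nil; exact: measurable_cst.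
under eq_fun do rewrite big_cons /=; apply: measurable_maxr => //.
by apply: measurableT_comp => //; exact: mv.
Qed.

Lemma measurable_selected_model p k (v : T -> 'cV[R]_p) (S : {set 'I_p}) :
  (0 < k <= p)%N -> mxmeas v -> measurable [set w | selected_model (v w) k = S].
Proof.
move=> kp mv.
rewrite (_ : mkset _ = [set w | forall i, ((\sum_j (`|v w i 0| < `|v w j 0|)%R)%N%:R < k%:R :> R) = (i \in S)]); last first.
  apply/seteqP; split => w /= => [<- i|h]; first by rewrite selected_modelE// ltr_nat.
  by apply/setP => i; rewrite selected_modelE// -h ltr_nat.
apply: measurable_forall => i.
have mb : measurable_fun setT (fun w => (\sum_j (`|v w i 0| < `|v w j 0|)%R)%N%:R < k%:R :> R).
  apply: measurable_fun_ltr => //; under eq_fun do rewrite natr_sum.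
  apply: measurable_bigsum => j; apply/measurable_EFinP; apply: measurable_natb.
  by apply: measurable_fun_ltr; apply: measurableT_comp => //; exact: mv.
case: (i \in S); first by have := measurable_set_of mb.
have := measurable_set_of (measurable_neg mb).
by congr measurable; apply/seteqP; split => w /=; [move/negbTE|move=> ->].
Qed.

Lemma mxmeas_gauss_lasso n p (X : T -> 'M[R]_(n, p)) (Y : T -> 'cV[R]_n) (th : T -> 'cV[R]_p) :
  mxmeas X -> mxmeas Y -> mxmeas th -> mxmeas (fun w => gauss_lasso (X w) (Y w) (th w)).
Proof.
move=> mX mY mth.
(* The dimensions in the estimator depend on the outcome through the support; it is therefore
   written as a sum over all sets [U] of the formula with fixed support [U], weighted by the
   indicator that the support is [U]. *)
pose b (U : {set 'I_p}) w : R := \prod_i (((th w i 0 != 0) == (i \in U))%:R).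
have bE U w : b U w = (vsupp (th w) == U)%:R.
  rewrite /b; have [<-|/eqP neq] := eqVneq.
    by rewrite big1// => i _; rewrite inE eqxx.
  apply/eqP/prodf_eq0; apply: contra_notP neq => h; apply/setP => i.
  apply/eqP; apply: contra_notT h => h; exists i => //.
  by move: h; rewrite inE pnatr_eq0 eqb0.
have mb U : measurable_fun setT (b U).
  apply: measurable_bigprod => i; apply/measurable_EFinP; apply: measurable_natb.
  have m1 : measurable_fun setT (fun w => th w i 0 == 0).
    by apply: measurable_fun_eqr => //; exact: mth.
  case: (i \in U).
    by under eq_fun do rewrite eqb_id; exact: measurable_neg.
  by under eq_fun do rewrite eqbF_neg negbK.
rewrite (_ : (fun w => _) = fun w => \sum_(U : {set 'I_p}) b U w *:
  (emb U *m (invmx ((X w *m emb U)^T *m (X w *m emb U)) *m (X w *m emb U)^T *m Y w))); last first.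
  apply/funext => w; rewrite (bigD1 (vsupp (th w)))//= big1 => [|U UV].
    by rewrite addr0 bE eqxx scale1r /gauss_lasso extvE subcolsE.
  by rewrite bE eq_sym (negbTE UV) scale0r.
move=> i j; under eq_fun do rewrite summxE; apply: measurable_bigsum => U.
have mXU : mxmeas (fun w => X w *m emb U) by apply: mxmeas_mul => //; exact: mxmeas_cst.
have mXUT := mxmeas_tr mXU.
apply: mxmeas_scale => //; apply: mxmeas_mul; first exact: mxmeas_cst.
by apply: mxmeas_mul => //; apply: mxmeas_mul => //; apply: mxmeas_inv; apply: mxmeas_mul.
Qed.

End MeasurableEstimator.

(** * Probability of the bad events *)

Section OuterBound.
Context (R : realType) d (Om : measurableType d) (P : probability Om R).

(* Outer-measure bounds let the bad events be combined without proving each measurable. *)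
Definition outer_bound (Q : set Om) (e : R) : Prop :=
  exists A, [/\ measurable A, Q `<=` A & (P A <= e%:E)%E].

Lemma outer_bound_bool (b : Om -> bool) (Q : set Om) e : measurable_fun setT b ->
  (forall w, Q w -> b w) -> (P [set w | b w] <= e%:E)%E -> outer_bound Q e.
Proof. by move=> mb Qb Pb; exists [set w | b w]; split => //; exact: measurable_set_of. Qed.

Lemma outer_bound0 (Q : set Om) e : 0 <= e -> (forall w, ~ Q w) -> outer_bound Q e.
Proof.
move=> e0 Q0; exists set0; split => //.
by rewrite measure0 lee_fin.
Qed.

Lemma outer_bound_sub (Q Q' : set Om) e e' : outer_bound Q e -> (forall w, Q' w -> Q w) ->
  e <= e' -> outer_bound Q' e'.
Proof.
move=> [A [mA QA PA]] QQ ee; exists A; split => //; first by move=> w /QQ /QA.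
by apply: le_trans PA _; rewrite lee_fin.
Qed.

Lemma outer_bound_or (Q Q' : set Om) e e' : outer_bound Q e -> outer_bound Q' e' ->
  outer_bound (Q `|` Q') (e + e').
Proof.
move=> [A [mA QA PA]] [A' [mA' QA' PA']]; exists (A `|` A'); split.
- exact: measurableU.
- by move=> w [/QA|/QA']; [left|right].
- apply: (@le_trans _ _ (P A + P A')%E); last by rewrite EFinD leeD.
  exact: measureU2.
Qed.

Lemma outer_bound_exists (I : finType) (Q : I -> set Om) e :
  (forall i, outer_bound (Q i) e) -> outer_bound [set w | exists i, Q i w] (#|I|%:R * e).
Proof.
move=> h.
suff : forall s : seq I, outer_bound [set w | exists2 i, i \in s & Q i w] ((size s)%:R * e).
  move=> /(_ (enum I)); rewrite -cardE => /outer_bound_sub; apply => //.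
  by move=> w [i Qi]; exists i; rewrite ?mem_enum.
elim=> [|i s IH] /=.
  by rewrite mul0r; apply: outer_bound0 => // w [].
apply: outer_bound_sub (outer_bound_or (h i) IH) _ _.
  move=> w [j]; rewrite inE => /orP[/eqP ->|js] Qj; [by left|right].
  by exists j.
by rewrite -natr1 mulrDl mul1r addrC.
Qed.

Lemma outer_bound_le (Q : set Om) e : measurable Q -> outer_bound Q e -> (P Q <= e%:E)%E.
Proof.
move=> mQ [A [mA QA PA]]; apply: le_trans PA.
by apply: le_measure; rewrite ?inE.
Qed.

End OuterBound.

Lemma l2_scale_lt (R : realType) n m (a : 'cV[R]_n) (q : 'cV[R]_m) (L t : R) : 0 <= L ->
  4 * L * l2sq a * l2sq q < t ^+ 2 -> 2 * Num.sqrt L * l2 a * l2 q < `|t|.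
Proof.
move=> L0 h; rewrite -ltr_sqr ?nnegrE ?mulr_ge0 ?sqrtr_ge0//.
rewrite !exprMn !l2_sqr sqr_sqrtr// real_normK ?num_real//.
by rewrite (_ : 2 ^+ 2 = 4)//; ring.
Qed.

Section BadEvents.
Context (R : realType) (d : measure_display) (Om : measurableType d)
  (P : probability Om R) (n p m : nat) (Z : 'I_n -> 'I_p -> Om -> R) (G : 'I_n -> Om -> R).
Hypothesis iid : iid_std_normal P (gauss_family Z G).
Variables (AT : 'M[R]_(p, m)) (v : 'cV[R]_m) (L : R).
Hypothesis uSig : AT^T *m AT \in unitmx.
Hypothesis mn : (m <= n)%N.
Hypothesis L0 : 0 < L.

Let mZ := mxmeas_zmx iid.
Let mG := mxmeas_gvec iid.
Let mZM k (M : 'M[R]_(p, k)) : mxmeas (fun w => zmx Z w *m M).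
Proof. by apply: mxmeas_mul => //; exact: mxmeas_cst. Qed.

Lemma popdir_l2sq u : l2sq (AT *m popinv AT u) = popvar AT u.
Proof. exact: l2sq_sol. Qed.

Lemma popdir_neq0 u : u != 0 -> AT *m popinv AT u != 0.
Proof. by move=> u0; rewrite -l2sq_eq0 popdir_l2sq gt_eqF// popvar_gt0. Qed.

Lemma popdir_perp u : (AT *m popinv AT u)^T *m (AT *m perp_mx u) = 0.
Proof.
have [_ N0 _ _] := perp_mxP u.
have e : (AT *m popinv AT u)^T *m AT = u^T.
  by apply: trmx_inj; rewrite trmx_mul !trmxK mulmxA /popinv mulKVmx.
by rewrite mulmxA e -[RHS]trmx0 -N0 trmx_mul trmxK.
Qed.

Definition gram_ok w := (zmx Z w *m AT)^T *m (zmx Z w *m AT) \in unitmx.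

Lemma bad_gram : outer_bound P [set w | ~ gram_ok w] (m%:R * expR (- ((n%:R - m%:R) / 4))).
Proof.
apply: (outer_bound_bool _ _ (prob_not_unit iid uSig (leqnn m) mn)).
  exact: measurable_neg (measurable_gram_unit (mZM AT)).
by move=> w /= /negP.
Qed.

(** Chernoff's parameter is [1/4]: the threshold [2/3 n] costs [n / 12], and [s / (1 + s) = 1/5]
    gains [(n - m) / 10]. The net rate, about [n / 60], is at least [L] once [n >= 74 m L] with [m]
    and [L] at least 1. *)
Lemma bad_resid u : u != 0 -> n%:R / 12 - (n%:R - m%:R) / 10 <= - L ->
  outer_bound P [set w | gram_ok w /\ ~ good_resid AT (zmx Z w) u] (expR (- L)).
Proof.
move=> u0 nL; have [km _ _ Ni] := perp_mxP u.
have q0 : (0 : R) <= 1 / 4 by lra.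
have := prob_resid_small iid (2 / 3 * n%:R) (popdir_neq0 u0) (popdir_perp u)
  (leq_trans km mn) q0 => h.
apply: (outer_bound_bool _ _ (le_trans h _)).
- apply: measurable_and; first exact: measurable_gram_unit.
  by apply: measurable_fun_ler => //; apply: measurable_l2sq; exact: measurable_resid.
- move=> w /= [ok /negP]; rewrite -leNgt popdir_l2sq => ->; rewrite andbT.
  by rewrite [zmx Z w *m _]mulmxA; exact: gram_mul_unit.
- rewrite lee_fin ler_expR; apply: le_trans nL.
  have kR : (perp_dim u)%:R <= m%:R :> R by rewrite ler_nat.
  rewrite (_ : 1 / 4 / (1 + 1 / 4) = 1 / 5); last by field.
  by lra.
Qed.

Lemma bad_sqr u : u != 0 ->
  outer_bound P [set w | ~ good_sqr AT (zmx Z w) u] (expR (- (n%:R / 20))).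
Proof.
move=> u0; apply: (outer_bound_bool _ _ (prob_sqr_large iid (popdir_neq0 u0))).
  by apply: measurable_fun_ltr => //; apply: measurable_l2sq.
by move=> w /= /negP; rewrite -ltNge popdir_l2sq.
Qed.

Lemma bad_noise_sqr :
  outer_bound P [set w | ~ (l2sq (gvec G w) <= 2 * n%:R)] (expR (- (n%:R / 20))).
Proof.
apply: (outer_bound_bool _ _ (prob_noise_sqr_large iid)).
  by apply: measurable_fun_ltr => //; apply: measurable_l2sq.
by move=> w /= /negP; rewrite -ltNge.
Qed.

Let x0 : 0 < 2 * Num.sqrt L. Proof. by rewrite mulr_gt0// sqrtr_gt0. Qed.

Let xE : expR (- ((2 * Num.sqrt L) ^+ 2 / 2)) = expR (- (2 * L)).
Proof. by rewrite exprMn sqr_sqrtr ?ltW//; congr expR; field. Qed.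

Lemma bad_cross u : u != 0 ->
  outer_bound P [set w | ~ good_cross AT v L (zmx Z w) u] (expR (- (2 * L))).
Proof.
move=> u0; rewrite -xE.
have ma d' (T : measurableType d') (X : T -> 'M[R]_(n, perp_dim u)) (g : T -> 'cV[R]_n) :
    mxmeas X -> mxmeas g -> mxmeas (fun t => cross_vec (perp_mx u) v (X t)).
  move=> mX _; have mXT := mxmeas_tr mX.
  apply: mxmeas_mul => //; apply: mxmeas_mul; last exact: mxmeas_cst.
  by apply: mxmeas_inv; apply: mxmeas_mul.
apply: (outer_bound_bool _ _ (prob_linear iid (a := fun Y _ => cross_vec (perp_mx u) v Y)
    (popdir_neq0 u0) (popdir_perp u) x0 ma)).
  have mc := ma _ _ _ _ (mZM (AT *m perp_mx u)) mG.
  apply: measurable_fun_ltr.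
    by do ! apply: measurable_funM => //; exact: measurable_l2.
  by apply: measurableT_comp => //; exact: measurable_dot.
by move=> w /= /negP; rewrite -ltNge -popdir_l2sq; apply: l2_scale_lt; exact: ltW.
Qed.

Let mgsol d' (T : measurableType d') (X : T -> 'M[R]_(n, m)) u :
  mxmeas X -> mxmeas (fun t => gsol (X t) u).
Proof.
move=> mX; have mXT := mxmeas_tr mX.
apply: mxmeas_mul => //; apply: mxmeas_mul; last exact: mxmeas_cst.
by apply: mxmeas_inv; apply: mxmeas_mul.
Qed.

Let mhsol d' (T : measurableType d') (X : T -> 'M[R]_(n, p)) u :
  mxmeas X -> mxmeas (fun t => gsol (X t *m AT) u).
Proof. by move=> mX; apply: mgsol; apply: mxmeas_mul => //; exact: mxmeas_cst. Qed.

Lemma bad_noise u :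
  outer_bound P [set w | ~ good_noise AT L (zmx Z w) (gvec G w) u] (expR (- (2 * L))).
Proof.
rewrite -xE.
apply: (outer_bound_bool _ _ (prob_noise_linear iid (h := fun X => gsol (X *m AT) u) x0 (fun d' T X => @mhsol d' T X u))).
  have mh := mhsol u mZ.
  apply: measurable_fun_ltr.
    by do ! apply: measurable_funM => //; exact: measurable_l2.
  by apply: measurableT_comp => //; exact: measurable_dot.
move=> w /= /negP; rewrite -ltNge => h.
(* A unit vector in dimension one serves as second factor, so that [l2_scale_lt] applies. *)
have l1 : l2sq (const_mx 1 : 'cV[R]_1) = 1 by rewrite /l2sq big_ord1 mxE expr1n.
have := @l2_scale_lt _ _ _ (gsol (zmx Z w *m AT) u) (const_mx 1 : 'cV[R]_1) L
  (dot (gsol (zmx Z w *m AT) u) (gvec G w)) (ltW L0).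
by rewrite {2}/l2 l1 sqrtr1 !mulr1; exact.
Qed.

Lemma bad_dual tau q : q^T *m AT = 0 ->
  outer_bound P [set w | ~ good_dual AT v L tau (zmx Z w) (gvec G w) q] (expR (- (2 * L))).
Proof.
move=> qA; have [->|q0] := eqVneq q 0.
  apply: outer_bound0 => [|w]; first exact: expR_ge0.
  by apply; rewrite /good_dual mulmx0 dot0r expr0n [l2sq 0]l2sqE dot0l mulr0.
rewrite -xE.
have ma d' (T : measurableType d') (X : T -> 'M[R]_(n, m)) (g : T -> 'cV[R]_n) :
    mxmeas X -> mxmeas g -> mxmeas (fun t => dual_vec v tau (X t) (g t)).
  move=> mX mg; apply: mxmeas_add; first exact: mgsol.
  by apply: mxmeas_scale => //; exact: measurable_resid.
apply: (outer_bound_bool _ _ (prob_linear iid (a := fun X g => dual_vec v tau X g) q0 qA x0 ma)).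
  have mc := ma _ _ _ _ (mZM AT) mG.
  apply: measurable_fun_ltr.
    by do ! apply: measurable_funM => //; exact: measurable_l2.
  by apply: measurableT_comp => //; exact: measurable_dot.
by move=> w /= /negP; rewrite -ltNge; apply: l2_scale_lt; exact: ltW.
Qed.

(** Given [Z] the tail is [exp(- mu^2 / (2 rho))], and [1 / rho = |r|^2 / popvar^2]; so it is an
    exponential in the chi-square variable [|r|^2 / popvar]. Bounding [1 / popvar] below by [Cmin]
    and taking the Laplace transform gives the exponent. *)
Lemma gauss_coordinate_tail (u : 'cV[R]_m) (mu Cmin : R) : u != 0 -> 0 < mu -> 0 < Cmin ->
  popvar AT u <= l2sq u / Cmin -> l2sq u = 1 ->
  outer_bound P [set w | gram_ok w /\ mu <= `|dot (gsol (zmx Z w *m AT) u) (gvec G w)|]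
    (expR (- ((n%:R - m%:R) / 2 * (Cmin * mu ^+ 2 / (1 + Cmin * mu ^+ 2))))).
Proof.
move=> u0 mu0 C0 vle lu; have [km N0 Ns Ni] := perp_mxP u.
pose N := AT *m perp_mx u; pose q := AT *m popinv AT u.
have d0 := popvar_gt0 uSig u0; rewrite lu div1r in vle.
pose b (X : 'M[R]_(n, p)) := (X *m AT)^T *m (X *m AT) \in unitmx.
have s0 : 0 <= Cmin * mu ^+ 2 by rewrite mulr_ge0 ?sqr_ge0// ltW.
have mb d' (T : measurableType d') (X : T -> 'M[R]_(n, p)) : mxmeas X ->
    measurable_fun setT (fun t => b (X t)).
  by move=> mX; apply: measurable_gram_unit; apply: mxmeas_mul => //; exact: mxmeas_cst.
have := prob_noise_tail iid (h := fun X => gsol (X *m AT) u) (mu := fun=> mu) (fun d' T X => @mhsol d' T X u) mb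
   (fun d' T X mX => @measurable_cst _ _ T R setT mu) (fun _ _ => mu0) => h.
apply: (outer_bound_bool _ _ (le_trans h _)).
- apply: measurable_and; first exact: mb.
  apply: measurable_fun_ler => //; apply: measurableT_comp => //.
  by apply: measurable_dot => //; exact: mhsol.
- by move=> w /= [ok ->]; rewrite andbT.
have := integral_resid iid 0 (popdir_neq0 u0) (popdir_perp u) (leq_trans km mn) s0 => h2.
apply: (@le_trans _ _ _ _ _ (le_trans _ h2)).
  apply: ge0_le_integral => //.
  - under eq_fun do rewrite EFinM.
    apply: emeasurable_funM; first by apply: measurable_natb; exact: mb.
    apply/measurable_EFinP; apply: measurable_expR_comp.
    apply: measurable_funM => //; apply: measurable_realV; apply: measurable_funM => //.
    by apply: measurable_l2sq; exact: mhsol.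
  - under eq_fun do rewrite EFinM.
    apply: emeasurable_funM; first by apply: measurable_natb; exact: measurable_gram_unit.
    apply/measurable_EFinP; apply: measurable_expR_comp; apply: measurable_funB => //.
    do ! apply: measurable_funM => //.
    by apply: measurable_l2sq; exact: measurable_resid.
  move=> w _; rewrite lee_fin /b; case: (boolP (_ \in unitmx)) => uX; last first.
    by rewrite mul0r mulr_ge0// expR_ge0.
  have uN : (zmx Z w *m (AT *m perp_mx u))^T *m (zmx Z w *m (AT *m perp_mx u)) \in unitmx.
    by rewrite [zmx Z w *m _]mulmxA; exact: gram_mul_unit.
  rewrite uN !mul1r ler_expR sub0r mulNr lerN2 popdir_l2sq.
  have := directional_rho (popinv AT u) uX u0 N0 Ns Ni; rewrite -/(popvar AT u).
  have r0 := directional_rho_gt0 uX u0.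
  rewrite l2sq_gsol// -!mulmxA; set r := l2sq _; move: r0; set rho := dot u _ => r0 e.
  have r1 : 0 < r by rewrite -(pmulr_rgt0 _ r0) e exprn_gt0.
  have -> : mu ^+ 2 / (2 * rho) = mu ^+ 2 / popvar AT u * (r / popvar AT u) / 2.
    have : rho * r / (popvar AT u ^+ 2) = 1 by rewrite e mulfV// expf_neq0// gt_eqF.
    move=> e1; rewrite -[LHS]mulr1 -e1; field; rewrite !gt_eqF//.
  rewrite ler_pM2r// ler_wpM2r//.
    by rewrite divr_ge0 ?l2sq_ge0// ltW.
  rewrite mulrC ler_wpM2l ?sqr_ge0// -[leLHS]invrK lef_pV2 ?posrE ?invr_gt0//.
rewrite lee_fin ler_expR sub0r lerN2.
have kR : (perp_dim u)%:R <= m%:R :> R by rewrite ler_nat.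
rewrite ler_wpM2r//; last by lra.
by rewrite divr_ge0// addr_ge0.
Qed.

End BadEvents.

(** * Arithmetic of the averaged tail *)

Section TailArithmetic.
Variables (R : realType) (n t s L l : R).
Hypothesis s0 : 0 <= s.
Hypothesis st : s <= t.
Hypothesis t1 : 1 <= t.
Hypothesis tl : ln t <= l.
Hypothesis L1 : 1 <= L.
Hypothesis nL : 74 * t * L <= n.

(* Uses a / (1 + a) >= a - a^2; the hypotheses keep [t * a] below 1/37, so the loss in the
   exponent is absorbed by the factor 2. *)
Lemma tail_bound_small (a : R) : 0 <= a -> n * a / 2 <= L -> n * a / 2 <= l + s / 2 ->
  t * expR (- ((n - t) / 2 * (a / (1 + a)))) <= 2 * expR (l - n * a / 2).
Proof.
move=> a0 yL yl; have t1' := t1; have L1' := L1; have st' := st; have tl' := tl.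
have t0 : 0 < t by lra.
have L0 : 0 < L by lra.
have ta : 37 * t * a <= 1.
  have h : 74 * t * L * a <= n * a by rewrite ler_wpM2r.
  by rewrite -(ler_pM2r L0) mul1r; lra.
have ba : a - a ^+ 2 <= a / (1 + a).
  rewrite ler_pdivlMr; last by lra.
  rewrite -subr_ge0 (_ : _ - _ = a ^+ 3); last by ring.
  by rewrite exprn_ge0.
have tn : 0 <= n - t.
  have : 0 <= t * (74 * L - 1) by rewrite mulr_ge0; lra.
  have := nL; lra.
have hb : (n - t) / 2 * (a - a ^+ 2) <= (n - t) / 2 * (a / (1 + a)).
  by rewrite ler_wpM2l// divr_ge0.
have a2 : 0 <= t * a ^+ 2 by rewrite mulr_ge0 ?sqr_ge0// ltW.
set z := n * a / 2 * a.
have z0 : 37 * t * z <= l + s / 2.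
  apply: le_trans yl; rewrite (_ : _ * z = 37 * t * a * (n * a / 2)); last by rewrite /z; ring.
  by rewrite ler_piMl// divr_ge0// mulr_ge0//; lra.
have lt : ln t <= t.
  by apply: ltW; apply: ln_sublinear.
(* From [s <= t] and [ln t <= t], the bound [l + s / 2] is at most [(l - ln t) + 3/2 t]; dividing by
   [t >= 1] only helps. *)
have zb : 37 * z <= 3 / 2 + (l - ln t).
  rewrite -(ler_pM2l t0).
  have : 0 <= (t - 1) * (l - ln t) by rewrite mulr_ge0//; lra.
  by lra.
have key : ln t - (n - t) / 2 * (a / (1 + a)) <= 1 / 2 + (l - n * a / 2).
  have : n * a / 2 - (n - t) / 2 * (a - a ^+ 2) = t * a / 2 + z - t * a ^+ 2 / 2.
    by rewrite /z; field.
  by lra.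
rewrite -[X in X * _](@lnK _ t) ?posrE// -expRD.
apply: (@le_trans _ _ (expR (1 / 2 + (l - n * a / 2)))); first by rewrite ler_expR.
rewrite [leLHS]expRD ler_wpM2r ?expR_ge0//.
have := expR_ge1Dx (- (1 / 2) : R); rewrite expRN.
rewrite (_ : 1 - 1 / 2 = 2^-1 :> R); last by field.
by rewrite lef_pV2 ?posrE ?expR_gt0.
Qed.

(* When [n * a / 2] exceeds min (L, l + s / 2), shrink [a] to that threshold: the left side is
   monotone in [a], and the last two terms of the right side cover the threshold. *)
Lemma tail_bound (a : R) : 0 <= a -> 0 <= l ->
  t * expR (- ((n - t) / 2 * (a / (1 + a)))) <=
  2 * expR l * expR (- (n * a / 2)) + 2 * expR (l - L) + 2 * expR (- (s / 2)).
Proof.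
move=> a0 l0; have t1' := t1; have L1' := L1; have s0' := s0.
have e0 x : 0 <= expR x :> R by exact: expR_ge0.
pose Y := Num.min L (l + s / 2).
have [yY|Yy] := leP (n * a / 2) Y.
  move: yY; rewrite le_min => /andP[yL yl].
  apply: le_trans (tail_bound_small a0 yL yl) _.
  have -> : 2 * expR l * expR (- (n * a / 2)) = 2 * expR (l - n * a / 2).
    by rewrite expRD mulrA.
  by have := e0 (l - L); have := e0 (- (s / 2)); lra.
have tn : t <= n.
  have : 0 <= t * (74 * L - 1) by rewrite mulr_ge0; lra.
  have := nL; lra.
have n0 : 0 < n by lra.
have Y0 : 0 <= Y by rewrite le_min; apply/andP; split; lra.
pose b := 2 * Y / n.
have b0 : 0 <= b by rewrite divr_ge0 ?mulr_ge0// ltW.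
have bY : n * b / 2 = Y by rewrite /b; field; rewrite gt_eqF.
have ba : b <= a by rewrite /b ler_pdivrMr//; lra.
have YL : Y <= L by rewrite ge_min lexx.
have Yl : Y <= l + s / 2 by rewrite ge_min lexx orbT.
have mono : b / (1 + b) <= a / (1 + a).
  rewrite ler_pdivrMr; last by lra.
  rewrite mulrAC ler_pdivlMr; last by lra.
  by lra.
apply: (@le_trans _ _ (t * expR (- ((n - t) / 2 * (b / (1 + b)))))).
  rewrite ler_wpM2l; [|lra|]; last by rewrite ler_expR lerN2 ler_wpM2l//; lra.
  by [].
apply: le_trans (tail_bound_small b0 _ _) _; rewrite bY//.
have : 0 <= 2 * expR l * expR (- (n * a / 2)) by rewrite !mulr_ge0.
have := e0 (l - L); have := e0 (- (s / 2)).
rewrite /Y; case: (leP L (l + s / 2)) => _; first lra.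
by rewrite (_ : l - (l + s / 2) = - (s / 2)); [lra|ring].
Qed.

End TailArithmetic.

(** * Error and selection bounds *)

(** The crude estimate [exp 1 <= 4] suffices. *)
Lemma expR_lt1 (R : realType) (x : R) : 8 < expR x -> 1 <= x.
Proof.
move=> h; rewrite leNgt; apply/negP => x1.
have e2 : expR (1 / 2) <= 2 :> R.
  have := expR_ge1Dx (- (1 / 2) : R); rewrite expRN.
  rewrite (_ : 1 - 1 / 2 = 2^-1 :> R); last by field.
  by rewrite lef_pV2 ?posrE ?expR_gt0.
have : expR x <= expR (1 / 2 + 1 / 2) by rewrite ler_expR; lra.
rewrite expRD; have : 0 < expR (1 / 2) :> R by exact: expR_gt0.
by nra.
Qed.

Section GaussLassoBounds.
Context (R : realType) (d : measure_display) (Om : measurableType d)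
  (P : probability Om R) (n p : nat)
  (Sig A : 'M[R]_p) (th0 : 'cV[R]_p) (sigma : R)
  (Z : 'I_n -> 'I_p -> Om -> R) (G : 'I_n -> Om -> R)
  (xi0 : R) (v0 : 'cV[R]_p) (Cmin eta c1 c2 lam : R) (thhat : Om -> 'cV[R]_p).
Local Notation S := (vsupp th0).
Local Notation T := (vsupp v0).
Local Notation E := (emb (R := R) T).
Local Notation AT := (A *m E).
Local Notation v := (E^T *m v0).
Local Notation L := (c1 * ln (p%:R : R)).
Local Notation t := #|T|.
Local Notation w0 := (extv (invmx (subm T T Sig) *m subv T v0)).
Local Notation tau := (sigma / (n%:R * lam)).
Hypothesis iid : iid_std_normal P (gauss_family Z G).
Hypothesis AA : A^T *m A = Sig.
Hypothesis Sigpos : forall u : 'cV[R]_p, u != 0 -> 0 < qform Sig u.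
Hypothesis Sigd : forall i, Sig i i <= 1.
Hypothesis sigma0 : 0 < sigma.
Hypothesis xi00 : 0 < xi0.
Hypothesis minsg : forall xi, 0 < xi < xi0 -> forall th, is_pop_min Sig th0 xi th ->
     map_mx Num.sg th = v0.
Hypothesis Cmin0 : 0 < Cmin.
Hypothesis Csig : Cmin <= sigma_min (subm T T Sig).
Hypothesis eta0 : 0 < eta.
Hypothesis dual : linf (subm (~: T) T Sig *m invmx (subm T T Sig) *m subv T v0) <= 1 - eta.
Hypothesis lamE : lam = 4 * sigma / eta * Num.sqrt (L / n%:R).
Hypothesis c20 : 0 < c2.
Hypothesis betamin : forall i, i \in S -> c2 * lam + 3 / 2 * lam * `|w0 i 0| <= `|th0 i 0|.
Hypothesis w0min : forall i, i \in T :\: S -> 2 * c2 <= `|w0 i 0|.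
Hypothesis etac : eta <= c2 * Num.sqrt Cmin.
Hypothesis nM : Num.max (74 * c1 / (eta ^+ 2 * Cmin)) (32 ^+ 2 * c1 / (c2 ^+ 2 * Cmin ^+ 2))
  * t%:R * ln (p%:R) <= n%:R.
Hypothesis mth : forall i, measurable_fun setT (fun w => thhat w i 0).
Hypothesis las : forall w,
  is_lasso (design Z A w) (response Z G A th0 sigma w) lam (thhat w).
Hypothesis n_gt0 : (0 < n)%N.
Hypothesis s_gt0 : (0 < #|S|)%N.
Hypothesis Lbig : 8 * p%:R < expR L.

Let nR : 0 < n%:R :> R. Proof. by rewrite ltr0n. Qed.

Let p_gt0 : (0 < p)%N.
Proof. by rewrite (leq_trans s_gt0)// -[leqRHS]card_ord max_card. Qed.

Let pR : 1 <= p%:R :> R. Proof. by rewrite ler1n. Qed.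

Let lnp0 : 0 <= ln (p%:R : R). Proof. exact: ln_ge0. Qed.

Let L1 : 1 <= L. Proof. by apply: expR_lt1; apply: le_lt_trans Lbig; have := pR; lra. Qed.

Let L0 : 0 < L. Proof. exact: lt_le_trans L1. Qed.

Let ST : S \subset T. Proof. exact: (pop_supp_sub AA Sigpos xi00 minsg). Qed.

Let t_gt0 : (0 < t)%N. Proof. by rewrite (leq_trans s_gt0)// subset_leq_card. Qed.

Let tR : 1 <= t%:R :> R. Proof. by rewrite ler1n. Qed.

Let tp : (t <= p)%N. Proof. by rewrite -[leqRHS]card_ord max_card. Qed.

Let lam_gt0 : 0 < lam.
Proof. by rewrite lamE mulr_gt0 ?divr_gt0 ?mulr_gt0// sqrtr_gt0 divr_gt0. Qed.

Let lam2 : n%:R * lam ^+ 2 * eta ^+ 2 = 16 * sigma ^+ 2 * L.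
Proof.
rewrite lamE exprMn sqr_sqrtr ?divr_ge0 ?(ltW L0)//.
by field; rewrite !gt_eqF.
Qed.

Let uSig : AT^T *m AT \in unitmx. Proof. exact: (gramAT_unit AA Sigpos). Qed.

Let submTE : subm T T Sig = AT^T *m AT.
Proof. by rewrite submE -AA trmx_mul !mulmxA. Qed.

Let w0E : w0 = E *m popinv AT v.
Proof. by rewrite extvE subvE submTE. Qed.

Let etac2 : eta ^+ 2 <= c2 ^+ 2 * Cmin.
Proof.
rewrite -[X in _ * X]sqr_sqrtr ?(ltW Cmin0)// -exprMn ler_sqr ?nnegrE ?(ltW eta0)//.
by rewrite mulr_ge0 ?sqrtr_ge0// ltW.
Qed.

Let n74 : 74 * L * t%:R <= n%:R * (eta ^+ 2 * Cmin).
Proof.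
have e0 : 0 < eta ^+ 2 * Cmin by rewrite mulr_gt0// exprn_gt0.
rewrite -ler_pdivrMr//; apply: le_trans nM.
rewrite [leLHS](_ : _ = 74 * c1 / (eta ^+ 2 * Cmin) * (t%:R * ln p%:R)); last by ring.
by rewrite -[leRHS]mulrA ler_wpM2r ?le_max ?lexx// mulr_ge0.
Qed.

Let n1024 : 1024 * L * t%:R <= n%:R * (c2 ^+ 2 * Cmin ^+ 2).
Proof.
have e0 : 0 < c2 ^+ 2 * Cmin ^+ 2 by rewrite mulr_gt0// exprn_gt0.
rewrite -ler_pdivrMr//; apply: le_trans nM.
rewrite [leLHS](_ : _ = 32 ^+ 2 * c1 / (c2 ^+ 2 * Cmin ^+ 2) * (t%:R * ln p%:R)); last by ring.
by rewrite -[leRHS]mulrA ler_wpM2r ?le_max ?lexx ?orbT// mulr_ge0.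
Qed.

Let colA1 j : l2sq (col j A) <= 1.
Proof.
apply: le_trans (Sigd j); rewrite -AA mxE /l2sq.
by apply: ler_sum => i _; rewrite !mxE expr2.
Qed.

Let Csig' : Cmin <= sigma_min (AT^T *m AT). Proof. by rewrite -submTE. Qed.

Let Cmin_1 : Cmin <= 1.
Proof.
have [i iT] := card_gt0P t_gt0.
apply: (Cmin_le1 uSig Cmin0 Csig' (i := enum_rank_in iT i)).
rewrite (_ : col _ AT = col i A); first exact: colA1.
by apply/matrixP => k l; rewrite -subcolsE !mxE enum_rankK_in.
Qed.

Let eta_1 : eta <= 1.
Proof.
have : 0 <= linf (subm (~: T) T Sig *m invmx (subm T T Sig) *m subv T v0).
  by rewrite /linf; elim/big_ind : _ => // x y x0 y0; rewrite le_max x0.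
by have := dual; lra.
Qed.

Let n74' : 74 * t%:R * L <= n%:R.
Proof.
rewrite -mulrA [t%:R * _]mulrC mulrA; apply: le_trans n74 _.
by rewrite ler_piMr ?(ltW nR)// mulr_ile1 ?(ltW Cmin0) ?sqr_ge0// expr_le1 ?(ltW eta0)//.
Qed.

Let tn : (t <= n)%N.
Proof.
rewrite -(ler_nat R); apply: le_trans n74'.
rewrite mulrAC -[leLHS]mul1r ler_wpM2r//; have := L1; lra.
Qed.

Let vn0 : v != 0.
Proof.
have [i iT] := card_gt0P t_gt0; apply/eqP => /matrixP/(_ (enum_rank_in iT i) 0).
by rewrite tr_emb_mulE enum_rankK_in// mxE => /eqP; apply/negP; move: iT; rewrite inE.
Qed.

Let lv : l2sq v = t%:R.
Proof.
rewrite /l2sq (eq_bigr (fun=> 1)) ?sumr_const ?card_ord// => i _.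
by rewrite tr_emb_mulE (pop_entry AA xi00 minsg)// enum_valP.
Qed.

Let dualT j : j \notin T -> `|dot (popinv AT (AT^T *m col j A)) v| <= 1 - eta.
Proof.
move=> jT; have jC : j \in ~: T by rewrite inE.
apply: le_trans dual.
have -> : dot (popinv AT (AT^T *m col j A)) v =
  (subm (~: T) T Sig *m invmx (subm T T Sig) *m subv T v0) (enum_rank_in jC j) 0.
  rewrite submTE submE subvE -!mulmxA tr_emb_mulE enum_rankK_in//.
  rewrite -AA -!mulmxA [A *m (E *m _)]mulmxA.
  have Ssym : (AT^T *m AT)^T = AT^T *m AT by rewrite [LHS]trmx_mul trmxK.
  rewrite /popinv dot_mull trmx_inv Ssym dot_mull trmxK.
  by rewrite dotE [RHS]mxE; apply: eq_bigr => i _; rewrite !mxE.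
exact: (le_bigmax _ (fun i => `|(subm (~: T) T Sig *m invmx (subm T T Sig) *m subv T v0) i 0|)).
Qed.

Let ldual j : j \notin T -> l2sq (dual_dir A v0 j) <= 1.
Proof. by move=> _; rewrite dual_dirE; apply: le_trans (colA1 j); exact: l2sq_resid_le. Qed.

Let dual_dir_perp j : (dual_dir A v0 j)^T *m AT = 0.
Proof. by apply: trmx_inj; rewrite trmx_mul trmxK dual_dirE tr_resid// trmx0. Qed.

Let varle u : popvar AT u <= l2sq u / Cmin. Proof. exact: popvar_le. Qed.

(** The residual events carry the guard [gram_ok], under which their Chernoff bounds hold; its
    failure is a bad event of its own. *)
Let bad : set Om :=
  [set w | ~ gram_ok Z AT w] `|`
  [set w | gram_ok Z AT w /\ ~ good_resid AT (zmx Z w) v] `|`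
  [set w | exists i, gram_ok Z AT w /\ ~ good_resid AT (zmx Z w) (unitv R i)] `|`
  [set w | exists i, ~ good_sqr AT (zmx Z w) (unitv R i)] `|`
  [set w | exists i, ~ good_cross AT v L (zmx Z w) (unitv R i)] `|`
  [set w | exists i, ~ good_noise AT L (zmx Z w) (gvec G w) (unitv R i)] `|`
  [set w | ~ (l2sq (gvec G w) <= 2 * n%:R)] `|`
  [set w | exists j, ~ good_dual AT v L tau (zmx Z w) (gvec G w) (dual_dir A v0 j)].

Let bad_bound : outer_bound P bad (6 * p%:R * expR (- L)).
Proof.
have nL := n74'; have t1 := tR; have l1 := L1.
have tL : t%:R <= t%:R * L by rewrite ler_peMr//; lra.
have LtL : L <= t%:R * L by rewrite ler_peMl// ltW.
have nt : n%:R / 12 - (n%:R - t%:R) / 10 <= - L by lra.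
have b1 := bad_gram iid uSig tn.
have b2 := bad_resid iid uSig tn vn0 nt.
have b3 := outer_bound_exists (fun i => bad_resid iid uSig tn (unitv_neq0 R i) nt).
have b4 := outer_bound_exists (fun i => bad_sqr iid uSig (unitv_neq0 R i)).
have b5 := outer_bound_exists (fun i => bad_cross iid v uSig L0 (unitv_neq0 R i)).
have b6 := outer_bound_exists (fun i => bad_noise iid AT L0 (unitv R i)).
have b7 := bad_noise_sqr iid.
have b8 := outer_bound_exists (fun j => bad_dual iid v L0 tau (dual_dir_perp j)).
apply: outer_bound_sub (outer_bound_or (outer_bound_or (outer_bound_or (outer_bound_or
  (outer_bound_or (outer_bound_or (outer_bound_or b1 b2) b3) b4) b5) b6) b7) b8) _ _ => //.
rewrite !card_ord; set e := expR (- L).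
have e0 : 0 < e by exact: expR_gt0.
have ee : expR (- (2 * L)) = e * e by rewrite -expRD; congr expR; ring.
have p1 := pR; have pt : t%:R <= p%:R :> R by rewrite ler_nat.
(* Hence every event of rate [exp(- 2 L)] costs at most [p e / 8] after the union bound. Only the
   two residual events cost a full [p e], so the total stays well below 6. *)
have e8 : 8 * e <= 1.
  rewrite /e expRN ler_pdivrMr ?expR_gt0// mul1r; apply: le_trans (ltW Lbig).
  by rewrite ler_peMr.
have h1 : expR (- ((n%:R - t%:R) / 4)) <= e * e by rewrite -ee ler_expR; lra.
have h2 : expR (- (n%:R / 20)) <= e * e by rewrite -ee ler_expR; lra.
rewrite ee.
have k1 (x y : R) : 0 <= x -> x <= y -> t%:R * x <= p%:R * y by move=> x0 xy; rewrite ler_pM // ler0n.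
have k2 (x y : R) : 0 <= x -> x <= y -> x <= p%:R * y.
  by move=> x0 xy; rewrite (le_trans xy)// ler_peMl// (le_trans x0).
have e2 : p%:R * (e * e) <= p%:R * e / 8.
  by rewrite -mulrA ler_wpM2l//; nra.
have q1 := k1 _ _ (expR_ge0 _) h1.
have q2 := k1 _ _ (expR_ge0 _) h2.
have q3 := k1 _ _ (ltW e0) (lexx e).
have q4 := k2 _ _ (ltW e0) (lexx e).
have q5 := k2 _ _ (expR_ge0 _) h2.
have q6 : t%:R * (e * e) <= p%:R * (e * e) by apply: k1 => //; rewrite mulr_ge0 ?ltW.
have pe0 : 0 <= p%:R * e by rewrite mulr_ge0// ltW.
by lra.
Qed.

Let thGL w := gauss_lasso (design Z A w) (response Z G A th0 sigma w) (thhat w).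

Let thGL_error w : ~ bad w -> gram_ok Z AT w /\
  thGL w - th0 = E *m (\col_k (sigma * dot (gsol (zmx Z w *m AT) (unitv R k)) (gvec G w))).
Proof.
move=> nb.
have ok : gram_ok Z AT w by apply: contrapT => h; apply: nb; do 7 left.
have gv : good_resid AT (zmx Z w) v.
  by apply: contrapT => h; apply: nb; do 6 left; right.
have g1 i : good_resid AT (zmx Z w) (unitv R i).
  by apply: contrapT => h; apply: nb; do 5 left; right; exists i.
have g2 i : good_sqr AT (zmx Z w) (unitv R i).
  by apply: contrapT => h; apply: nb; do 4 left; right; exists i.
have g3 i : good_cross AT v L (zmx Z w) (unitv R i).
  by apply: contrapT => h; apply: nb; do 3 left; right; exists i.
have g4 i : good_noise AT L (zmx Z w) (gvec G w) (unitv R i).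
  by apply: contrapT => h; apply: nb; do 2 left; right; exists i.
have g5 : l2sq (gvec G w) <= 2 * n%:R.
  by apply: contrapT => h; apply: nb; left; right.
have g6 j : j \notin T -> good_dual AT v L tau (zmx Z w) (gvec G w) (dual_dir A v0 j).
  by move=> _; apply: contrapT => h; apply: nb; right; exists j.
split => //.
have sgS i : i \in S -> v0 i 0 = Num.sg (th0 i 0) by exact: (pop_sign AA Sigpos xi00 minsg).
have sgT i : i \in T -> i \notin S -> v0 i 0 = Num.sg (- (E *m popinv AT v) i 0).
  exact: (pop_sign_compl AA Sigpos xi00 minsg).
have w0S i : i \in S -> c2 * lam + 3 / 2 * lam * `|(E *m popinv AT v) i 0| <= `|th0 i 0|.
  by move=> iS; rewrite -w0E; exact: betamin.
have w0T i : i \in T -> i \notin S -> 2 * c2 <= `|(E *m popinv AT v) i 0|.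
  by move=> iT iS; rewrite -w0E; apply: w0min; rewrite inE iS.
have supp : vsupp (thhat w) = T.
  exact: (support_recovery n_gt0 sigma0 lam_gt0 eta0 c20 Cmin0 L0 lam2 etac2 n74 n1024
    uSig varle vn0 lv ST sgS sgT w0S w0T dualT ldual ok gv g1 g2 g3 g4 g5 g6 (las w)).
have XE : zmx Z w *m A *m E = zmx Z w *m AT by rewrite mulmxA.
rewrite /thGL /response.
have -> : design Z A w = zmx Z w *m A by [].
rewrite (gauss_lasso_error (sigma *: gvec G w) supp ST); last by rewrite XE.
congr (_ *m _); rewrite XE; apply/matrixP => k l; rewrite ord1 [RHS]mxE.
rewrite -unitvE -!scalemxAr dotZr /gsol dot_mull; move: (zmx Z w *m AT) => X.
have Ssym : (X^T *m X)^T = X^T *m X by rewrite [LHS]trmx_mul trmxK.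
by rewrite [dot (invmx _ *m _) _]dot_mull trmx_inv Ssym.
Qed.

Let mthGL : mxmeas thGL.
Proof.
have mX : mxmeas (fun w => zmx Z w *m A).
  by apply: mxmeas_mul; [exact: (mxmeas_zmx iid)|exact: mxmeas_cst].
apply: mxmeas_gauss_lasso; first exact: mX.
  apply: mxmeas_add; first by apply: mxmeas_mul => //; exact: mxmeas_cst.
  by apply: mxmeas_scale => //; exact: (mxmeas_gvec iid).
by move=> i j; rewrite ord1; exact: mth.
Qed.

Lemma measurable_gauss_lasso_linf mu : measurable [set w | (mu <= linf (thGL w - th0))%R].
Proof.
apply: measurable_set_of; apply: measurable_fun_ler => //.
by apply: measurable_linf; apply: mxmeas_add => //; exact: mxmeas_cst.
Qed.

Let s := #|S|.

(** The constant 8 is 6 from [bad] plus 2 from [tail_bound], applied with [l = ln p] and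
    [a = Cmin mu^2 / sigma^2]. *)
Lemma gauss_lasso_linf (mu : R) : 0 < mu ->
  (P [set w | (mu <= linf (thGL w - th0))%R] <=
   (8 * p%:R * expR (- L) + 2 * expR (- (s%:R / 2)) +
    2 * p%:R * expR (- (n%:R * Cmin * mu ^+ 2 / (2 * sigma ^+ 2))))%:E)%E.
Proof.
move=> mu0; apply: outer_bound_le; first exact: measurable_gauss_lasso_linf.
have ms0 : 0 < mu / sigma by rewrite divr_gt0.
have tail k := gauss_coordinate_tail iid uSig tn (unitv_neq0 R k) ms0 Cmin0
  (varle _) (l2sq_unitv R k).
apply: outer_bound_sub (outer_bound_or bad_bound (outer_bound_exists tail)) _ _.
  move=> w /= muw; have [|/thGL_error[ok e]] := pselect (bad w); [by left|right].
  have [i] := linf_ge mu0 muw; rewrite e.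
  have [iT|iT] := boolP (i \in T); last first.
    by rewrite emb_mul_notin// normr0 leNgt mu0.
  rewrite -(enum_rankK_in iT iT) emb_mulE mxE normrM (gtr0_norm sigma0) => h.
  by exists (enum_rank_in iT i); split => //; rewrite ler_pdivrMr// mulrC.
rewrite card_ord.
set a := Cmin * (mu / sigma) ^+ 2.
have a0 : 0 <= a by rewrite mulr_ge0 ?sqr_ge0// ltW.
have tln : ln (t%:R : R) <= ln (p%:R : R).
  by rewrite ler_ln ?posrE ?ltr0n// ler_nat.
have st : s%:R <= t%:R :> R by rewrite ler_nat subset_leq_card.
have := tail_bound (ler0n _ _) st tR tln L1 n74' a0 lnp0.
rewrite lnK ?posrE ?ltr0n// expRB lnK ?posrE ?ltr0n// -expRN.
have -> : n%:R * a / 2 = n%:R * Cmin * mu ^+ 2 / (2 * sigma ^+ 2).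
  by rewrite /a; field; rewrite gt_eqF.
by lra.
Qed.

Lemma gauss_lasso_selection :
  ((1 - (10 * p%:R * expR (- L) + 2 * expR (- (s%:R / 2))))%:E <=
   P [set w | selected_model (thGL w) s = S])%E.
Proof.
(* Half the guaranteed signal. Then [n Cmin mu^2 / (2 sigma^2) = 2 L c2^2 Cmin / eta^2 >= L], so the
   last term is at most [2 p exp(- L)] and raises 8 to 10. *)
set mu := c2 * lam / 2.
have mu0 : 0 < mu by rewrite divr_gt0// mulr_gt0.
have := gauss_lasso_linf mu0; set Q := [set w | _] => hQ.
have mQ : measurable Q by exact: measurable_gauss_lasso_linf.
have sp : (0 < s <= p)%N by rewrite s_gt0 -[leqRHS]card_ord max_card.
apply: (@le_trans _ _ (P (~` Q))); last first.
  apply: le_measure; rewrite ?inE; first exact: measurableC.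
    exact: measurable_selected_model.
  move=> w /negP; rewrite -ltNge => h.
  apply: (selected_model_eq s_gt0 h) => i iS; rewrite /mu mulrC divfK//.
  apply: le_trans (betamin iS); rewrite lerDl !mulr_ge0 ?normr_ge0//; exact: ltW.
rewrite probability_setC// EFinB leeB//; apply: le_trans hQ _.
rewrite lee_fin.
have h : L <= n%:R * Cmin * mu ^+ 2 / (2 * sigma ^+ 2).
  rewrite (_ : _ / _ = (n%:R * lam ^+ 2 * eta ^+ 2) * (c2 ^+ 2 * Cmin) / (8 * sigma ^+ 2 * eta ^+ 2)); last first.
    by rewrite /mu; field; rewrite !gt_eqF.
  rewrite lam2 (_ : _ / _ = 2 * L * (c2 ^+ 2 * Cmin / eta ^+ 2)); last first.
    by field; rewrite !gt_eqF.
  have : 1 <= c2 ^+ 2 * Cmin / eta ^+ 2 by rewrite ler_pdivlMr ?mul1r// exprn_gt0.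
  by have := L0; nra.
have : 2 * p%:R * expR (- (n%:R * Cmin * mu ^+ 2 / (2 * sigma ^+ 2))) <= 2 * p%:R * expR (- L).
  by rewrite ler_wpM2l// ler_expR lerN2.
by lra.
Qed.

End GaussLassoBounds.

Theorem theorem3p6 (R : realType) (d : measure_display) (Om : measurableType d)
  (P : probability Om R) (n p : nat)
  (Sig A : 'M[R]_p) (th0 : 'cV[R]_p) (sigma : R)
  (Z : 'I_n -> 'I_p -> Om -> R) (G : 'I_n -> Om -> R)
  (xi0 : R) (v0 : 'cV[R]_p)
  (Cmin eta c1 c2 lam : R)
  (thhat : Om -> 'cV[R]_p) :
  (* Gaussian model: X = Z A (rows i.i.d. N(0, A^T A)), W = sigma G *)
  iid_std_normal P (gauss_family Z G) ->
  A^T *m A = Sig ->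
  (forall u : 'cV[R]_p, u != 0 -> 0 < qform Sig u) ->
  (forall i, Sig i i <= 1) ->
  0 < sigma ->
  (* T0, v0 : sign pattern of the population minimizer for xi in (0, xi0) *)
  0 < xi0 ->
  (forall xi, 0 < xi < xi0 -> forall th, is_pop_min Sig th0 xi th ->
     map_mx Num.sg th = v0) ->
  let S := vsupp th0 in let s0 := #|S| in
  let T0 := vsupp v0 in let t0 := #|T0| in
  let w0 := extv (invmx (subm T0 T0 Sig) *m subv T0 v0) in
  (* (i) *)
  0 < Cmin -> Cmin <= sigma_min (subm T0 T0 Sig) ->
  (* (ii) *)
  0 < eta ->
  linf (subm (~: T0) T0 Sig *m invmx (subm T0 T0 Sig) *m subv T0 v0) <= 1 - eta ->
  1 < c1 ->
  lam = 4 * sigma / eta * Num.sqrt (c1 * ln (p%:R) / n%:R) ->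
  (* (iii) *)
  0 < c2 ->
  (forall i, i \in S -> c2 * lam + 3 / 2 * lam * `|w0 i 0| <= `|th0 i 0|) ->
  (forall i, i \in T0 :\: S -> 2 * c2 <= `|w0 i 0|) ->
  eta <= c2 * Num.sqrt Cmin ->
  let M1 := 74 * c1 / (eta ^+ 2 * Cmin) in
  let M3 := 32 ^+ 2 * c1 / (c2 ^+ 2 * Cmin ^+ 2) in
  Num.max M1 M3 * t0%:R * ln (p%:R) <= n%:R ->
  let fac := 1 + 4 * opnorm2 Sig / kappa Sig s0 1 in
  Num.max (fac * M1) (fac * M3) * s0%:R * ln (p%:R) <= n%:R ->
  (* the Lasso estimator (a measurable selection of minimizers) *)
  (forall i, measurable_fun setT (fun w => thhat w i 0)) ->
  (forall w, is_lasso (design Z A w) (response Z G A th0 sigma w) lam (thhat w)) ->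
  let thGL := fun w =>
    gauss_lasso (design Z A w) (response Z G A th0 sigma w) (thhat w) in
  (forall mu : R, 0 < mu ->
     (P [set w | (mu <= linf (thGL w - th0))%R] <=
      (p%:R * expR (- (n%:R / 10)) + 6 * expR (- (s0%:R / 2))
       + 8 * powR (p%:R) (1 - c1)
       + 2 * p%:R * expR (- (n%:R * Cmin * mu ^+ 2 / (2 * sigma ^+ 2))))%:E)%E)
  /\
  ((1 - p%:R * expR (- (n%:R / 10)) - 6 * expR (- (s0%:R / 2))
    - 10 * powR (p%:R) (1 - c1))%:E
     <= P [set w | selected_model (thGL w) s0 = S])%E.
Proof.
move=> iid AA Sigpos Sigd sigma0 xi00 minsg S s0 T0 t0 w0 Cmin0 Csig eta0 dual c11 lamE
  c20 betamin w0min etac M1 M3 nM fac _ mth las thGL.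
have lamE' : lam = 4 * sigma / eta * Num.sqrt ((c1 * ln p%:R) / n%:R) by [].
pose L := c1 * ln (p%:R : R).
have pe0 : 0 <= p%:R * expR (- (n%:R / 10)) :> R by rewrite mulr_ge0 ?expR_ge0.
have s60 : 0 <= expR (- (s0%:R / 2)) :> R by exact: expR_ge0.
have pw0 : 0 <= powR p%:R (1 - c1) :> R by exact: powR_ge0.
have mum mu : 0 <= 2 * p%:R * expR (- (n%:R * Cmin * mu ^+ 2 / (2 * sigma ^+ 2))) :> R.
  by rewrite !mulr_ge0 ?expR_ge0.
(* Both bounds are trivial once the first three terms reach 1. This settles an empty support,
   [n = 0] and [8 p^(1-c1) >= 1], and leaves exactly the extra hypotheses of the quantitative
   lemmas. *)
have trivial_case : 1 <= p%:R * expR (- (n%:R / 10)) + 6 * expR (- (s0%:R / 2))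
    + 8 * powR p%:R (1 - c1) :> R ->
    (forall mu : R, 0 < mu ->
     (P [set w | (mu <= linf (thGL w - th0))%R] <=
      (p%:R * expR (- (n%:R / 10)) + 6 * expR (- (s0%:R / 2))
       + 8 * powR (p%:R) (1 - c1)
       + 2 * p%:R * expR (- (n%:R * Cmin * mu ^+ 2 / (2 * sigma ^+ 2))))%:E)%E)
  /\
  ((1 - p%:R * expR (- (n%:R / 10)) - 6 * expR (- (s0%:R / 2))
    - 10 * powR (p%:R) (1 - c1))%:E
     <= P [set w | selected_model (thGL w) s0 = S])%E.
  move=> one; split=> [mu mu0|]; last first.
    apply: le_trans (measure_ge0 _ _); rewrite lee_fin.
    by lra.
  apply: le_trans (probability_le1 _ _) _.
    exact: (measurable_gauss_lasso_linf A th0 sigma iid mth).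
  by rewrite lee_fin; have := mum mu; lra.
have [s00|s_gt0] := posnP s0.
  by apply: trivial_case; rewrite s00 mul0r oppr0 expR0; lra.
have p_gt0 : (0 < p)%N by rewrite (leq_trans s_gt0)// -[leqRHS]card_ord max_card.
have pR : 1 <= p%:R :> R by rewrite ler1n.
have [n00|n_gt0] := posnP n.
  by apply: trivial_case; rewrite [X in - (X%:R / 10)]n00 mul0r oppr0 expR0; lra.
have pwE : powR p%:R (1 - c1) = p%:R * expR (- L).
  rewrite /powR pnatr_eq0 (gtn_eqF p_gt0) mulrBl mul1r expRD lnK// posrE.
  by rewrite ltr0n.
have [Lsmall|Lbig] := leP (expR L) (8 * p%:R).
  apply: trivial_case; rewrite pwE.
  have : 1 <= 8 * (p%:R * expR (- L)).
    by rewrite expRN mulrA ler_pdivlMr ?expR_gt0// mul1r.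
  by lra.
split=> [mu mu0|].
  have h := gauss_lasso_linf iid AA Sigpos Sigd sigma0 xi00 minsg Cmin0 Csig eta0 dual
    lamE' c20 betamin w0min etac nM mth las n_gt0 s_gt0 Lbig mu0.
  by apply: le_trans h _; rewrite lee_fin pwE -/s0; have := mum mu; lra.
have h := gauss_lasso_selection iid AA Sigpos Sigd sigma0 xi00 minsg Cmin0 Csig eta0 dual
  lamE' c20 betamin w0min etac nM mth las n_gt0 s_gt0 Lbig.
by apply: le_trans h; rewrite lee_fin pwE -/s0; lra.
Qed.
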